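(* Let $\pi\in\operatorname{Irr}(A)$ with corresponding orbit ${\mathcal O}$, and let $Q_\pi:S_c({\mathcal O})\to{\mathcal B}({\mathcal H}_\pi)$ be the map defined in the context. Then $Q_\pi$ determines a deformed product on $S_c({\mathcal O})$ by $Q_\pi(\phi\times_Q\psi)=Q_\pi(\phi)Q_\pi(\psi)$. The involution on $S_c({\mathcal O})$ is given by $Q_\pi(\psi^* )=Q_\pi(\psi)^*$. They are described as follows. (1) (The case of the 1-point orbit ${\mathcal O}_{p,q}$, $\pi=\pi_{p,q}$): for $\phi,\psi\in S_c({\mathcal O}_{p,q})$, $$(\phi\times_Q\psi)(p,q,0)=\phi(p,q,0)\psi(p,q,0),\qquad \psi^*(p,q,0)=\overline{\psi(p,q,0)}.$$ (2) (The case of the $2n$-dimensional orbit ${\mathcal O}_r$, $r\ne0$, $\pi=\pi_r$): for $\phi,\psi\in S_c({\mathcal O}_r)$, $$(\phi\times_Q\psi)(\alpha,\beta,r)=\int\phi(\tilde p,\beta,r)\,\psi\bigl(\alpha,\beta+\eta_\lambda(r)\tilde x,r\bigr)\,e\bigl[(\tilde p-\alpha)\cdot\tilde x\bigr]\,d\tilde p\,d\tilde x,$$ $$\psi^*(\alpha,\beta,r)=\int\overline{\psi(\tilde p,\tilde q,r)}\,\bar e\bigl[(\alpha-\tilde p)\cdot x+(\beta-\tilde q)\cdot y\bigr]\,\bar e\bigl[\eta_\lambda(r)x\cdot y\bigr]\,d\tilde p\,d\tilde q\,dx\,dy.$$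
   Context: Fix an integer $n\ge1$ and $\lambda\in\mathbb{R}$. Put $\eta_\lambda(r)=\frac{e^{2\lambda r}-1}{2\lambda}$ (and $\eta_\lambda(r)=r$ if $\lambda=0$), $e(t)=e^{2\pi i t}$, $\bar e(t)=e^{-2\pi i t}$. All unlabelled measures are Lebesgue measures. $\mathcal A$ is the $*$-algebra of Schwartz functions $f(x,y,r)$ on $\mathbb{R}^n\times\mathbb{R}^n\times\mathbb{R}$ having compact support in $r$, with $$(f\times g)(x,y,r)=\int f(\tilde x,\tilde y,r)\,g(x-\tilde x,y-\tilde y,r)\,\bar e[\eta_\lambda(r)\tilde x\cdot(y-\tilde y)]\,d\tilde x\,d\tilde y,\qquad f^*(x,y,r)=\overline{f(-x,-y,r)}\,\bar e[\eta_\lambda(r)x\cdot y].$$ The $C^*$-algebra $A$ is the operator norm closure of $\{L(f):f\in\mathcal A\}$ on $L^2(\mathbb{R}^{2n+1})$, where $L(f)\xi=f\times\xi$. Its irreducible $*$-representations, up to equivalence, form the set $\operatorname{Irr}(A)$ consisting of (the extensions to $A$ of): for $(p,q)\in\mathbb{R}^{2n}$, $\pi_{p,q}(f)=\int f(x,y,0)\bar e(p\cdot x+q\cdot y)\,dx\,dy$ on ${\mathcal H}_{\pi_{p,q}}=\mathbb{C}$; for $r\ne0$, $\pi_r(f)\xi(u)=\int f(x,y,r)\bar e(\eta_\lambda(r)u\cdot y)\xi(u+x)\,dx\,dy$ on ${\mathcal H}_{\pi_r}=L^2(\mathbb{R}^n)$. The orbits (dressing orbits, which are symplectic leaves) in $G=\{(p,q,r)\}=\mathbb{R}^{2n+1}$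 corresponding to $\pi_{p,q}$ and $\pi_r$ are ${\mathcal O}_{p,q}=\{(p,q,0)\}$ and ${\mathcal O}_r=\{(\alpha,\beta,r):(\alpha,\beta)\in\mathbb{R}^{2n}\}$, respectively. The canonical measure $d\theta$ is the unit point mass on ${\mathcal O}_{p,q}$, and $|\eta_\lambda(r)|^{-n}\,d\alpha\,d\beta$ on ${\mathcal O}_r$. $S_c({\mathcal O})$ is the space of Schwartz functions on ${\mathcal O}$ having compact support (where ${\mathcal O}_r$ is identified with $\mathbb{R}^{2n}$ via $(\alpha,\beta)$). For $f\in\mathcal A$, put $\hat f(p',q',r')=\int f(\tilde x,\tilde y,r')\bar e(p'\cdot\tilde x+q'\cdot\tilde y)\,d\tilde x\,d\tilde y$. The map $\pi(f)\mapsto\hat f|_{\mathcal O}$ ($f\in\mathcal A$) extends to a Hilbert space isomorphism from the Hilbert–Schmidt operators $HS({\mathcal H}_\pi)$ onto $L^2({\mathcal O},d\theta)$; its inverse is denoted $S_\pi:L^2({\mathcal O},d\theta)\to HS({\mathcal H}_\pi)$. $Q_\pi$ is the restriction of $S_\pi$ to $S_c({\mathcal O})$, regarded as a map into ${\mathcal B}({\mathcal H}_\pi)$ with the operator norm; so $Q_\pi(\phi)=\pi(f)$ for any $f\in\mathcal A$ with $\hat f|_{\mathcal O}=\phi$.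
   Formalization: S_c(O_r) is taken as all Schwartz functions on R^{2n}: for nonzero compactly supported ψ, ψ* is never compactly supported. The product is also shown to preserve compact support. The integral for ψ* is iterated, (p̃,q̃) first, then (x,y). *)

(* Defs.v *)
From HB Require Import structures.
From mathcomp Require Import all_boot all_order all_algebra complex.
From mathcomp Require Import all_classical all_reals all_analysis.
From mathcomp Require Import measurable_realfun ring.

Set Implicit Arguments.
Unset Strict Implicit.
Unset Printing Implicit Defensive.

Import Order.TTheory GRing.Theory Num.Theory.
Import numFieldNormedType.Exports.

Local Open Scope classical_set_scope.
Local Open Scope ring_scope.
Local Open Scope complex_scope.

(* The Borel sigma-algebra of R^n, generated by the coordinates. *)
Section rV_measurable.
Context (R : realType) (n : nat).

Let coors : 'I_n -> 'rV[R]_n -> measurableTypeR R := fun i v => v ord0 i.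

Let rV_set0 : g_sigma_preimage coors set0.
Proof. exact: sigma_algebra0. Qed.

Let rV_setC A : g_sigma_preimage coors A -> g_sigma_preimage coors (~` A).
Proof. exact: sigma_algebraC. Qed.

Let rV_bigcup (F : (set 'rV[R]_n)^nat) : (forall i, g_sigma_preimage coors (F i)) ->
  g_sigma_preimage coors (\bigcup_i (F i)).
Proof. exact: sigma_algebra_bigcup. Qed.

HB.instance Definition _ := @isMeasurable.Build default_measure_display
  'rV[R]_n (g_sigma_preimage coors) rV_set0 rV_setC rV_bigcup.

Lemma measurable_coord (i : 'I_n) :
  measurable_fun [set: 'rV[R]_n] (fun v => v ord0 i : measurableTypeR R).
Proof.
move=> _ Y mY; rewrite setTI; apply: sub_sigma_algebra => /=.
rewrite -bigcup_seq/=; exists i => /=; first by rewrite mem_index_enum.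
by exists Y => //; rewrite setTI.
Qed.

Lemma measurable_fun_rVP d (T : measurableType d) (f : T -> 'rV[R]_n) :
  (forall i, measurable_fun [set: T] (fun x => f x ord0 i : measurableTypeR R)) ->
  measurable_fun [set: T] f.
Proof.
move=> mf; suff : g_sigma_preimage (fun i => coors i \o f) `<=` measurable.
  rewrite g_sigma_preimage_comp => prefS _ A mA.
  by apply: prefS; exists A.
apply: smallest_sub; first exact: sigma_algebra_measurable.
rewrite -bigcup_seq; apply: bigcup_sub => i _ _ [B mB <-].
exact: mf.
Qed.

End rV_measurable.

(* The library proves this too, but its canonical instance for [m1 \x m2] is the
   one for subprobabilities. *)
Lemma sigma_finite_product d1 d2 (T1 : measurableType d1) (T2 : measurableType d2)
    (R : realType) (m1 : {sigma_finite_measure set T1 -> \bar R})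
    (m2 : {sigma_finite_measure set T2 -> \bar R}) :
  sigma_finite setT (m1 \x m2)%E.
Proof.
have /sigma_finiteP[F [TF ndF Foo]] := sigma_finiteT m1.
have /sigma_finiteP[G [TG ndG Goo]] := sigma_finiteT m2.
exists (fun n => F n `*` G n).
  rewrite -setXTT TF TG predeqE => -[x y]; split.
    move=> [/= [n _ Fnx] [k _ Gky]]; exists (maxn n k) => //; split.
    - by move: x Fnx; exact/subsetPset/ndF/leq_maxl.
    - by move: y Gky; exact/subsetPset/ndG/leq_maxr.
  by move=> [n _ []/= ? ?]; split; exists n.
move=> k; have [? ?] := Foo k; have [? ?] := Goo k.
split; first exact: measurableX.
by rewrite product_measure1E// lte_mul_pinfty// ge0_fin_numE.
Qed.

Section lebesgue_rV.
Context (R : realType).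

Section step.
Context (n : nat) (m : {sigma_finite_measure set 'rV[R]_n -> \bar R}).

Definition cons_rV (x : measurableTypeR R * 'rV[R]_n) : 'rV[R]_n.+1 :=
  row_mx (\row_(_ < 1) x.1) x.2.

Definition uncons_rV (v : 'rV[R]_n.+1) : measurableTypeR R * 'rV[R]_n :=
  (v ord0 ord0, \row_i v ord0 (lift ord0 i)).

Lemma cons_rVK : cancel cons_rV uncons_rV.
Proof.
move=> [x v]; rewrite /uncons_rV /cons_rV /=; congr pair.
  transitivity (row_mx (\row_(_ < 1) x) v ord0 (lshift n ord0)).
    by congr (row_mx _ _ _ _); exact: val_inj.
  by rewrite row_mxEl mxE.
apply/rowP => i; rewrite mxE.
transitivity (row_mx (\row_(_ < 1) x) v ord0 (rshift 1 i)).
  by congr (row_mx _ _ _ _); exact: val_inj.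
by rewrite row_mxEr.
Qed.

Lemma measurable_cons_rV : measurable_fun setT cons_rV.
Proof.
apply: measurable_fun_rVP => i; case: (@split_ordP 1 n i) => j ->.
  rewrite [X in measurable_fun _ X](_ : _ = fst); first exact: measurable_fst.
  apply/funext => x; transitivity ((\row_(_ < 1) x.1) ord0 j); last by rewrite mxE.
  exact: row_mxEl.
rewrite [X in measurable_fun _ X](_ : _ = (fun v : 'rV[R]_n => v ord0 j) \o snd).
  by apply: measurableT_comp; [exact: measurable_coord|exact: measurable_snd].
by apply/funext => x; exact: row_mxEr.
Qed.

Lemma measurable_uncons_rV : measurable_fun setT uncons_rV.
Proof.
apply/measurable_fun_pairP; split => /=; first exact: measurable_coord.
apply: measurable_fun_rVP => i.
by under eq_fun do rewrite /= mxE; exact: measurable_coord.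
Qed.

Definition lebesgue_step : set 'rV[R]_n.+1 -> \bar R :=
  pushforward (lebesgue_measure \x m)%E cons_rV.

Let mstep := measure_function_pushforward__canonical__measure_function_Measure
  (lebesgue_measure \x m)%E measurable_cons_rV.

HB.instance Definition _ := isMeasure.Build _ _ _ lebesgue_step
  (measure0 mstep) (measure_ge0 mstep) (@measure_semi_sigma_additive _ _ _ mstep).

Let lebesgue_step_sigma_finite : sigma_finite setT lebesgue_step.
Proof.
have [F TF Foo] := sigma_finite_product lebesgue_measure m.
exists (fun k => uncons_rV @^-1` F k).
  by rewrite -preimage_bigcup -TF preimage_setT.
move=> k; have [mF Fk] := Foo k; split.
  by rewrite -[X in measurable X]setTI; exact: measurable_uncons_rV.
by rewrite /lebesgue_step /pushforward -comp_preimage (_ : _ \o _ = id) ?preimage_id//;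
  apply/funext => x /=; exact: cons_rVK.
Qed.

HB.instance Definition _ := Measure_isSigmaFinite.Build _ _ _ lebesgue_step
  lebesgue_step_sigma_finite.

End step.

(* Lebesgue measure on R^n, as an iterated product; R^0 is a point of mass 1. *)
Fixpoint leb (n : nat) : {sigma_finite_measure set 'rV[R]_n -> \bar R} :=
  match n with
  | 0 => \d_(0 : 'rV[R]_0)
  | k.+1 => lebesgue_step (leb k)
  end.

End lebesgue_rV.
(* [Re] and [Im] would otherwise be the projections of a [numClosedFieldType]. *)
Local Notation Re := (@complex.Re _).
Local Notation Im := (@complex.Im _).

(* [Rintegral] is junk on non-integrable parts, as for real-valued functions. *)
Definition cintegral d (T : measurableType d) (R : realType)
    (mu : {measure set T -> \bar R}) (f : T -> R[i]) : R[i] :=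
  (\int[mu]_x Re (f x)) +i* (\int[mu]_x Im (f x)).

Reserved Notation "\cint [ mu ]_ x F"
  (at level 36, F at level 36, mu at level 10, x at level 0,
   format "'[' \cint [ mu ]_ x '/  '  F ']'").
Notation "\cint [ mu ]_ x F" := (cintegral mu (fun x => F)) : ring_scope.

Section L2.
Context d (T : measurableType d) (R : realType).
Variable mu : {measure set T -> \bar R}.

Definition sqnormc (z : R[i]) : R := Re z ^+ 2 + Im z ^+ 2.

Definition is_L2 (f : T -> R[i]) : Prop :=
  [/\ measurable_fun setT (fun x => Re (f x)),
      measurable_fun setT (fun x => Im (f x)) &
      (\int[mu]_x (sqnormc (f x))%:E < +oo)%E].

Definition L2_pred : {pred T -> R[i]} := fun f => `[< is_L2 f >].

Lemma measurable_sqnormc (f : T -> R[i]) :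
  measurable_fun setT (fun x => Re (f x)) ->
  measurable_fun setT (fun x => Im (f x)) ->
  measurable_fun setT (fun x => sqnormc (f x)).
Proof.
by move=> mr mi; apply: measurable_funD; exact: measurable_funX.
Qed.

Lemma sqnormc_ge0 z : 0 <= sqnormc z.
Proof. by rewrite addr_ge0 ?sqr_ge0. Qed.

Lemma sqnormcD_le a z w :
  sqnormc (a * z + w) <= 2 * sqnormc a * sqnormc z + 2 * sqnormc w.
Proof.
have -> : 2 * sqnormc a * sqnormc z + 2 * sqnormc w =
    sqnormc (a * z + w) + sqnormc (a * z - w).
  by rewrite /sqnormc; case: a z w => [a b] [x y] [u v] /=; ring.
by rewrite lerDl sqnormc_ge0.
Qed.

Lemma L2_submod_closed : submod_closed L2_pred.
Proof.
split.
  apply/asboolP; split; [exact: measurable_cst|exact: measurable_cst|].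
  rewrite integral0_eq ?ltry// => x _.
  by rewrite /sqnormc /= expr0n addr0.
move=> a f g /asboolP[fr fi ffin] /asboolP[gr gi gfin]; apply/asboolP.
have mr : measurable_fun setT (fun x => Re ((a *: f + g) x)).
  rewrite (_ : (fun _ => _) =
    (fun x => Re a * Re (f x) - Im a * Im (f x) + Re (g x))); last first.
    by apply/funext => x; rewrite /GRing.add /GRing.scale /=; case: (a) (f x) (g x) => [? ?] [? ?] [? ?].
  apply: measurable_funD => //.
  by apply: measurable_funB; exact: measurable_funM.
have mi : measurable_fun setT (fun x => Im ((a *: f + g) x)).
  rewrite (_ : (fun _ => _) =
    (fun x => Re a * Im (f x) + Im a * Re (f x) + Im (g x))); last first.
    by apply/funext => x; rewrite /GRing.add /GRing.scale /=; case: (a) (f x) (g x) => [? ?] [? ?] [? ?].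
  apply: measurable_funD => //.
  by apply: measurable_funD; exact: measurable_funM.
split => //.
have /measurable_EFinP mf := measurable_sqnormc fr fi.
have /measurable_EFinP mg := measurable_sqnormc gr gi.
have a0 : 0 <= 2 * sqnormc a by rewrite mulr_ge0 ?sqnormc_ge0.
apply: (@le_lt_trans _ _
  (\int[mu]_x ((2 * sqnormc a)%:E * (sqnormc (f x))%:E
              + 2%:E * (sqnormc (g x))%:E))%E).
  apply: ge0_le_integral => //.
  - by move=> x _; rewrite lee_fin sqnormc_ge0.
  - by apply/measurable_EFinP; exact: measurable_sqnormc.
  - by apply: emeasurable_funD; exact: measurable_funeM.
  - by move=> x _; rewrite -!EFinM -EFinD lee_fin; exact: sqnormcD_le.
rewrite ge0_integralD//.
- rewrite !ge0_integralZl//; try by move=> x _; rewrite lee_fin sqnormc_ge0.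
  by rewrite lte_add_pinfty// lte_mul_pinfty// lee_fin.
- by move=> x _; rewrite -EFinM lee_fin mulr_ge0 ?sqnormc_ge0.
- exact: measurable_funeM.
- by move=> x _; rewrite -EFinM lee_fin mulr_ge0 ?sqnormc_ge0.
- exact: measurable_funeM.
Qed.

HB.instance Definition _ :=
  GRing.isSubmodClosed.Build _ _ L2_pred L2_submod_closed.

Record L2fun := MkL2fun { L2fun_val : T -> R[i]; _ : L2fun_val \in L2_pred }.

HB.instance Definition _ := [isSub for L2fun_val].
HB.instance Definition _ := [Choice of L2fun by <:].
HB.instance Definition _ := [SubChoice_isSubLmodule of L2fun by <:].

Definition L2null : {pred L2fun} :=
  fun f => `[< {ae mu, forall x, L2fun_val f x = 0} >].

Lemma L2null_zmod_closed : zmod_closed L2null.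
Proof.
split; first by apply/asboolP; apply: aeW.
move=> f g /asboolP f0 /asboolP g0; apply/asboolP.
by apply: filterS2 f0 g0 => x /= fx gx; rewrite /GRing.add /GRing.opp /= fx gx subrr.
Qed.

HB.instance Definition _ :=
  GRing.isZmodClosed.Build _ L2null L2null_zmod_closed.

Definition L2 : Type := Quotient.quot L2null.

HB.instance Definition _ := Choice.on L2.
HB.instance Definition _ := EqQuotient.on L2.
HB.instance Definition _ := GRing.Zmodule.on L2.

Local Open Scope quotient_scope.

Definition L2scale (a : R[i]) (xi : L2) : L2 := \pi_L2 (a *: repr xi).

Lemma L2null_scale a (f : L2fun) : f \in L2null -> a *: f \in L2null.
Proof.
move=> /asboolP f0; apply/asboolP; apply: filterS f0 => x fx.
by rewrite -[LHS]/(a * L2fun_val f x) fx mulr0.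
Qed.

Lemma pi_L2scale a (f : L2fun) : L2scale a (\pi_L2 f) = \pi_L2 (a *: f).
Proof.
apply/eqP; rewrite /L2scale -Quotient.idealrBE -scalerBr; apply: L2null_scale.
by rewrite Quotient.idealrBE reprK.
Qed.

Lemma pi_L2D (f g : L2fun) : \pi_L2 (f + g) = \pi_L2 f + \pi_L2 g.
Proof. exact: (Quotient.pi_add L2null). Qed.

Lemma L2scaleA a b (xi : L2) : L2scale a (L2scale b xi) = L2scale (a * b) xi.
Proof. by rewrite -[xi]reprK; move: (repr xi) => f; rewrite (pi_L2scale b) !pi_L2scale scalerA. Qed.

Lemma L2scale1 : left_id 1 L2scale.
Proof. by move=> xi; rewrite -[xi]reprK; move: (repr xi) => f; rewrite pi_L2scale scale1r. Qed.

Lemma L2scaleDr : right_distributive L2scale +%R.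
Proof.
move=> a xi zeta; rewrite -[xi]reprK -[zeta]reprK.
by move: (repr xi) (repr zeta) => f g; rewrite -pi_L2D !pi_L2scale scalerDr pi_L2D.
Qed.

Lemma L2scaleDl (xi : L2) : {morph L2scale^~ xi : a b / a + b}.
Proof. 
move=> a b; rewrite -[xi]reprK; move: (repr xi) => f.
by rewrite !pi_L2scale scalerDl pi_L2D.
 Qed.

HB.instance Definition _ := GRing.Zmodule_isLmodule.Build R[i] L2
  L2scaleA L2scale1 L2scaleDr L2scaleDl.

Definition L2rep (xi : L2) : T -> R[i] := L2fun_val (repr xi).

(* The class of [f]; 0 if [f] is not square integrable. *)
Definition toL2 (f : T -> R[i]) : L2 := \pi_L2 (insubd (0 : L2fun) f).

Definition L2inner (xi zeta : L2) : R[i] :=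
  \cint[mu]_x (L2rep xi x * conjc (L2rep zeta x)).

End L2.

Section schwartz.
Context (R : realType) (V : normedModType R).

Definition iter_derive (vs : seq V) (g : V -> R) : V -> R :=
  foldr (fun v h => 'D_v h) g vs.

(* Derivatives are taken along arbitrary vectors rather than along a basis; for
   V of finite dimension this is the usual Schwartz space. *)
Definition schwartz_real (g : V -> R) : Prop :=
  (forall vs v x, derivable (iter_derive vs g) x v) /\
  (forall vs k, exists M, forall x, `|x| ^+ k * `|iter_derive vs g x| <= M).

Definition schwartz (f : V -> R[i]) : Prop :=
  schwartz_real (fun x => Re (f x)) /\ schwartz_real (fun x => Im (f x)).

Definition compactly_supported (f : V -> R[i]) : Prop :=
  exists M, forall x, M < `|x| -> f x = 0.

End schwartz.

Section setup.
Context (R : realType).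

(* e^(2 pi i t) *)
Definition e (t : R) : R[i] := cos (2 * pi * t) +i* sin (2 * pi * t).
Definition ebar (t : R) : R[i] := e (- t).

Definition eta (lam r : R) : R :=
  if lam == 0 then r else (expR (2 * lam * r) - 1) / (2 * lam).

Context (n : nat).

Definition dot (u v : 'rV[R]_n) : R := \sum_(i < n) u ord0 i * v ord0 i.

Definition leb2 : {measure set ('rV[R]_n * 'rV[R]_n) -> \bar R} :=
  (leb R n \x leb R n)%E.

(* The space of the (p, q, r), and also that of the (x, y, r). *)
Local Notation G := ('rV[R]_n * 'rV[R]_n * R)%type.

Definition calA (f : G -> R[i]) : Prop :=
  schwartz f /\
  exists M, forall x y r, M < `|r| -> f (x, y, r) = 0.

Definition fhat (f : G -> R[i]) : G -> R[i] := fun g =>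
  \cint[leb2]_z (f (z.1, z.2, g.2) * ebar (dot g.1.1 z.1 + dot g.1.2 z.2)).

(* Irr(A), as the list of its members. *)
Inductive irrep :=
  | irr_pt (p q : 'rV[R]_n)
  | irr_orb (r : R) (r0 : r != 0).

(* The orbit of a representation, through its coordinates: a point, or the
   (alpha, beta). *)
Definition orbit (rho : irrep) : Type :=
  match rho with
  | irr_pt _ _ => unit
  | irr_orb _ _ => ('rV[R]_n * 'rV[R]_n)%type
  end.

Definition orbit_incl (rho : irrep) : orbit rho -> G :=
  match rho with
  | irr_pt p q => fun _ => (p, q, 0)
  | irr_orb r _ => fun z => (z.1, z.2, r)
  end.

Definition Schwartz_orbit (rho : irrep) : (orbit rho -> R[i]) -> Prop :=
  match rho with
  | irr_pt _ _ => fun _ => True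
  | irr_orb _ _ => fun phi => schwartz phi
  end.

(* S_c(O): as in the algebra [calA], the compact support is in the variable r,
   hence automatic on an orbit. *)
Record Sc (rho : irrep) := MkSc {
  Sc_fun :> orbit rho -> R[i];
  Sc_prop : Schwartz_orbit Sc_fun }.

Section representation.
Context (lam : R).

Definition emb (r : R) (z : 'rV[R]_n * 'rV[R]_n) : G := (z.1, z.2, r).

Lemma measurable_emb r : measurable_fun setT (emb r).
Proof.
apply/measurable_fun_pairP; split => /=; last exact: measurable_cst.
by rewrite (_ : _ \o _ = id)//; apply/funext => -[].
Qed.

(* The canonical measure of an orbit, as a measure on G concentrated on it. *)
Definition dtheta (rho : irrep) : {measure set G -> \bar R} :=
  match rho with
  | irr_pt p q => \d_((p, q, 0) : G)
  | irr_orb r _ =>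
      measure_function_pushforward__canonical__measure_function_Measure
        (mscale (`|eta lam r| ^- n)%:nng leb2) (measurable_emb r)
  end.

Definition hilb (rho : irrep) : lmodType R[i] :=
  match rho with
  | irr_pt _ _ => R[i]
  | irr_orb _ _ => L2 (leb R n)
  end.

Definition inner (rho : irrep) : hilb rho -> hilb rho -> R[i] :=
  match rho with
  | irr_pt _ _ => fun z w => z * conjc w
  | irr_orb _ _ => @L2inner _ _ _ (leb R n)
  end.

Definition hnorm (rho : irrep) (xi : hilb rho) : R :=
  Num.sqrt (Re (inner xi xi)).

Definition bounded_operator (rho : irrep) (A : hilb rho -> hilb rho) : Prop :=
  linear A /\ exists M, forall xi, hnorm (A xi) <= M * hnorm xi.

Definition adjoint (rho : irrep) (A B : hilb rho -> hilb rho) : Prop :=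
  forall xi zeta, inner (A xi) zeta = inner xi (B zeta).

Definition orthonormal_basis (rho : irrep) (I : choiceType)
    (b : I -> hilb rho) : Prop :=
  (forall i j, inner (b i) (b j) = (i == j)%:R) /\
  (forall xi, (forall i, inner xi (b i) = 0) -> xi = 0).

Definition HS_sqnorm (rho : irrep) (I : choiceType) (b : I -> hilb rho)
    (A : hilb rho -> hilb rho) : \bar R :=
  (\esum_(i in [set: I]) (hnorm (A (b i)) ^+ 2)%:E)%E.

Definition hilbert_schmidt (rho : irrep) (A : hilb rho -> hilb rho) : Prop :=
  bounded_operator A /\
  exists (I : choiceType) (b : I -> hilb rho),
    orthonormal_basis b /\ (HS_sqnorm b A < +oo)%E.

Definition rep (rho : irrep) (f : G -> R[i]) : hilb rho -> hilb rho :=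
  match rho with
  | irr_pt p q => fun z =>
      (\cint[leb2]_w (f (w.1, w.2, 0) * ebar (dot p w.1 + dot q w.2))) * z
  | irr_orb r _ => fun xi =>
      toL2 (leb R n) (fun u =>
        \cint[leb2]_w (f (w.1, w.2, r) * ebar (eta lam r * dot u w.2)
                       * L2rep xi (u + w.1)))
  end.

(* S is the inverse of the Hilbert space isomorphism from the Hilbert-Schmidt
   operators onto L^2(O, dtheta) which extends rep f |-> fhat f; for a linear map,
   preserving the norms is the same as preserving the inner products. *)
Record is_S (rho : irrep)
    (S : L2 (dtheta rho) -> hilb rho -> hilb rho) : Prop := IsS {
  S_bounded : forall F, bounded_operator (S F);
  S_linear : forall a F1 F2 xi, S (a *: F1 + F2) xi = a *: S F1 xi + S F2 xi;
  S_isometry : forall F (I : choiceType) (b : I -> hilb rho),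
    orthonormal_basis b -> HS_sqnorm b (S F) = (Re (L2inner F F))%:E;
  S_onto : forall A, hilbert_schmidt A -> exists F, S F = A;
  S_rep : forall f, calA f -> S (toL2 (dtheta rho) (fhat f)) = @rep rho f }.

(* A function on an orbit as an element of L^2(O, dtheta); its values off the
   orbit are irrelevant. *)
Definition orbit_class (rho : irrep) : (orbit rho -> R[i]) -> L2 (dtheta rho) :=
  match rho with
  | irr_pt p q => fun phi => toL2 (dtheta (irr_pt p q)) (fun=> phi tt)
  | irr_orb r r0 => fun phi => toL2 (dtheta (irr_orb r0)) (fun g => phi g.1)
  end.

Definition restriction (rho : irrep) (f : G -> R[i]) : orbit rho -> R[i] :=
  fun z => f (orbit_incl z).

(* The choice of f is immaterial, and this is the restriction of the above S to
   S_c(O): both are part of the theorem. *)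
Definition Q (rho : irrep) (phi : orbit rho -> R[i]) : hilb rho -> hilb rho :=
  rep (xget (fun=> 0) [set f | calA f /\ @restriction rho (fhat f) = phi]).

Definition deformed_product (rho : irrep) (mul : Sc rho -> Sc rho -> Sc rho) :
    Prop :=
  forall phi psi : Sc rho, Q (mul phi psi) = Q phi \o Q psi.

Definition deformed_involution (rho : irrep) (star : Sc rho -> Sc rho) : Prop :=
  forall psi : Sc rho, adjoint (Q psi) (Q (star psi)).

End representation.
End setup.

Arguments irr_pt {R n} p q.
Arguments irr_orb {R n} r r0.
Arguments rep {R n} lam rho f.
Arguments restriction {R n} rho f.
Arguments is_S {R n} lam rho S.

(* Main.v *)
(* Let F be the Fourier transform in the first variable. For a Schwartz function phi
   on O_r put k_phi (u, v) = (F^-1 phi) (v - u, eta_lambda(r) u). Undoing the Fourier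
   transform in p shows that pi_r(f) is the integral operator with kernel k_phi, where
   phi is the restriction of fhat f to O_r; multiplying the inverse transform of phi by
   a bump function in r shows that every phi arises in this way. Thus Q phi is the
   operator with kernel k_phi. These kernels are Schwartz functions on R^(2n), hence
   dominated by a product of bounded integrable weights; operators with such kernels
   are bounded, compose and have adjoints by the usual formulas for kernels, and
   determine their kernels. The product and the involution are therefore obtained by
   applying the inverse of phi |-> k_phi to the composed and to the adjoint kernel.
   Everything rests on Fourier inversion for Schwartz functions, proved in one variable
   with Poisson kernels and extended to R^n one coordinate at a time. *)
Require Import Defs.
From mathcomp Require Import all_boot all_order all_algebra complex.
From mathcomp Require Import all_classical all_reals all_analysis.
From mathcomp Require Import measurable_realfun ring lra.

Set Implicit Arguments.
Unset Strict Implicit.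
Unset Printing Implicit Defensive.

Import Order.TTheory GRing.Theory Num.Theory.
Import numFieldNormedType.Exports.

Local Open Scope classical_set_scope.
Local Open Scope ring_scope.
Local Open Scope complex_scope.

(* [Re] and [Im] would otherwise be the projections of a [numClosedFieldType]. *)
Local Notation Re := (@complex.Re _).
Local Notation Im := (@complex.Im _).
Local Notation normc := (@ComplexField.Normc.normc _).

(** * Measurability and dominated integrals *)

(** Schwartz functions are given here by directional derivatives, which yield continuity along lines
    but not jointly. Measurability therefore rests on separate continuity, and new functions are
    shown to be Schwartz inside classes closed under differentiation rather than by formulas for
    iterated derivatives. The transforms carry a parameter from a normed space: untransformed
    coordinates and [r] live there, so one-variable results iterate over the coordinates and give
    functions Schwartz jointly with the parameters. Poisson kernels are convenient because damping
    by e^(-eps |x|) leaves integrals with elementary antiderivatives, and rescaling turns the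
    kernels into the fixed density 1 / (pi (1 + y^2)); up to the factor pi, a product of such
    densities is also the weight dominating Schwartz functions on R^n. Bounds by products of
    functions of one variable each make every section integrable, so kernels are compared at points,
    not only almost everywhere. In the involution the modulus of the integrand does not depend on
    the outer variables; the orders cannot be exchanged, and the inner integral is evaluated first,
    which restores decay. *)

Section caratheodory.
Context d (T : measurableType d) (R : realType).

Lemma dyadic_floor_cvg (t : R) :
  (Num.floor (t * k.+1%:R))%:~R / k.+1%:R @[k --> \oo] --> t.
Proof.
apply/cvgrPdist_le => eps eps0; near=> k.
have k0 : 0 < k.+1%:R :> R by rewrite ltr0n.
rewrite (_ : t - _ = (t * k.+1%:R - (Num.floor (t * k.+1%:R))%:~R) / k.+1%:R).
  have /andP[h1 h2] := floor_itv (t * k.+1%:R).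
  rewrite normrM normfV (gtr0_norm k0) ler_pdivrMr// ger0_norm ?subr_ge0//.
  apply: (@le_trans _ _ 1); first by rewrite lerBlDr addrC; apply: ltW; move: h2; rewrite intrD.
  rewrite -ler_pdivrMl// mulr1.
  by rewrite (@le_trans _ _ k%:R) ?ler_nat//; near: k; exact: nbhs_infty_ger.
by rewrite mulrBl mulfK ?gt_eqF.
Unshelve. all: by end_near. Qed.

(** Carathéodory's argument: rounding [t] down to the grid of mesh [1 / (k + 1)] leaves countably
    many sections of [f], so the rounded functions are measurable, and they converge pointwise to
    [f] by continuity in [t]. *)
Lemma measurable_separately_continuous (f : T * R -> R) :
  (forall t, measurable_fun setT (fun x => f (x, t))) ->
  (forall x, continuous (fun t => f (x, t))) -> measurable_fun setT f.
Proof.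
move=> mf cf.
pose g (k : nat) (p : T * R) := f (p.1, (Num.floor (p.2 * k.+1%:R))%:~R / k.+1%:R).
apply: (@measurable_fun_cvg _ _ _ _ g) => [k|[x t] _]; last first.
  have := cvg_comp _ _ (@dyadic_floor_cvg t) (cf x t).
  exact.
move=> _ Y mY; rewrite setTI.
have -> : g k @^-1` Y = \bigcup_(j : int) (((fun x => f (x, j%:~R / k.+1%:R)) @^-1` Y) `*`
    [set t | Num.floor (t * k.+1%:R) == j]).
  apply/seteqP; split => [[x t] /= h|[x t] [j _ [/= h /eqP jE]]].
    by exists (Num.floor (t * k.+1%:R)) => //; split => /=.
  by rewrite /g/= jE.
apply: countable_bigcupT_measurable => // j; apply: measurableX.
  by rewrite -[X in measurable X]setTI; exact: mf.
have k0 : 0 < k.+1%:R :> R by rewrite ltr0n.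
rewrite (_ : [set t | _] = `[j%:~R / k.+1%:R, (j + 1)%:~R / k.+1%:R[%classic); last first.
  apply/seteqP; split => t /=; rewrite floor_eq in_itv/=;
  by rewrite ler_pdivrMr// ltr_pdivlMr.
exact: measurable_itv.
Qed.

End caratheodory.

Section real_integrals.
Context d (T : measurableType d) (R : realType) (mu : {measure set T -> \bar R}).
Implicit Types (f g : T -> R).

Definition rintegrable f := mu.-integrable setT (EFin \o f).

Lemma rintegrable_measurable f : rintegrable f -> measurable_fun setT f.
Proof. by move=> /measurable_int/measurable_EFinP. Qed.

Lemma rintegrable_le f g : measurable_fun setT f -> rintegrable g ->
  (forall x, `|f x| <= g x) -> rintegrable f.
Proof.
move=> mf ig fg; apply: (le_integrable measurableT _ _ ig) => /=.
  exact/measurable_EFinP.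
by move=> x _; rewrite lee_fin (le_trans (fg x))// ler_norm.
Qed.

Lemma rintegrable_norm f : rintegrable f -> rintegrable (fun x => `|f x|).
Proof. by move=> /integrable_abse. Qed.

Lemma rintegrableZ k f : rintegrable f -> rintegrable (fun x => k * f x).
Proof.
by move=> /(integrableZl measurableT k); apply: eq_integrable => // x _ /=; rewrite EFinM.
Qed.

Lemma rintegrableD f g : rintegrable f -> rintegrable g ->
  rintegrable (fun x => f x + g x).
Proof.
by move=> h1 h2; have := integrableD measurableT h1 h2; apply: eq_integrable.
Qed.

Lemma eq_Rintegral_ae f g : measurable_fun setT f -> measurable_fun setT g ->
  {ae mu, forall x, f x = g x} -> \int[mu]_x f x = \int[mu]_x g x.
Proof.
move=> mf mg fg; rewrite /Rintegral; congr fine.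
apply: ae_eq_integral => //; [exact/measurable_EFinP|exact/measurable_EFinP|].
by apply: filterS fg => x /= -> _.
Qed.

Lemma RintegralN f : rintegrable f -> \int[mu]_x (- f x) = - \int[mu]_x f x.
Proof.
move=> intf; rewrite -mulN1r -RintegralZl//; apply: eq_Rintegral => x _.
by rewrite mulN1r.
Qed.

Lemma EFin_Rintegral f : rintegrable f ->
  (\int[mu]_x f x)%:E = (\int[mu]_x (f x)%:E)%E.
Proof. by move=> /(integrable_fin_num measurableT) h; rewrite /Rintegral fineK. Qed.

Lemma ge0_rintegrable f : measurable_fun setT f -> (forall x, 0 <= f x) ->
  (\int[mu]_x (f x)%:E < +oo)%E -> rintegrable f.
Proof.
move=> mf f0 foo; apply/integrableP; split; first exact/measurable_EFinP.
apply: le_lt_trans foo; rewrite le_eqVlt; apply/orP; left; apply/eqP.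
by apply: eq_integral => x _ /=; rewrite ger0_norm.
Qed.

Lemma rintegrable_lty f : rintegrable f -> (\int[mu]_x (`|f x|)%:E < +oo)%E.
Proof. by move=> /integrableP[_]. Qed.

End real_integrals.

(** * Fubini for integrands dominated by a product *)

Section dominated_fubini.
Context d1 d2 (T1 : measurableType d1) (T2 : measurableType d2) (R : realType).
Variables (m1 : {sigma_finite_measure set T1 -> \bar R})
          (m2 : {sigma_finite_measure set T2 -> \bar R}).
Variables (f : T1 * T2 -> R) (a : T1 -> R) (b : T2 -> R).
Hypotheses (mf : measurable_fun setT f).
Hypotheses (ia : rintegrable m1 a) (ib : rintegrable m2 b).
Hypothesis fab : forall x y, `|f (x, y)| <= a x * b y.

(** The product bound makes every section integrable, not only almost every one, so the iterated
    integrals below involve no default value of [Rintegral]. *)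
Lemma fub_section1 x : rintegrable m2 (fun y => f (x, y)).
Proof.
apply: rintegrable_le (rintegrableZ (a x) ib) _ => //.
exact: measurableT_comp.
Qed.

Lemma fub_section2 y : rintegrable m1 (fun x => f (x, y)).
Proof.
apply: (rintegrable_le _ (rintegrableZ (b y) ia)).
  exact: measurableT_comp.
by move=> x; rewrite mulrC.
Qed.

Lemma fub_prod : rintegrable (m1 \x m2)%E f.
Proof.
have ma := rintegrable_measurable ia.
have mb := rintegrable_measurable ib.
apply/integrable12ltyP => /=; first exact/measurable_EFinP.
apply: (@le_lt_trans _ _ (\int[m1]_x \int[m2]_y (`|a x|%:E * `|b y|%:E))%E).
  apply: ge0_le_integral => //.
  - by move=> x _; exact: integral_ge0.
  - apply: (measurable_fun_fubini_tonelli_F (abse \o (EFin \o f))) => //=.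
    by apply: measurableT_comp => //; apply/measurable_EFinP.
  - have mab : measurable_fun setT (fun p : T1 * T2 => (`|a p.1|%:E * `|b p.2|%:E)%E).
      apply: emeasurable_funM; apply/measurable_EFinP; apply: measurableT_comp => //;
      exact: measurableT_comp.
    apply: (measurable_fun_fubini_tonelli_F (fun p : T1 * T2 => (`|a p.1|%:E * `|b p.2|%:E)%E)) => //=.
  - move=> x _; apply: ge0_le_integral => //.
    + by apply/measurable_EFinP; do 2 apply: measurableT_comp => //.
    + apply: emeasurable_funM => //; apply/measurable_EFinP; exact: measurableT_comp.
    + by move=> y _; rewrite -EFinM lee_fin -normrM (le_trans (fab x y))// ler_norm.
have mb' : measurable_fun setT (fun y => `|b y|%:E).
  by apply/measurable_EFinP; apply: measurableT_comp.
rewrite (eq_integral (fun x => `|a x|%:E * \int[m2]_y `|b y|%:E)%E); last first.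
  by move=> x _; rewrite ge0_integralZl.
rewrite ge0_integralZr//=.
- apply: lte_mul_pinfty; [exact: integral_ge0| |exact: rintegrable_lty].
  exact: (integrable_fin_num measurableT (rintegrable_norm ia)).
- by apply/measurable_EFinP; apply: measurableT_comp.
- exact: integral_ge0.
Qed.

Let finF x : (\int[m2]_y (f (x, y))%:E)%E = (\int[m2]_y f (x, y))%:E.
Proof. by rewrite EFin_Rintegral//; exact: fub_section1. Qed.

Let finG y : (\int[m1]_x (f (x, y))%:E)%E = (\int[m1]_x f (x, y))%:E.
Proof. by rewrite EFin_Rintegral//; exact: fub_section2. Qed.

Lemma fub_int1 : rintegrable m1 (fun x => \int[m2]_y f (x, y)).
Proof.
have := integrable_fubini_F fub_prod; apply: eq_integrable => // x _.
by rewrite /= -finF.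
Qed.

Lemma Rfub1 : \int[(m1 \x m2)%E]_z f z = \int[m1]_x \int[m2]_y f (x, y).
Proof.
rewrite /Rintegral -(integral12_prod_meas1 fub_prod); congr fine.
by apply: eq_integral => x _; rewrite -finF.
Qed.

Lemma Rfub2 : \int[(m1 \x m2)%E]_z f z = \int[m2]_y \int[m1]_x f (x, y).
Proof.
rewrite /Rintegral -(integral21_prod_meas1 fub_prod); congr fine.
by apply: eq_integral => x _; rewrite -finG.
Qed.

End dominated_fubini.

(** * Complex-valued integrals *)

Section complex_modulus.
Context (R : realType).
Implicit Types z w : R[i].

Lemma complexP z w : Re z = Re w -> Im z = Im w -> z = w.
Proof. by case: z w => [a b] [c d] /= -> ->. Qed.

Lemma ReD z w : Re (z + w) = Re z + Re w. Proof. by case: z w => [a b] [c d]. Qed.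
Lemma ImD z w : Im (z + w) = Im z + Im w. Proof. by case: z w => [a b] [c d]. Qed.
Lemma ReM z w : Re (z * w) = Re z * Re w - Im z * Im w.
Proof. by case: z w => [a b] [c d]. Qed.
Lemma ImM z w : Im (z * w) = Re z * Im w + Im z * Re w.
Proof. by case: z w => [a b] [c d]. Qed.
Lemma Reconj z : Re (conjc z) = Re z. Proof. by case: z. Qed.
Lemma Imconj z : Im (conjc z) = - Im z. Proof. by case: z. Qed.

Lemma normcE_sqrt z : normc z = Num.sqrt (sqnormc z).
Proof. by case: z. Qed.

Lemma normc_ge0 z : 0 <= normc z.
Proof. by rewrite normcE_sqrt sqrtr_ge0. Qed.

Lemma sqr_normcE z : normc z ^+ 2 = sqnormc z.
Proof. by rewrite normcE_sqrt sqr_sqrtr// sqnormc_ge0. Qed.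

Lemma normcM z w : normc (z * w) = normc z * normc w.
Proof. exact: ComplexField.Normc.normcM. Qed.

Lemma normc_conj z : normc (conjc z) = normc z.
Proof. by rewrite !normcE_sqrt /sqnormc Reconj Imconj sqrrN. Qed.

Lemma Re_le_normc z : `|Re z| <= normc z.
Proof.
by rewrite normcE_sqrt -sqrtr_sqr ler_wsqrtr// /sqnormc lerDl sqr_ge0.
Qed.

Lemma Im_le_normc z : `|Im z| <= normc z.
Proof.
by rewrite normcE_sqrt -sqrtr_sqr ler_wsqrtr// /sqnormc lerDr sqr_ge0.
Qed.

Lemma normc_le z : normc z <= `|Re z| + `|Im z|.
Proof.
rewrite normcE_sqrt -(@ler_pXn2r _ 2)// ?nnegrE ?addr_ge0 ?sqrtr_ge0//.
rewrite sqr_sqrtr ?sqnormc_ge0// /sqnormc sqrrD !real_normK ?num_real//.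
by rewrite lerD2r lerDl mulrn_wge0// mulr_ge0.
Qed.

Lemma normc_e (t : R) : normc (e t) = 1.
Proof. by rewrite normcE_sqrt /sqnormc /= cos2Dsin2 sqrtr1. Qed.

Lemma normc_ebar (t : R) : normc (ebar t) = 1.
Proof. exact: normc_e. Qed.

Lemma eD (s t : R) : e (s + t) = e s * e t.
Proof.
by rewrite /e mulrDr; apply: complexP; rewrite ?ReM ?ImM/= ?cosD ?sinD//; ring.
Qed.

Lemma e0 : e (0 : R) = 1.
Proof. by rewrite /e mulr0 cos0 sin0. Qed.

Lemma conj_e (t : R) : conjc (e t) = e (- t).
Proof. by apply: complexP; rewrite ?Reconj ?Imconj /= mulrN ?cosN ?sinN. Qed.

End complex_modulus.

Section complex_integral.
Context d (T : measurableType d) (R : realType).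
Implicit Types (f g : T -> R[i]) (mu : {measure set T -> \bar R}).

Definition cmeasurable f :=
  measurable_fun setT (fun x => Re (f x)) /\ measurable_fun setT (fun x => Im (f x)).

Lemma cmeasurable_cst c : cmeasurable (cst c).
Proof. by split; exact: measurable_cst. Qed.

Lemma cmeasurableM f g : cmeasurable f -> cmeasurable g ->
  cmeasurable (fun x => f x * g x).
Proof.
move=> [f1 f2] [g1 g2]; split.
  by under eq_fun do rewrite ReM; apply: measurable_funB; exact: measurable_funM.
by under eq_fun do rewrite ImM; apply: measurable_funD; exact: measurable_funM.
Qed.

Lemma cmeasurable_conj f : cmeasurable f -> cmeasurable (fun x => conjc (f x)).
Proof.
move=> [f1 f2]; split; first by under eq_fun do rewrite Reconj.
by under eq_fun do rewrite Imconj; exact: measurableT_comp.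
Qed.

Lemma cmeasurable_e (h : T -> R) : measurable_fun setT h ->
  cmeasurable (fun x => e (h x)).
Proof.
move=> mh; have mh2 : measurable_fun setT (fun x => 2 * pi * h x).
  exact: measurable_funM.
split; [apply: (measurableT_comp _ mh2)|apply: (measurableT_comp _ mh2)].
  by apply: continuous_measurable_fun; exact: continuous_cos.
by apply: continuous_measurable_fun; exact: continuous_sin.
Qed.

Lemma cmeasurable_ebar (h : T -> R) : measurable_fun setT h ->
  cmeasurable (fun x => ebar (h x)).
Proof. by move=> mh; apply: cmeasurable_e; exact: measurableT_comp. Qed.

Lemma measurable_normc f : cmeasurable f -> measurable_fun setT (fun x => normc (f x)).
Proof.
move=> [f1 f2]; under eq_fun do rewrite normcE_sqrt.
apply: (measurableT_comp (f := @Num.sqrt R) (g := fun x => sqnormc (f x))).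
  by apply: continuous_measurable_fun; exact: sqrt_continuous.
exact: measurable_sqnormc.
Qed.

Definition cintegrable mu f :=
  rintegrable mu (fun x => Re (f x)) /\ rintegrable mu (fun x => Im (f x)).

Lemma cintegrable_measurable mu f : cintegrable mu f -> cmeasurable f.
Proof. by move=> [/rintegrable_measurable h /rintegrable_measurable k]. Qed.

Lemma cintegrable_le mu f (g : T -> R) : cmeasurable f -> rintegrable mu g ->
  (forall x, normc (f x) <= g x) -> cintegrable mu f.
Proof.
move=> [f1 f2] ig fg; split; apply: (rintegrable_le _ ig) => // x.
  exact: le_trans (Re_le_normc _) (fg x).
exact: le_trans (Im_le_normc _) (fg x).
Qed.

Lemma cintegrable_normc mu f : cintegrable mu f -> rintegrable mu (fun x => normc (f x)).
Proof.
move=> fi; have mf := cintegrable_measurable fi; case: fi => f1 f2.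
apply: (rintegrable_le _ (rintegrableD (rintegrable_norm f1) (rintegrable_norm f2))).
  exact: measurable_normc.
by move=> x; rewrite ger0_norm ?normc_ge0// normc_le.
Qed.

Lemma cintegrableZ mu c f : cintegrable mu f -> cintegrable mu (fun x => c * f x).
Proof.
move=> fi; apply: (cintegrable_le _ (rintegrableZ (normc c) (cintegrable_normc fi))).
  by apply: cmeasurableM; [exact: cmeasurable_cst|exact: cintegrable_measurable fi].
by move=> x; rewrite normcM.
Qed.

Lemma cintegrable_conj mu f : cintegrable mu f -> cintegrable mu (fun x => conjc (f x)).
Proof.
move=> fi; apply: (cintegrable_le _ (cintegrable_normc fi)).
  by apply: cmeasurable_conj; exact: cintegrable_measurable fi.
by move=> x; rewrite normc_conj.
Qed.

Lemma cintegrableMe mu f (h : T -> R) : cintegrable mu f -> measurable_fun setT h ->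
  cintegrable mu (fun x => f x * e (h x)).
Proof.
move=> fi mh; apply: (cintegrable_le _ (cintegrable_normc fi)).
  by apply: cmeasurableM; [exact: cintegrable_measurable fi|exact: cmeasurable_e].
by move=> x; rewrite normcM normc_e mulr1.
Qed.

Lemma eq_cintegral mu f g : f =1 g -> cintegral mu f = cintegral mu g.
Proof. by move=> /funext ->. Qed.

Lemma cintegral0 mu : cintegral mu (fun=> 0 : R[i]) = 0.
Proof. by rewrite /cintegral; apply: complexP; rewrite /= /Rintegral integral0. Qed.

Lemma cintegralD mu f g : cintegrable mu f -> cintegrable mu g ->
  cintegral mu (fun x => f x + g x) = cintegral mu f + cintegral mu g.
Proof.
move=> [f1 f2] [g1 g2]; apply: complexP; rewrite ?ReD ?ImD /cintegral/= -RintegralD//;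
by apply: eq_Rintegral => x _; rewrite ?ReD ?ImD.
Qed.

Lemma cintegralZl mu c f : cintegrable mu f ->
  cintegral mu (fun x => c * f x) = c * cintegral mu f.
Proof.
move=> [f1 f2]; apply: complexP; rewrite ?ReM ?ImM /cintegral/= -!RintegralZl//.
  rewrite -RintegralB//; [|exact: rintegrableZ|exact: rintegrableZ].
  by apply: eq_Rintegral => x _; rewrite ReM.
rewrite -RintegralD//; [|exact: rintegrableZ|exact: rintegrableZ].
by apply: eq_Rintegral => x _; rewrite ImM.
Qed.

Lemma cintegralZr mu c f : cintegrable mu f ->
  cintegral mu (fun x => f x * c) = cintegral mu f * c.
Proof.
by move=> fi; rewrite mulrC -cintegralZl//; apply: eq_cintegral => x; rewrite mulrC.
Qed.

Lemma cintegral_conj mu f : cintegrable mu f ->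
  cintegral mu (fun x => conjc (f x)) = conjc (cintegral mu f).
Proof.
move=> [f1 f2]; apply: complexP; rewrite ?Reconj ?Imconj /cintegral/= -?RintegralN//;
by apply: eq_Rintegral => x _; rewrite ?Reconj ?Imconj.
Qed.

Lemma cintegral_ae mu f g : cmeasurable f -> cmeasurable g ->
  {ae mu, forall x, f x = g x} -> cintegral mu f = cintegral mu g.
Proof.
move=> [f1 f2] [g1 g2] fg; rewrite /cintegral; congr (_ +i* _);
by apply: eq_Rintegral_ae => //; apply: filterS fg => x ->.
Qed.

(** The factor 2 comes from bounding the real and the imaginary part separately; the estimates that
    rely on this only need some finite constant. *)
Lemma normc_cintegral_le mu f (g : T -> R) : cmeasurable f -> rintegrable mu g ->
  (forall x, normc (f x) <= g x) -> normc (cintegral mu f) <= 2 * \int[mu]_x g x.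
Proof.
move=> mf ig fg; have [f1 f2] := cintegrable_le mf ig fg.
apply: (le_trans (normc_le _)); rewrite /cintegral/= mulr_natl mulr2n; apply: lerD.
  apply: (le_trans (le_normr_Rintegral measurableT f1)).
  apply: le_Rintegral => //; first exact: rintegrable_norm.
  by move=> x _; exact: le_trans (Re_le_normc _) (fg x).
apply: (le_trans (le_normr_Rintegral measurableT f2)).
apply: le_Rintegral => //; first exact: rintegrable_norm.
by move=> x _; exact: le_trans (Im_le_normc _) (fg x).
Qed.

End complex_integral.

Lemma cmeasurable_comp d1 d2 (T1 : measurableType d1) (T2 : measurableType d2)
    (R : realType) (f : T2 -> R[i]) (h : T1 -> T2) :
  cmeasurable f -> measurable_fun setT h -> cmeasurable (fun x => f (h x)).
Proof. by move=> [f1 f2] mh; split; [exact: (measurableT_comp f1 mh)|exact: (measurableT_comp f2 mh)]. Qed.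

Section complex_fubini.
Context d1 d2 (T1 : measurableType d1) (T2 : measurableType d2) (R : realType).
Variables (m1 : {sigma_finite_measure set T1 -> \bar R})
          (m2 : {sigma_finite_measure set T2 -> \bar R}).
Variables (f : T1 * T2 -> R[i]) (a : T1 -> R) (b : T2 -> R).
Hypotheses (mf : cmeasurable f).
Hypotheses (ia : rintegrable m1 a) (ib : rintegrable m2 b).
Hypothesis fab : forall x y, normc (f (x, y)) <= a x * b y.

Let fr x y : `|Re (f (x, y))| <= a x * b y.
Proof. exact: le_trans (Re_le_normc _) (fab x y). Qed.
Let fi x y : `|Im (f (x, y))| <= a x * b y.
Proof. exact: le_trans (Im_le_normc _) (fab x y). Qed.
Let mr : measurable_fun setT (fun x => Re (f x)). Proof. by case: mf. Qed.
Let mi : measurable_fun setT (fun x => Im (f x)). Proof. by case: mf. Qed.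

Lemma cfub_section1 x : cintegrable m2 (fun y => f (x, y)).
Proof. by split; [exact: (fub_section1 mr ib fr)|exact: (fub_section1 mi ib fi)]. Qed.

Lemma cfub_prod : cintegrable (m1 \x m2)%E f.
Proof. by split; [exact: (fub_prod mr ia ib fr)|exact: (fub_prod mi ia ib fi)]. Qed.

Lemma cfub_int1 : cintegrable m1 (fun x => cintegral m2 (fun y => f (x, y))).
Proof. by split; [exact: (fub_int1 mr ia ib fr)|exact: (fub_int1 mi ia ib fi)]. Qed.

Lemma cfub1 : cintegral (m1 \x m2)%E f = cintegral m1 (fun x => cintegral m2 (fun y => f (x, y))).
Proof.
by rewrite /cintegral; congr (_ +i* _); [exact: (Rfub1 mr ia ib fr)|exact: (Rfub1 mi ia ib fi)].
Qed.

Lemma cfub2 : cintegral (m1 \x m2)%E f = cintegral m2 (fun y => cintegral m1 (fun x => f (x, y))).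
Proof.
by rewrite /cintegral; congr (_ +i* _); [exact: (Rfub2 mr ia ib fr)|exact: (Rfub2 mi ia ib fi)].
Qed.

Lemma cfubC : cintegral m1 (fun x => cintegral m2 (fun y => f (x, y))) =
  cintegral m2 (fun y => cintegral m1 (fun x => f (x, y))).
Proof. by rewrite -cfub1 cfub2. Qed.

End complex_fubini.

(** * Schwartz functions *)

Section schwartz_closure.
Context (R : realType).

(** Turns decay against the pure powers [s ^+ 0] and [s ^+ k] into decay against [(1 + s) ^+ k]; the
    larger of 1 and s decides. *)
Lemma expr1D_le k (s : R) : 0 <= s -> (1 + s) ^+ k <= 2 ^+ k * (1 + s ^+ k).
Proof.
move=> s0; have [s1|s1] := leP s 1.
  apply: (@le_trans _ _ (2 ^+ k)).
    by rewrite lerXn2r ?nnegrE ?addr_ge0// -[leRHS]/(1 + 1) lerD2l.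
  by rewrite ler_peMr ?exprn_ge0// lerDl exprn_ge0.
apply: (@le_trans _ _ ((2 * s) ^+ k)).
  rewrite lerXn2r ?nnegrE ?addr_ge0 ?mulr_ge0//.
  by rewrite mulr_natl mulr2n lerD2r ltW.
by rewrite exprMn ler_wpM2l ?exprn_ge0// lerDr.
Qed.

Section span.
Context (V : normedModType R).
Implicit Types (g h : V -> R) (P : (V -> R) -> Prop).

Definition rapid_decay g :=
  forall k : nat, exists M, forall x, `|x| ^+ k * `|g x| <= M.

Lemma rapid_decayD g h : rapid_decay g -> rapid_decay h ->
  rapid_decay (fun x => g x + h x).
Proof.
move=> rg rh k; have [M gM] := rg k; have [N hN] := rh k; exists (M + N) => x.
rewrite (le_trans _ (lerD (gM x) (hN x)))// -mulrDr ler_wpM2l ?exprn_ge0//.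
exact: ler_normD.
Qed.

(** The Leibniz rule and differentiation under the integral return sums of functions of the original
    shape, so a class closed under derivatives has to be closed under sums as well. *)
Inductive addspan P : (V -> R) -> Prop :=
| addspan_base g : P g -> addspan P g
| addspan_add g h : addspan P g -> addspan P h -> addspan P (fun x => g x + h x).

(** An induction principle: three checks on the generators replace a formula for all iterated
    derivatives. Each closure property of Schwartz functions below comes from a suitable [P]. *)
Lemma schwartz_span P :
  (forall g, P g -> forall x v, derivable g x v) ->
  (forall g, P g -> forall v, addspan P ('D_v g)) ->
  (forall g, P g -> rapid_decay g) ->
  forall g, addspan P g -> schwartz_real g.
Proof.
move=> Pd PD Pr.
have sd g : addspan P g -> forall x v, derivable g x v.
  elim => [? /Pd//|g1 g2 _ h1 _ h2 x v]; exact: derivableD.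
have sD g : addspan P g -> forall v, addspan P ('D_v g).
  elim => [? /PD//|g1 g2 s1 h1 s2 h2 v].
  rewrite (_ : 'D_v _ = fun x => 'D_v g1 x + 'D_v g2 x).
    exact: addspan_add.
  by apply/funext => x; apply: deriveD; exact: sd.
have sr g : addspan P g -> rapid_decay g.
  elim => [? /Pr//|g1 g2 _ h1 _ h2]; exact: rapid_decayD.
have sI vs g : addspan P g -> addspan P (iter_derive vs g).
  by move=> sg; elim: vs => //= v vs ih; exact: sD.
by move=> g sg; split => [vs v x|vs]; [exact/sd/sI|exact/sr/sI].
Qed.

Lemma schwartz_derivable g : schwartz_real g -> forall x v, derivable g x v.
Proof. by move=> [h _] x v; exact: (h [::]). Qed.

Lemma schwartz_derive g v : schwartz_real g -> schwartz_real ('D_v g).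
Proof.
have E vs : iter_derive vs ('D_v g) = iter_derive (rcons vs v) g.
  by rewrite /iter_derive foldr_rcons.
by move=> [h1 h2]; split => vs; rewrite E; [exact: h1|exact: h2].
Qed.

Lemma schwartz_rapid g : schwartz_real g -> rapid_decay g.
Proof. by move=> [_ h]; exact: (h [::]). Qed.

Lemma schwartz_realD g h : schwartz_real g -> schwartz_real h ->
  schwartz_real (fun x => g x + h x).
Proof.
move=> sg sh; apply: (@schwartz_span (@schwartz_real R V)).
- by move=> ? /schwartz_derivable.
- by move=> ? ? v; apply: addspan_base; exact: schwartz_derive.
- by move=> ? /schwartz_rapid.
- by apply: addspan_add; exact: addspan_base.
Qed.

Lemma schwartz_realZ c g : schwartz_real g -> schwartz_real (fun x => c * g x).
Proof.
move=> sg.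
apply: (@schwartz_span (fun f => exists2 g, schwartz_real g & f = fun x => c * g x)).
- by move=> _ [f sf ->] x v; apply: derivableZ; exact: schwartz_derivable.
- move=> _ [f sf ->] v; apply: addspan_base; exists ('D_v f); first exact: schwartz_derive.
  by apply/funext => x; apply: deriveZ; exact: schwartz_derivable.
- move=> _ [f sf ->] k; have [M fM] := schwartz_rapid sf k; exists (`|c| * M) => x.
  by rewrite normrM mulrCA ler_wpM2l.
- by apply: addspan_base; exists g.
Qed.

Lemma schwartz_realN g : schwartz_real g -> schwartz_real (fun x => - g x).
Proof.
by move=> /(schwartz_realZ (-1)); under eq_fun do rewrite mulN1r.
Qed.

(** The generators are the Schwartz functions together with the products [l * g], because the
    derivative of [l * g] along [v] is [l * 'D_v g + l v * g]. Decay of order k of the product uses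
    decay of order k + 1 of [g]. *)
Lemma schwartz_realM_linear (l : V -> R) (C : R) g :
  (forall s x v, l (s *: v + x) = s * l v + l x) -> (forall x, `|l x| <= C * `|x|) ->
  schwartz_real g -> schwartz_real (fun x => l x * g x).
Proof.
move=> ll lC sg.
have ld x v : is_derive x v l (l v).
  have E : s^-1 *: ((l \o shift x) (s *: v) - l x) @[s --> (0:R)^'] --> l v.
    apply: cvg_near_cst; near=> s.
    rewrite /= ll addrK scalerA -[_ *: _]/(_ * _) mulVf ?mul1r//.
    by near: s; exact: nbhs_dnbhs_neq.
  by apply: DeriveDef; [apply/cvg_ex; exists (l v)|apply/cvg_lim].
apply: (@schwartz_span (fun f => schwartz_real f \/
    exists2 g, schwartz_real g & f = fun x => l x * g x)).
- move=> ? [/schwartz_derivable//|[f sf ->]] x v.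
  by apply: derivableM; [exact: (@ex_derive _ _ _ _ _ _ _ (ld x v))|exact: schwartz_derivable].
- move=> ? [?|[f sf ->]] v.
    by apply: addspan_base; left; exact: schwartz_derive.
  rewrite (_ : 'D_v _ = fun x => l x * 'D_v f x + l v * f x).
    apply: addspan_add; apply: addspan_base.
      by right; exists ('D_v f) => //; exact: schwartz_derive.
    by left; exact: schwartz_realZ.
  apply/funext => x; have dl := ld x v.
  rewrite [LHS]deriveM//; last exact: schwartz_derivable.
  by rewrite derive_val -![_ *: _]/(_ * _) [f x * _]mulrC.
- move=> ? [/schwartz_rapid//|[f sf ->]].
  move=> k; have [M fM] := schwartz_rapid sf k.+1; exists (`|C| * M) => x.
  rewrite normrM (@le_trans _ _ (`|C| * (`|x| ^+ k.+1 * `|f x|)))//; last by rewrite ler_wpM2l.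
  rewrite (_ : `|C| * _ = `|x| ^+ k * ((`|C| * `|x|) * `|f x|)); last by rewrite exprSr; ring.
  rewrite ler_wpM2l ?exprn_ge0// ler_wpM2r//.
  by rewrite (le_trans (lC x))// ler_wpM2r// ler_norm.
- by apply: addspan_base; right; exists g.
Unshelve. all: by end_near. Qed.

End span.

Section pullback_affine.
Context (V W : normedModType R) (A : V -> W) (l : V -> W) (C : R).
Hypothesis Al : forall h x v, A (h *: v + x) = h *: l v + A x.
Hypothesis AC : forall x, `|x| <= C * (1 + `|A x|).

(** By [AC] the point [x] cannot run to infinity without [A x] doing so at a comparable rate, so
    decay of [g] at [A x] becomes decay at [x]. Derivatives along [v] become derivatives of [g]
    along [l v]. *)
Lemma schwartz_real_pullback_affine (g : W -> R) : schwartz_real g -> schwartz_real (g \o A).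
Proof.
have E (f : W -> R) x v : (fun h => h^-1 *: ((f \o A \o shift x) (h *: v) - (f \o A) x)) =
    (fun h => h^-1 *: ((f \o shift (A x)) (h *: l v) - f (A x))).
  by apply/funext => h /=; rewrite Al.
move=> sg.
apply: (@schwartz_span _ (fun f => exists2 g, schwartz_real g & f = g \o A)).
- move=> _ [f sf ->] x v; rewrite /derivable E.
  exact: schwartz_derivable sf (A x) (l v).
- move=> _ [f sf ->] v; apply: addspan_base; exists ('D_(l v) f).
    exact: schwartz_derive.
  by apply/funext => x; rewrite /derive E.
- move=> _ [f sf ->] k; have [M fM] := schwartz_rapid sf k; have [N fN] := schwartz_rapid sf 0.
  exists (`|C| ^+ k * (2 ^+ k * (N + M))) => x.
  apply: (@le_trans _ _ (`|C| ^+ k * (2 ^+ k * (`|A x| ^+ 0 + `|A x| ^+ k) * `|f (A x)|))).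
    rewrite mulrA ler_wpM2r//; apply: (@le_trans _ _ ((`|C| * (1 + `|A x|)) ^+ k)).
      rewrite lerXn2r// ?nnegrE ?mulr_ge0 ?addr_ge0//.
      by rewrite (le_trans (AC x))// ler_wpM2r ?addr_ge0// ler_norm.
    by rewrite exprMn ler_wpM2l ?exprn_ge0// expr1D_le.
  rewrite ler_wpM2l ?exprn_ge0// -mulrA ler_wpM2l ?exprn_ge0// mulrDl.
  exact: lerD.
- by apply: addspan_base; exists g.
Qed.

Lemma schwartz_pullback_affine (f : W -> R[i]) : schwartz f -> schwartz (f \o A).
Proof.
by move=> [f1 f2]; split; [exact: schwartz_real_pullback_affine f1|exact: schwartz_real_pullback_affine f2].
Qed.

End pullback_affine.

Section pullback.
Context (V W : normedModType R) (A : V -> W) (l : V -> W) (C : R).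
Hypothesis Al : forall h x v, A (h *: v + x) = h *: l v + A x.
Hypothesis AC : forall x, `|x| <= C * `|A x|.

Let AC' x : `|x| <= `|C| * (1 + `|A x|).
Proof.
rewrite (le_trans (AC x))// (le_trans (ler_wpM2r _ (ler_norm C)))// ler_wpM2l//.
by rewrite lerDr.
Qed.

Lemma schwartz_real_pullback (g : W -> R) : schwartz_real g -> schwartz_real (g \o A).
Proof. exact: (schwartz_real_pullback_affine Al AC'). Qed.

Lemma schwartz_pullback (f : W -> R[i]) : schwartz f -> schwartz (f \o A).
Proof. by move=> [f1 f2]; split; [exact: schwartz_real_pullback f1|exact: schwartz_real_pullback f2]. Qed.

End pullback.

(** Both difference quotients are the same function of the increment, which stands in for a chain
    rule for functions that are only directionally derivable. *)
Lemma derive_pullback (V W : normedModType R) (A l : V -> W) (f : W -> R) :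
  (forall h x v, A (h *: v + x) = h *: l v + A x) ->
  forall x v, derivable f (A x) (l v) ->
  derivable (f \o A) x v /\ 'D_v (f \o A) x = 'D_(l v) f (A x).
Proof.
move=> Al x v; have E : (fun h => h^-1 *: ((f \o A \o shift x) (h *: v) - (f \o A) x)) =
    (fun h => h^-1 *: ((f \o shift (A x)) (h *: l v) - f (A x))).
  by apply/funext => h /=; rewrite Al.
by rewrite /derivable /derive E.
Qed.

Lemma normX_pair (V W : normedModType R) (p : V * W) k :
  `|p| ^+ k <= `|p.1| ^+ k + `|p.2| ^+ k.
Proof.
rewrite prod_normE; case: (leP `|p.1| `|p.2|) => _.
  by rewrite lerDr exprn_ge0.
by rewrite lerDl exprn_ge0.
Qed.

Lemma rapid_bounded (V : normedModType R) (g : V -> R) k : rapid_decay g ->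
  exists2 M, 0 <= M & forall x, `|x| ^+ k * `|g x| <= M.
Proof.
move=> rg; have [M gM] := rg k; exists `|M| => // x.
by rewrite (le_trans (gM x))// ler_norm.
Qed.

Lemma schwartz_real_tensor (V W : normedModType R) (g : V -> R) (h : W -> R) :
  schwartz_real g -> schwartz_real h -> schwartz_real (fun p : V * W => g p.1 * h p.2).
Proof.
move=> sg sh.
have d1 (f : V -> R) x v : schwartz_real f ->
    derivable (f \o fst : V * W -> R) x v /\ 'D_v (f \o fst : V * W -> R) x = 'D_(v.1) f x.1.
  by move=> sf; apply: (@derive_pullback _ _ fst fst) => //; exact: schwartz_derivable.
have d2 (f : W -> R) x v : schwartz_real f ->
    derivable (f \o snd : V * W -> R) x v /\ 'D_v (f \o snd : V * W -> R) x = 'D_(v.2) f x.2.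
  by move=> sf; apply: (@derive_pullback _ _ snd snd) => //; exact: schwartz_derivable.
apply: (@schwartz_span _ (fun f => exists g h, [/\ schwartz_real g, schwartz_real h &
   f = fun p : V * W => g p.1 * h p.2])).
- move=> _ [a [b [sa sb ->]]] x v.
  by apply: (@derivableM _ _ (a \o fst) (b \o snd)); [exact: (d1 _ _ _ sa).1|exact: (d2 _ _ _ sb).1].
- move=> _ [a [b [sa sb ->]]] v.
  rewrite (_ : 'D_v _ = fun p => a p.1 * 'D_(v.2) b p.2 + 'D_(v.1) a p.1 * b p.2).
    apply: addspan_add; apply: addspan_base.
      by exists a, ('D_(v.2) b); split => //; exact: schwartz_derive.
    by exists ('D_(v.1) a), b; split => //; exact: schwartz_derive.
  apply/funext => p; have [da Ea] := d1 _ p v sa; have [db Eb] := d2 _ p v sb.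
  have := @deriveM _ _ (a \o fst) (b \o snd) p v da db.
  by rewrite Ea Eb -![_ *: _]/(_ * _) /= => ->; rewrite [b _ * _]mulrC.
- move=> _ [a [b [sa sb ->]]] k.
  have [Ma Ma0 aM] := rapid_bounded k (schwartz_rapid sa).
  have [Mb Mb0 bM] := rapid_bounded k (schwartz_rapid sb).
  have [Na Na0 aN] := rapid_bounded 0 (schwartz_rapid sa).
  have [Nb Nb0 bN] := rapid_bounded 0 (schwartz_rapid sb).
  exists (Ma * Nb + Na * Mb) => p.
  apply: (@le_trans _ _ ((`|p.1| ^+ k + `|p.2| ^+ k) * `|a p.1 * b p.2|)).
    by rewrite ler_wpM2r// normX_pair.
  rewrite mulrDl normrM mulrA [`|p.2| ^+ k * _]mulrCA; apply: lerD; apply: ler_pM => //;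
    rewrite ?mulr_ge0 ?exprn_ge0//.
    by have := bN p.2; rewrite expr0 mul1r.
  by have := aN p.1; rewrite expr0 mul1r.
- by apply: addspan_base; exists g, h.
Qed.

Section complex_schwartz.
Context (V W : normedModType R).
Implicit Types (f g : V -> R[i]).

Lemma schwartzD f g : schwartz f -> schwartz g -> schwartz (fun x => f x + g x).
Proof.
move=> [f1 f2] [g1 g2]; split.
  by under eq_fun do rewrite ReD; exact: schwartz_realD.
by under eq_fun do rewrite ImD; exact: schwartz_realD.
Qed.

Lemma schwartz_conj f : schwartz f -> schwartz (fun x => conjc (f x)).
Proof.
move=> [f1 f2]; split; first by under eq_fun do rewrite Reconj.
by under eq_fun do rewrite Imconj; exact: schwartz_realN.
Qed.

Lemma schwartzN f : schwartz f -> schwartz (fun x => - f x).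
Proof.
have E1 (z : R[i]) : Re (- z) = - Re z by case: z.
have E2 (z : R[i]) : Im (- z) = - Im z by case: z.
move=> [f1 f2]; split.
  by under eq_fun do rewrite E1; exact: schwartz_realN.
by under eq_fun do rewrite E2; exact: schwartz_realN.
Qed.

Lemma schwartzZ (c : R[i]) f : schwartz f -> schwartz (fun x => c * f x).
Proof.
move=> [f1 f2]; split.
  under eq_fun do rewrite ReM; apply: schwartz_realD; first exact: schwartz_realZ.
  by apply: schwartz_realN; exact: schwartz_realZ.
by under eq_fun do rewrite ImM; apply: schwartz_realD; exact: schwartz_realZ.
Qed.

Lemma schwartz_realC (g : V -> R) : schwartz_real g -> schwartz (fun x => (g x)%:C).
Proof.
move=> sg; split => //; have := schwartz_realZ 0 sg.
by congr schwartz_real; apply/funext => s; rewrite mul0r.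
Qed.

Lemma schwartz_tensor f (g : W -> R[i]) : schwartz f -> schwartz g ->
  schwartz (fun p : V * W => f p.1 * g p.2).
Proof.
move=> [f1 f2] [g1 g2]; split.
  under eq_fun do rewrite ReM; apply: schwartz_realD; first exact: schwartz_real_tensor f1 g1.
  by apply: schwartz_realN; exact: schwartz_real_tensor f2 g2.
under eq_fun do rewrite ImM; apply: schwartz_realD; first exact: schwartz_real_tensor f1 g2.
exact: schwartz_real_tensor f2 g1.
Qed.

Lemma schwartz_normc_bound f k : schwartz f ->
  exists2 M, 0 <= M & forall x, `|x| ^+ k * normc (f x) <= M.
Proof.
move=> [/schwartz_rapid/(rapid_bounded k)[M M0 fM] /schwartz_rapid/(rapid_bounded k)[N N0 fN]].
exists (M + N); first exact: addr_ge0.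
move=> x; apply: le_trans (lerD (fM x) (fN x)).
by rewrite -mulrDr ler_wpM2l ?exprn_ge0// normc_le.
Qed.

End complex_schwartz.

End schwartz_closure.

(** * Fourier inversion in one variable *)

Section lebesgue_affine.
Context (R : realType) (c b : R) (c0 : c != 0).
Local Notation mu := (@lebesgue_measure R).
Let phi (y : measurableTypeR R) : measurableTypeR R := c * y + b.

Let mphi : measurable_fun setT phi.
Proof.
have : measurable_fun [set: R] (fun y => c * y + b : R).
  by apply: measurable_funD => //; exact: measurable_funM.
exact.
Qed.

Let nu : {measure set (measurableTypeR R) -> \bar R} :=
  mscale (`|c|%:nng)
    (measure_function_pushforward__canonical__measure_function_Measure mu mphi).

(** Lebesgue measure is determined by its values on the intervals []p, q]]. The sign of [c] matters
    because for c < 0 the preimage of such an interval is closed at its left end instead. *)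
Let nuE (A : set (measurableTypeR R)) : measurable A -> mu A = nu A.
Proof.
apply: lebesgue_measure_unique => _ [[p q] /= pq <-].
rewrite /nu /mscale/= /pushforward.
rewrite lebesgue_measure_itv/= lte_fin.
have [cp|cn|c00] := ltgtP c 0; last by move: c0; rewrite c00 eqxx.
- rewrite (_ : phi @^-1` _ = `[(q - b) / c, (p - b) / c[%classic); last first.
    apply/seteqP; split => y /=; rewrite !in_itv/= /phi;
    by rewrite ler_ndivrMr// ltr_ndivlMr// lerBrDr ltrBlDr [_ * c]mulrC andbC.
  rewrite lebesgue_measure_itv/= lte_fin ltr_ndivrMr// divfK// ltrD2r ltr0_norm//.
  case: ifPn => _; last by rewrite mule0.
  by rewrite -!EFinB -EFinM; congr EFin; field.
- rewrite (_ : phi @^-1` _ = `](p - b) / c, (q - b) / c]%classic); last first.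
    apply/seteqP; split => y /=; rewrite !in_itv/= /phi;
    by rewrite ler_pdivlMr// ltr_pdivrMr// lerBrDr ltrBlDr [_ * c]mulrC.
  rewrite lebesgue_measure_itv/= lte_fin ltr_pdivrMr// divfK// ltrD2r gtr0_norm//.
  case: ifPn => _; last by rewrite mule0.
  by rewrite -!EFinB -EFinM; congr EFin; field.
Qed.

Lemma ge0_integral_affine (f : R -> \bar R) : measurable_fun [set: R] f ->
  (forall x, 0 <= f x)%E ->
  (\int[mu]_x f x = `|c|%:E * \int[mu]_x f (c * x + b)%R)%E.
Proof.
move=> mf f0; rewrite (eq_measure_integral nu); last by move=> A mA _; exact: nuE.
rewrite ge0_integral_mscale//; congr (_ * _)%E.
by rewrite ge0_integral_pushforward.
Qed.

Lemma rintegrable_affine (f : R -> R) : rintegrable mu f ->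
  rintegrable mu (fun x => f (c * x + b)).
Proof.
move=> fi; have mf := rintegrable_measurable fi.
have mf' : measurable_fun [set: R] f by exact: mf.
apply/integrableP; split.
  by apply/measurable_EFinP; exact: (measurableT_comp mf mphi).
have := rintegrable_lty fi; rewrite ge0_integral_affine//; last first.
  by apply/measurable_EFinP; exact: measurableT_comp.
move=> h; rewrite ltNge; apply/negP => h'.
move: h; rewrite ltNge => /negP; apply.
have -> : (\int[mu]_x (`|f (c * x + b)%R|)%:E = +oo)%E.
  by apply/eqP; rewrite -leye_eq.
by rewrite mulry gtr0_sg ?normr_gt0// mul1e.
Qed.

Lemma Rintegral_affine (f : R -> R) : rintegrable mu f ->
  \int[mu]_x f x = `|c| * \int[mu]_x f (c * x + b).
Proof.
move=> fi; have fi' := rintegrable_affine fi.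
apply: EFin_inj; rewrite EFinM !EFin_Rintegral//.
have mf : measurable_fun [set: R] (fun x => (f x)%:E) := measurable_int _ fi.
have E1 := @integralE _ _ _ mu setT (fun x => (f x)%:E).
have E2 := @integralE _ _ _ mu setT (fun x => (f (c * x + b))%:E).
have fin1 := integrable_pos_fin_num measurableT fi'.
have fin2 := integrable_neg_fin_num measurableT fi'.
rewrite E1 E2 muleBr//; last by rewrite fin_num_adde_defr.
congr (_ - _)%E.
  rewrite (@ge0_integral_affine (fun x => (f x)%:E)^\+%E)//; last exact: measurable_funepos.
  by congr (_ * _)%E; apply: eq_integral => x _; rewrite !funeposE.
rewrite (@ge0_integral_affine (fun x => (f x)%:E)^\-%E)//; last exact: measurable_funeneg.
by congr (_ * _)%E; apply: eq_integral => x _; rewrite !funenegE.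
Qed.

Lemma cintegrable_affine (f : R -> R[i]) : cintegrable mu f ->
  cintegrable mu (fun x => f (c * x + b)).
Proof. by move=> [/rintegrable_affine ? /rintegrable_affine ?]. Qed.

Lemma cintegral_affine (f : R -> R[i]) : cintegrable mu f ->
  cintegral mu f = `|c|%:C * cintegral mu (fun x => f (c * x + b)).
Proof.
move=> [f1 f2]; rewrite /cintegral; apply: complexP => /=.
  by rewrite Rintegral_affine// mul0r subr0.
by rewrite Rintegral_affine// mul0r addr0.
Qed.

End lebesgue_affine.

Section dominated_Rintegral.
Context d (T : measurableType d) (R : realType) (mu : {measure set T -> \bar R}).

Lemma Rintegral_dominated_cvg (f_ : (T -> R)^nat) (f g : T -> R) :
  (forall n, measurable_fun setT (f_ n)) -> rintegrable mu g ->
  (forall n x, `|f_ n x| <= g x) -> (forall x, f_ n x @[n --> \oo] --> f x) ->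
  \int[mu]_x f_ n x @[n --> \oo] --> \int[mu]_x f x.
Proof.
move=> mf ig fg ff.
have mf' : measurable_fun setT f by apply: (measurable_fun_cvg mf) => x _; exact: ff.
apply: fine_cvg; rewrite EFin_Rintegral; last first.
  apply: (rintegrable_le mf' ig) => x.
  by apply: (ler_cvg_to (cvg_norm (ff x)) (cvg_cst (g x))); exact: nearW.
apply: (@dominated_cvg _ _ _ mu setT _ _ _ (EFin \o g)) => //.
- by move=> n; exact/measurable_EFinP.
- by move=> x _; apply: cvg_EFin; [exact: nearW|exact: ff].
- by move=> n x _; rewrite lee_fin.
Qed.

End dominated_Rintegral.

(** * The weight 1 / (1 + x^2) on the line *)

Section cauchy_weight.
Context (R : realType).
Local Notation mu := (@lebesgue_measure R).

Lemma integral_oneDsqrV : (\int[mu]_x ((oneDsqr x)^-1)%:E = pi%:E)%E.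
Proof.
rewrite (@ge0_symfun_integralT _ (fun x : R => (oneDsqr x)^-1)).
- rewrite (_ : [set x | 0 <= x] = `[0%R, +oo[%classic); last first.
    by apply/seteqP; split => x /=; rewrite in_itv/= andbT.
  by rewrite integral0y_oneDsqr -EFinM; congr EFin; field.
- by move=> x; rewrite invr_ge0 addr_ge0// sqr_ge0.
- by move=> x; exact: continuous_oneDsqrV.
- by move=> x; rewrite /= /oneDsqr sqrrN.
Qed.

Lemma oneDsqrV_ge0 (t : R) : 0 <= (oneDsqr t)^-1.
Proof. by rewrite invr_ge0 addr_ge0// sqr_ge0. Qed.

Lemma rintegrable_oneDsqrV : rintegrable mu (fun x : R => (oneDsqr x)^-1).
Proof.
apply: ge0_rintegrable.
- by apply: continuous_measurable_fun; exact: continuous_oneDsqrV.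
- exact: oneDsqrV_ge0.
- by rewrite integral_oneDsqrV ltry.
Qed.

Lemma Rintegral_oneDsqrV : \int[mu]_x (oneDsqr x)^-1 = pi.
Proof. by rewrite /Rintegral integral_oneDsqrV. Qed.

Lemma rintegrable_oneDsqr (M : R) (f : R -> R) : measurable_fun [set: R] f ->
  (forall t, `|f t| <= M * (oneDsqr t)^-1) -> rintegrable mu f.
Proof. by move=> mf fM; apply: (rintegrable_le _ (rintegrableZ M rintegrable_oneDsqrV) fM). Qed.

Lemma derivable_measurable (f : R -> R) : (forall x, derivable f x 1) ->
  measurable_fun [set: R] f.
Proof.
move=> df; apply: continuous_measurable_fun => x.
by apply: differentiable_continuous; apply/derivable1_diffP.
Qed.

(* The integral of H(t + s) over t does not depend on s; differentiate at s = 0. *)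
Lemma Rintegral_derive0 (H h : R -> R) (M : R) :
  (forall x, is_derive x (1 : R) H (h x)) ->
  (forall t, `|H t| <= M * (oneDsqr t)^-1) ->
  (forall t, `|h t| <= M * (oneDsqr t)^-1) ->
  \int[mu]_t h t = 0.
Proof.
move=> Hh HM hM.
have dH x : derivable H x 1 by have Hhx := Hh x; exact: ex_derive.
have iH : rintegrable mu H by apply: rintegrable_oneDsqr HM; exact: derivable_measurable.
have M0 : 0 <= M.
  by have := le_trans (normr_ge0 _) (HM 0); rewrite pmulr_lge0// invr_gt0 /oneDsqr expr0n addr0.
have dHs (s t : R) : derivable (fun s => H (t + s)) s 1 /\ 'D_1 (fun s => H (t + s)) s = h (t + s).
  have [] // := @derive_pullback R R R (fun s => t + s) id H _ s 1.
    by move=> ? ? ?; rewrite addrCA.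
  by move=> ? ->; split => //; have Hhx := Hh (t + s); rewrite derive_val.
pose F s := \int[mu]_(t in setT) H (t + s).
have FE : F = cst (\int[mu]_t H t).
  apply/funext => s; rewrite (@Rintegral_affine R 1 s (oner_neq0 _) H)// normr1 mul1r /F/=.
  by apply: eq_Rintegral => x _; rewrite mul1r.
have i3 s : rintegrable mu (fun t => H (t + s)).
  have := @rintegrable_affine R 1 s (oner_neq0 _) _ iH.
  by under eq_fun do rewrite mul1r.
have := @differentiation_under_integral R _ _ mu (fun s t => H (t + s)) setT measurableT
  0 (-1) 1 _ _ _ (fun t => M * 3 * (oneDsqr t)^-1) _ _ _.
rewrite -/F FE derive1_cst => ->.
- by apply: eq_Rintegral => t _; rewrite /partial1of2 derive1E (dHs 0 t).2 addr0.
- by rewrite /= in_itv/= ltrN10 ltr01.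
- by move=> s _; exact: i3.
- by move=> s t _ _; exact: (dHs s t).1.
- by move=> t; rewrite !mulr_ge0// oneDsqrV_ge0.
- exact: rintegrableZ rintegrable_oneDsqrV.
- move=> s t /=; rewrite in_itv/= => /andP[s1 s2] _; rewrite /partial1of2 derive1E (dHs s t).2.
  rewrite (le_trans (hM _))// -mulrA ler_wpM2l//.
  rewrite ler_pdivlMr ?ltr_pwDl ?sqr_ge0// mulrC ler_pdivrMr ?ltr_pwDl ?sqr_ge0//.
  have s21 : s ^+ 2 <= 1 by rewrite -[leRHS](expr1n _ 2) -ler_sqrt// ?exprn_ge0// sqrtr_sqr expr1n sqrtr1 ler_norml !ltW.
  (* Origin of the constant 3: for s^2 <= 1 one has [3 (1 + (t + s)^2) - (1 + t^2) = 2 (1 - s^2) +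
     (t + 2 s)^2 + (t + s)^2 >= 0]. *)
  have := sqr_ge0 (t + 2 * s); have := sqr_ge0 (t + s); rewrite /oneDsqr; lra.
Qed.

End cauchy_weight.

(** * Cosine transforms with phase and parameter *)

Section cosine_transform.
Context (R : realType) (W : normedModType R).
Local Notation mu := (@lebesgue_measure R).
Implicit Types (g : R * W -> R) (th : R).

(** The phase [th] closes the family under differentiation in the frequency, since a derivative of
    the cosine only shifts the phase by pi / 2. It also covers the sine transform, as
    [sin y = cos (y - pi / 2)]. *)
Definition cosT th g (p : R * W) : R :=
  \int[mu]_t (g (t, p.2) * cos (2 * pi * p.1 * t + th)).

Lemma normX_fst (p : R * W) : `|p.1| <= `|p|.
Proof. by rewrite prod_normE le_max lexx. Qed.

Lemma normX_snd (p : R * W) : `|p.2| <= `|p|.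
Proof. by rewrite prod_normE le_max lexx orbT. Qed.

(** From [(1 + t^2) |w|^k <= |p|^k + |p|^(k + 2)] for p = (t, w). The bound is uniform in [w], so it
    still dominates while the parameter moves. *)
Lemma schwartz_cauchy_bound g k : schwartz_real g ->
  exists2 M, 0 <= M & forall t w, `|w| ^+ k * `|g (t, w)| <= M * (oneDsqr t)^-1.
Proof.
move=> /schwartz_rapid sg; have [M M0 gM] := rapid_bounded k sg.
have [N N0 gN] := rapid_bounded k.+2 sg.
exists (M + N); first exact: addr_ge0.
move=> t w; rewrite ler_pdivlMr; last by rewrite ltr_pwDl// sqr_ge0.
apply: le_trans (lerD (gM (t, w)) (gN (t, w))).
have h1 := normX_fst (t, w); have h2 := normX_snd (t, w).
rewrite -mulrDl mulrAC ler_wpM2r// /oneDsqr mulrDr mulr1 -(addn2 k) exprD.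
apply: lerD; first by rewrite lerXn2r// nnegrE.
by rewrite -(real_normK (num_real t)) ler_pM ?exprn_ge0// lerXn2r// nnegrE.
Qed.

Lemma schwartz_line_derivable g w : schwartz_real g -> forall t, derivable (fun t => g (t, w)) t 1.
Proof.
move=> sg t; have [] // := @derive_pullback R R (R * W)%type (fun t => (t, w)) (fun t => (t, 0)) g _ t 1 _.
  by move=> h x v; congr pair; rewrite /= scaler0 add0r.
exact: schwartz_derivable.
Qed.

Lemma schwartz_line_derive g w : schwartz_real g ->
  'D_1 (fun t => g (t, w)) = fun t => 'D_((1, 0) : R * W) g (t, w).
Proof.
move=> sg; apply/funext => t.
have [] // := @derive_pullback R R (R * W)%type (fun t => (t, w)) (fun t => (t, 0)) g _ t 1 _.
  by move=> h x v; congr pair; rewrite /= scaler0 add0r.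
exact: schwartz_derivable.
Qed.

Lemma schwartz_line_measurable g w : schwartz_real g ->
  measurable_fun [set: R] (fun t => g (t, w)).
Proof. by move=> sg; apply: derivable_measurable; exact: schwartz_line_derivable. Qed.

Lemma is_derive_affine (a b t : R) : is_derive t (1 : R) (fun t : R => a * t + b) a.
Proof.
have -> : (fun t : R => a * t + b) = (a \*: (@id R)) + cst b by apply/funext.
by apply: is_derive_eq; rewrite addr0 -[LHS]/(a * 1) mulr1.
Qed.

Lemma cosDpihalf (x : R) : cos (x + pi / 2) = - sin x.
Proof. by rewrite cosD cos_pihalf sin_pihalf mulr0 mulr1 add0r. Qed.

Lemma is_derive_cosl (a b t : R) :
  is_derive t (1 : R) (fun t : R => cos (a * t + b)) (a * cos (a * t + b + pi / 2)).
Proof.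
have d1 := is_derive_affine a b t; have d2 := is_derive_cos (a * t + b).
have -> : a * cos (a * t + b + pi / 2) = - sin (a * t + b) * a.
  by rewrite cosDpihalf mulrC.
exact: (@is_derive1_comp R cos (fun t => a * t + b) t _ _ d2 d1).
Qed.

Lemma normr_cos_le1 (x : R) : `|cos x| <= 1.
Proof. by rewrite ler_norml cos_geN1 cos_le1. Qed.

Lemma measurable_cosl (a b : R) : measurable_fun [set: R] (fun t : R => cos (a * t + b)).
Proof.
by apply: derivable_measurable => t; exact: (@ex_derive _ _ _ _ _ _ _ (is_derive_cosl a b t)).
Qed.

Lemma cosT_integrand_bound g k w : schwartz_real g ->
  exists2 M, 0 <= M & forall th xi t, `|w| ^+ k * `|g (t, w) * cos (2 * pi * xi * t + th)| <= M * (oneDsqr t)^-1.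
Proof.
move=> sg; have [M M0 gM] := schwartz_cauchy_bound k sg; exists M => // th xi t.
apply: le_trans (gM t w); rewrite ler_wpM2l ?exprn_ge0// normrM ler_piMr//.
exact: normr_cos_le1.
Qed.

Lemma cosT_integrable th g xi w : schwartz_real g ->
  rintegrable mu (fun t => g (t, w) * cos (2 * pi * xi * t + th)).
Proof.
move=> sg; have [M M0 gM] := cosT_integrand_bound 0 w sg.
apply: (@rintegrable_oneDsqr _ M).
  by apply: measurable_funM; [exact: schwartz_line_measurable|exact: measurable_cosl].
by move=> t; have := gM th xi t; rewrite expr0 mul1r.
Qed.

Lemma cosT_bound_snd g k : schwartz_real g ->
  exists M, forall th p, `|p.2| ^+ k * `|cosT th g p| <= M.
Proof.
move=> sg; have [M M0 gM] := schwartz_cauchy_bound k sg.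
exists (M * \int[mu]_t (oneDsqr t)^-1) => th [xi w] /=.
have ic := cosT_integrable th xi w sg.
rewrite /cosT/= (le_trans (ler_wpM2l _ (le_normr_Rintegral measurableT ic))) ?exprn_ge0//.
rewrite -RintegralZl//; last exact: rintegrable_norm.
rewrite -[leRHS]RintegralZl//; last exact: rintegrable_oneDsqrV.
apply: le_Rintegral => //.
- exact: rintegrableZ (rintegrable_norm ic).
- exact: rintegrableZ (rintegrable_oneDsqrV R).
move=> t _; apply: le_trans (gM t w); rewrite ler_wpM2l ?exprn_ge0// normrM ler_piMr//.
exact: normr_cos_le1.
Qed.

Let fst_mul g := fun p : R * W => p.1 * g p.

Let schwartz_fst_mul g : schwartz_real g -> schwartz_real (fst_mul g).
Proof.
apply: (@schwartz_realM_linear _ _ (fun p : R * W => p.1) 1) => //.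
by move=> p; rewrite mul1r normX_fst.
Qed.

(** Integration by parts: the function [H], with phase advanced by pi / 2, has a derivative of
    integral 0, and differentiating its cosine advances the phase to [th + pi], which changes the
    sign of the original cosine. *)
Lemma cosT_parts th g p : schwartz_real g ->
  2 * pi * p.1 * cosT th g p = cosT (th + pi / 2) ('D_((1, 0) : R * W) g) p.
Proof.
move=> sg; case: p => xi w /=.
set c := 2 * pi * xi; set Dg := 'D_((1, 0) : R * W) g.
have sDg : schwartz_real Dg by exact: schwartz_derive.
pose H (t : R) := g (t, w) * cos (c * t + (th + pi / 2)).
have dgl f t : schwartz_real f ->
    is_derive t (1 : R) (fun t => f (t, w)) ('D_((1, 0) : R * W) f (t, w)).
  move=> sf; apply: DeriveDef; first exact: schwartz_line_derivable.
  exact: (congr1 (fun h => h t) (schwartz_line_derive w sf)).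
have dH t : is_derive t (1 : R) H (Dg (t, w) * cos (c * t + (th + pi / 2)) - c * (g (t, w) * cos (c * t + th))).
  have d1 := dgl g t sg; have d2 := is_derive_cosl c (th + pi / 2) t.
  apply: (@is_derive_eq _ _ _ _ _ _ _ _ (is_deriveM d1 d2)).
  rewrite -![_ *: _]/(_ * _) (_ : cos (c * t + (th + pi / 2) + pi / 2) = - cos (c * t + th)).
    rewrite -[X in _ + _ * X]/(Dg (t, w)).
    by move: (g (t, w)) (Dg (t, w)) (cos _) (cos _) => ? ? ? ?; ring.
  by rewrite (_ : _ + _ + pi / 2 = c * t + th + pi) ?cosDpi//; field.
have i1 := cosT_integrable (th + pi / 2) xi w sDg.
have i2 := cosT_integrable th xi w sg.
have [M M0 gM] := cosT_integrand_bound 0 w sg.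
have [N N0 DgN] := cosT_integrand_bound 0 w sDg.
have w0 (t : R) := oneDsqrV_ge0 t.
have := @Rintegral_derive0 R H _ (M + (N + `|c| * M)) dH.
rewrite RintegralB//; last exact: rintegrableZ.
rewrite RintegralZl// => H0; apply/esym/eqP; rewrite -subr_eq0; apply/eqP; apply: H0.
- move=> t; have := gM (th + pi / 2) xi t; rewrite expr0 mul1r => /le_trans; apply.
  by rewrite ler_wpM2r// lerDl addr_ge0// mulr_ge0.
- move=> t; apply: (le_trans (ler_normB _ _)).
    have := gM th xi t; have := DgN (th + pi / 2) xi t; rewrite !expr0 !mul1r => h1 h2.
    apply: (@le_trans _ _ ((N + `|c| * M) * (oneDsqr t)^-1)); last by rewrite ler_wpM2r// lerDr.
    by rewrite [leRHS]mulrDl; apply: lerD => //; rewrite normrM -mulrA ler_wpM2l.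
Qed.

(** Each power of the frequency is traded, by [cosT_parts], for one derivative of [g], at the cost
    of a factor [(2 * pi)^-1]. *)
Lemma cosT_bound_fst k g th : schwartz_real g ->
  exists M, forall p, `|p.1| ^+ k * `|cosT th g p| <= M.
Proof.
elim: k g th => [|k ih] g th sg.
  have [M gM] := cosT_bound_snd 0 sg; exists M => p.
  by have := gM th p; rewrite !expr0.
have [M gM] := ih _ (th + pi / 2) (schwartz_derive ((1, 0) : R * W) sg).
exists (M * (2 * pi)^-1) => p; have := gM p; rewrite -cosT_parts// => h.
have p0 : 0 < 2 * pi :> R by rewrite mulr_gt0 ?pi_gt0.
rewrite ler_pdivlMr//; apply: le_trans h.
by rewrite !normrM (gtr0_norm (pi_gt0 R)) gtr0_norm// exprSr le_eqVlt; apply/orP; left; apply/eqP; ring.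
Qed.

Lemma cosT_rapid g th : schwartz_real g -> rapid_decay (cosT th g).
Proof.
move=> sg k; have [M gM] := cosT_bound_fst k th sg; have [N gN] := cosT_bound_snd k sg.
exists (M + N) => p.
rewrite (le_trans _ (lerD (gM p) (gN th p)))// -mulrDl ler_wpM2r// normX_pair//.
Qed.

Lemma derive_line (V : normedModType R) (f : V -> R) (p v : V) :
  derivable (fun h : R => f (h *: v + p)) (0 : R) (1 : R) ->
  derivable f p v /\ 'D_v f p = 'D_(1 : R) (fun h : R => f (h *: v + p)) (0 : R).
Proof.
rewrite /derivable /derive.
have -> : (fun h : R => h^-1 *: (((fun h : R => f (h *: v + p)) \o shift 0) (h *: 1) -
    f (0 *: v + p))) = (fun h => h^-1 *: ((f \o shift p) (h *: v) - f p)).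
  by apply/funext => h /=; rewrite scale0r add0r addr0 -[h *: 1]/(h * 1) mulr1.
by [].
Qed.

(** The W-component of the direction differentiates [g]; its R-component brings down the factor
    [2 * pi * v.1 * t] and advances the phase. Both terms are again cosine transforms of Schwartz
    functions, as [schwartz_span] requires. *)
Lemma cosT_derive g th (p v : R * W) : schwartz_real g ->
  derivable (cosT th g : R * W -> R) p v /\
  'D_v (cosT th g : R * W -> R) p = cosT th ('D_((0, v.2) : R * W) g) p
    + cosT (th + pi / 2) (fun q : R * W => 2 * pi * v.1 * (q.1 * g q)) p.
Proof.
move=> sg; case: p v => xi w [a v] /=.
set Dg := 'D_((0, v) : R * W) g.
have sDg : schwartz_real Dg by exact: schwartz_derive.
have stg : schwartz_real (fun q : R * W => 2 * pi * a * (q.1 * g q)).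
  by apply: schwartz_realZ; exact: schwartz_fst_mul.
pose f (h t : R) := g (t, h *: v + w) * cos (2 * pi * (h * a + xi) * t + th).
pose df (h t : R) := Dg (t, h *: v + w) * cos (2 * pi * (h * a + xi) * t + th) +
  2 * pi * a * (t * g (t, h *: v + w)) * cos (2 * pi * (h * a + xi) * t + (th + pi / 2)).
have dg h t : is_derive h (1 : R) (fun h => g (t, h *: v + w)) (Dg (t, h *: v + w)).
  have [|d E] := @derive_pullback R R (R * W)%type (fun h => (t, h *: v + w))
    (fun h => (0, h *: v)) g _ h 1 (@schwartz_derivable _ _ _ sg (t, h *: v + w) (0, (1 : R) *: v)).
    move=> k x y; congr pair; first by rewrite /= scaler0 add0r.
    by rewrite /= scalerDl scalerA addrA.
  by apply: DeriveDef => //; apply: (etrans E); rewrite scale1r.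
have dfE h t : is_derive h (1 : R) (fun h => f h t) (df h t).
  have d1 := dg h t; have d2 := is_derive_cosl (2 * pi * a * t) (2 * pi * xi * t + th) h.
  have E s : cos (2 * pi * a * t * s + (2 * pi * xi * t + th)) = cos (2 * pi * (s * a + xi) * t + th).
    by congr cos; ring.
  rewrite (_ : f^~ t = fun h => g (t, h *: v + w) * cos (2 * pi * a * t * h + (2 * pi * xi * t + th))); last first.
    by apply/funext => s; rewrite E.
  apply: (@is_derive_eq _ _ _ _ _ _ _ _ (is_deriveM d1 d2)).
  rewrite -![_ *: _]/(_ * _) /df -E.
  rewrite (_ : cos (2 * pi * a * t * h + (2 * pi * xi * t + th) + pi / 2) =
     cos (2 * pi * (h * a + xi) * t + (th + pi / 2))); last by congr cos; ring.
  rewrite -[X in _ + _ * X]/(Dg (t, h *: v + w)).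
  by move: (g _) (Dg _) (cos _) (cos _) => ? ? ? ?; ring.
have AE h : h *: ((a, v) : R * W) + (xi, w) = (h * a + xi, h *: v + w) by [].
have FE : (fun h : R => cosT th g (h *: ((a, v) : R * W) + (xi, w))) =
    fun h => \int[mu]_(t in setT) f h t by [].
have if_ h : rintegrable mu (f h) by exact: cosT_integrable.
have [M M0 DgM] := schwartz_cauchy_bound 0 sDg.
have [N N0 gN] := schwartz_cauchy_bound 0 stg.
have i1 : rintegrable mu (fun t => Dg (t, w) * cos (2 * pi * xi * t + th)) by exact: cosT_integrable.
have i2 : rintegrable mu (fun t => (2 * pi * a * (t * g (t, w))) * cos (2 * pi * xi * t + (th + pi / 2))).
  exact: (cosT_integrable (th + pi / 2) xi w stg).
(* The bound is free of [h], because the Cauchy bounds are uniform in the W-argument and cosines are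
   at most 1; this is the majorant for differentiation under the integral. *)
have dfb h t : `|df h t| <= (M + N) * (oneDsqr t)^-1.
  rewrite mulrDl; apply: (le_trans (ler_normD _ _)).
  apply: lerD; rewrite normrM; apply: (le_trans (ler_piMr _ (normr_cos_le1 _))) => //.
    by have := DgM t (h *: v + w); rewrite expr0 mul1r.
  by have := gN t (h *: v + w); rewrite expr0 mul1r.
have G0 t : 0 <= (M + N) * (oneDsqr t)^-1 by rewrite mulr_ge0 ?addr_ge0 ?oneDsqrV_ge0.
have iG : rintegrable mu (fun t => (M + N) * (oneDsqr t)^-1).
  exact: rintegrableZ (rintegrable_oneDsqrV R).
have I0 : [set` `](-1)%R, 1%R[ ] (0 : R) by rewrite /= in_itv/= ltrN10 ltr01.
have df1 h t : [set` `](-1)%R, 1%R[ ] h -> setT t -> derivable (f^~ t) h 1.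
  by move=> _ _; have dft := dfE h t; exact: ex_derive.
have dfG h t : [set` `](-1)%R, 1%R[ ] h -> setT t -> `|partial1of2 f h t| <= (M + N) * (oneDsqr t)^-1.
  by move=> _ _; rewrite partial1of2E; have dft := dfE h t; rewrite derive_val.
have [] := derive_line (f := cosT th g) (p := (xi, w)) (v := (a, v)).
  rewrite FE.
  exact: (derivable_under_integral measurableT I0 (fun h _ => if_ h) df1 G0 iG dfG).
move=> dc Ec; split => //; rewrite Ec FE -derive1E.
rewrite (differentiation_under_integral measurableT I0 (fun h _ => if_ h) df1 G0 iG dfG).
rewrite /cosT /= -RintegralD//; apply: eq_Rintegral => t _.
rewrite partial1of2E; have dft := dfE 0 t; rewrite derive_val /df.
by rewrite scale0r mul0r !add0r.
Qed.

Lemma schwartz_cosT th g : schwartz_real g -> schwartz_real (cosT th g).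
Proof.
move=> sg; apply: (@schwartz_span _ _ (fun f => exists th g, schwartz_real g /\ f = cosT th g)).
- by move=> _ [t [f [sf ->]]] x v; exact: (cosT_derive t x v sf).1.
- move=> _ [t [f [sf ->]]] v.
  rewrite (_ : 'D_v _ = fun p => cosT t ('D_((0, v.2) : R * W) f) p
    + cosT (t + pi / 2) (fun q : R * W => 2 * pi * v.1 * (q.1 * f q)) p).
    apply: addspan_add; apply: addspan_base.
      by exists t, ('D_((0, v.2) : R * W) f); split => //; exact: schwartz_derive.
    exists (t + pi / 2), (fun q : R * W => 2 * pi * v.1 * (q.1 * f q)); split => //.
    by apply: schwartz_realZ; exact: schwartz_fst_mul.
  by apply/funext => p; exact: (cosT_derive t p v sf).2.
- by move=> _ [t [f [sf ->]]]; exact: cosT_rapid.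
- by apply: addspan_base; exists th, g.
Qed.

End cosine_transform.

(** * Exponential damping and Poisson kernels *)

Section poisson_kernel.
Context (R : realType).
Local Notation mu := (@lebesgue_measure R).

Definition expk (eps x : R) : R := expR (- (eps * `|x|)).

Lemma expk_ge0 eps x : 0 <= expk eps x. Proof. exact: expR_ge0. Qed.

Lemma expk_le1 eps x : 0 <= eps -> expk eps x <= 1.
Proof. by move=> e0; rewrite /expk -expR0 ler_expR oppr_le0 mulr_ge0. Qed.

Lemma continuous_expk eps : continuous (expk eps).
Proof.
move=> x; apply: (@continuous_comp _ _ _ (fun x => - (eps * `|x|)) expR); last exact: continuous_expR.
by apply: cvgN; apply: cvgMl_tmp; apply: cvg_norm; exact: cvg_id.
Qed.

Lemma measurable_expk eps : measurable_fun [set: R] (expk eps).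
Proof. by apply: continuous_measurable_fun; exact: continuous_expk. Qed.

(** With y = eps |x| / 2 one has [e^(2 y) >= (1 + y)^2 >= 1 + y^2] and [x^2 = (4 / eps^2) y^2]; this
    explains the constant. *)
Lemma expk_le (eps x : R) : 0 < eps ->
  expk eps x <= (1 + 4 / eps ^+ 2) * (oneDsqr x)^-1.
Proof.
move=> e0; rewrite ler_pdivlMr ?ltr_pwDl ?sqr_ge0// /expk expRN ler_pdivrMl ?expR_gt0//.
set y := eps * `|x| / 2.
have y0 : 0 <= y by rewrite /y divr_ge0// mulr_ge0// ltW.
have h : (1 + y) ^+ 2 <= expR (eps * `|x|).
  rewrite (_ : eps * `|x| = y + y); last by rewrite /y -splitr.
  by rewrite expRD -expr2 lerXn2r// ?nnegrE ?expR_ge0 ?addr_ge0// expR_ge1Dx.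
have k0 : 0 <= 1 + 4 / eps ^+ 2 by rewrite addr_ge0// divr_ge0// sqr_ge0.
apply: le_trans (ler_wpM2r k0 h).
have yE : x ^+ 2 = y ^+ 2 * (4 / eps ^+ 2).
  by rewrite /y -(real_normK (num_real x)); field; rewrite gt_eqF.
rewrite /oneDsqr yE; set z := 4 / eps ^+ 2; have z0 : 0 <= z by rewrite divr_ge0// sqr_ge0.
have : 0 <= y ^+ 2 by exact: sqr_ge0.
move=> y2; rewrite sqrrD expr1n mul1r; nra.
Qed.

Lemma rintegrable_expk eps : 0 < eps -> rintegrable mu (expk eps).
Proof.
move=> e0; apply: (rintegrable_oneDsqr (measurable_expk eps)) => x.
by rewrite ger0_norm ?expk_ge0//; exact: expk_le.
Qed.

Lemma rintegrable_expk_cos eps a : 0 < eps -> rintegrable mu (fun x => expk eps x * cos (a * x)).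
Proof.
move=> e0; apply: (rintegrable_le _ (rintegrable_expk e0)).
  apply: measurable_funM; first exact: measurable_expk.
  by have := measurable_cosl a 0; under eq_fun do rewrite addr0.
by move=> x; rewrite normrM ger0_norm ?expk_ge0// ler_piMr ?expk_ge0// normr_cos_le1.
Qed.

(** The summand 1 makes the integrand nonnegative, as the fundamental theorem on a half-line and the
    symmetry argument of [even_line] both ask. The cosine integral is recovered afterwards by
    subtracting the integral of [expk], which the case a = 0 provides. *)
Let half_line (eps a : R) : 0 < eps ->
  \int[mu]_(x in `[0, +oo[) (expR (- (eps * x)) * (1 + cos (a * x))) =
  eps^-1 + eps / (eps ^+ 2 + a ^+ 2).
Proof.
move=> e0.
pose F (x : R) : R := expR (- (eps * x)) *
  (- eps^-1 + (a * sin (a * x) - eps * cos (a * x)) / (eps ^+ 2 + a ^+ 2)).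
have D0 : eps ^+ 2 + a ^+ 2 != 0 by rewrite gt_eqF// ltr_pwDl ?sqr_ge0// exprn_gt0.
have dm (c x : R) : is_derive x (1:R) (fun x : R => c * x) c.
  by have := is_derive_affine c 0 x; under [X in is_derive _ _ X _]eq_fun do rewrite addr0.
have dexp x : is_derive x (1:R) (fun x : R => expR (- (eps * x))) (expR (- (eps * x)) * - eps).
  have d1 : is_derive x (1:R) (fun x : R => - (eps * x)) (- eps).
    by under [X in is_derive _ _ X _]eq_fun do rewrite -mulNr.
  exact: (@is_derive1_comp R expR (fun x => - (eps * x)) x _ _ (is_derive_expR _) d1).
have dsin x : is_derive x (1:R) (fun x : R => sin (a * x)) (cos (a * x) * a).
  exact: (@is_derive1_comp R sin (fun x => a * x) x _ _ (is_derive_sin _) (dm a x)).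
have dcos x : is_derive x (1:R) (fun x : R => cos (a * x)) (- sin (a * x) * a).
  exact: (@is_derive1_comp R cos (fun x => a * x) x _ _ (is_derive_cos _) (dm a x)).
pose G (x : R) : R := (a * sin (a * x) - eps * cos (a * x)).
have dG x : is_derive x (1:R) G (a * (cos (a * x) * a) - eps * (- sin (a * x) * a)).
  by have := is_deriveB (is_deriveZ a (dsin x)) (is_deriveZ eps (dcos x)).
have dF x : is_derive x (1:R) F (expR (- (eps * x)) * (1 + cos (a * x))).
  pose H := (fun x => - eps^-1 + G x / (eps ^+ 2 + a ^+ 2)).
  have dH : is_derive x (1:R) H ((a * (cos (a * x) * a) - eps * (- sin (a * x) * a)) / (eps ^+ 2 + a ^+ 2)).
    have := is_deriveD (is_derive_cst (- eps^-1) x (1:R)) (is_deriveZ ((eps ^+ 2 + a ^+ 2)^-1) (dG x)).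
    rewrite add0r -[_ *: _]/(_ * _) mulrC.
    rewrite (_ : cst _ + _ = H)//.
    by apply/funext => y; rewrite /H /= mulrC.
  apply: (@is_derive_eq _ _ _ _ _ _ _ _ (is_deriveM (dexp x) dH)).
  rewrite -![_ *: _]/(_ * _) /H /G.
  by move: (expR _) (sin _) (cos _) => E S C; field; rewrite D0 gt_eqF.
have cF x : {for x, continuous F}.
  by apply: differentiable_continuous; apply/derivable1_diffP; have dFx := dF x; exact: ex_derive.
rewrite (@Rintegral_ge0_continuous_FTC2y R _ F 0 0).
- by rewrite /F !mulr0 oppr0 expR0 sin0 cos0; field; rewrite D0 gt_eqF.
- by move=> x _; rewrite mulr_ge0 ?expR_ge0// -lerBlDl sub0r cos_geN1.
- apply: continuous_in_subspaceT => x _.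
  have d1 := dexp x; have d2 := is_deriveD (is_derive_cst (1:R) x (1:R)) (dcos x).
  apply: differentiable_continuous; apply/derivable1_diffP.
  by apply: derivableM; exact: ex_derive.
- pose K : R := eps^-1 + (`|a| + eps) / (eps ^+ 2 + a ^+ 2).
  have D1 : 0 < eps ^+ 2 + a ^+ 2 by rewrite ltr_pwDl ?sqr_ge0// exprn_gt0.
  have K0 : 0 <= K.
    by apply: addr_ge0; [rewrite invr_ge0 ltW|apply: divr_ge0; [rewrite addr_ge0// ltW|exact: ltW]].
  have FK x : `|F x| <= K * expR (- (eps * x)).
    rewrite normrM ger0_norm ?expR_ge0// mulrC ler_wpM2r ?expR_ge0//.
    apply: (le_trans (ler_normD _ _)); rewrite normrN gtr0_norm ?invr_gt0// lerD2l.
    rewrite normrM normfV (gtr0_norm D1) ler_wpM2r ?invr_ge0 ?(ltW D1)//.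
    apply: (le_trans (ler_normB _ _)); rewrite !normrM (gtr0_norm e0); apply: lerD.
      by rewrite ler_piMr// ler_norml sin_geN1 sin_le1.
    by rewrite ler_piMr ?(ltW e0)// normr_cos_le1.
  apply/cvgrPdist_le => delta delta0; near=> x.
  rewrite sub0r normrN (le_trans (FK x))// expRN ler_pdivrMr ?expR_gt0//.
  have x0 : K / (delta * eps) <= x by near: x; apply: nbhs_pinfty_ge; exact: num_real.
  apply: (@le_trans _ _ (delta * (eps * x))).
    by rewrite mulrA -ler_pdivrMl ?mulr_gt0// mulrC.
  rewrite ler_pM2l//; by apply: (le_trans _ (expR_ge1Dx _)); rewrite lerDr.
- by move=> x _; have dFx := dF x; exact: ex_derive.
- apply: cvg_at_right_filter; exact: cF.
- by move=> x _; rewrite derive1E; have dFx := dF x; rewrite derive_val.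
Unshelve. all: by end_near. Qed.

Let even_line (eps a : R) : 0 < eps ->
  \int[mu]_x (expk eps x * (1 + cos (a * x))) = 2 * (eps^-1 + eps / (eps ^+ 2 + a ^+ 2)).
Proof.
move=> e0; rewrite -half_line// /Rintegral (@ge0_symfun_integralT _ (fun x => expk eps x * (1 + cos (a * x)))).
- rewrite (_ : [set x | 0 <= x] = `[0%R, +oo[%classic); last first.
    by apply/seteqP; split => x /=; rewrite in_itv/= andbT.
  rewrite fineM; [|by []|].
    congr (_ * fine _); apply: eq_integral => x; rewrite inE/= in_itv/= andbT => x0.
    by rewrite /expk ger0_norm.
  have i1 : rintegrable mu (fun x => expk eps x * (1 + cos (a * x))).
    have := rintegrableD (rintegrable_expk e0) (rintegrable_expk_cos a e0).
    by apply: eq_integrable => // x _ /=; rewrite mulrDr mulr1.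
  have i2 : mu.-integrable `[0, +oo[ (EFin \o (fun x => expk eps x * (1 + cos (a * x)))).
    exact: (integrableS measurableT).
  exact: integrable_fin_num i2.
- by move=> x; rewrite mulr_ge0 ?expk_ge0// -lerBlDl sub0r cos_geN1.
- move=> x; apply: cvgM; first exact: continuous_expk.
  apply: cvgD; first exact: cvg_cst.
  apply: (@continuous_comp _ _ _ (fun x => a * x) cos); last exact: continuous_cos.
  by apply: cvgMl_tmp; exact: cvg_id.
- by move=> x; rewrite /= /expk normrN mulrN cosN.
Qed.

Lemma Rintegral_expk_cos (eps a : R) : 0 < eps ->
  \int[mu]_x (expk eps x * cos (a * x)) = 2 * eps / (eps ^+ 2 + a ^+ 2).
Proof.
move=> e0; have D0 : eps ^+ 2 + a ^+ 2 != 0 by rewrite gt_eqF// ltr_pwDl ?sqr_ge0// exprn_gt0.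
have i0 := rintegrable_expk e0.
have i1 := rintegrable_expk_cos a e0.
have I0 : \int[mu]_x expk eps x = 2 / eps.
  have := even_line 0 e0.
  rewrite (_ : (fun x => _) = (fun x => 2 * expk eps x)); last first.
    by apply/funext => x; rewrite mul0r cos0; ring.
  rewrite RintegralZl// => /(congr1 ( *%R 2^-1)); rewrite mulKf// => ->.
  by field; rewrite gt_eqF.
have := even_line a e0.
rewrite (_ : (fun x => _) = (fun x => expk eps x + expk eps x * cos (a * x))); last first.
  by apply/funext => x; rewrite mulrDr mulr1.
rewrite RintegralD// I0 => /(congr1 (fun z => z - 2 / eps)); rewrite addrC addKr => ->.
by field; rewrite D0 gt_eqF.
Qed.

Lemma Rintegral_expk_sin (eps a : R) : 0 < eps ->
  \int[mu]_x (expk eps x * sin (a * x)) = 0.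
Proof.
move=> e0.
have i1 : rintegrable mu (fun x => expk eps x * sin (a * x)).
  apply: (rintegrable_le _ (rintegrable_expk e0)).
    apply: measurable_funM; first exact: measurable_expk.
    have := measurable_cosl a (- (pi / 2)); under eq_fun do rewrite cosB cos_pihalf sin_pihalf mulr0 add0r mulr1.
    by [].
  by move=> x; rewrite normrM ger0_norm ?expk_ge0// ler_piMr ?expk_ge0// ler_norml sin_geN1 sin_le1.
have N0 : (-1 : R) != 0 by rewrite oppr_eq0 oner_eq0.
have := @Rintegral_affine R (-1) 0 N0 _ i1; rewrite normrN1 mul1r.
rewrite [X in _ = X -> _](_ : _ = - \int[mu]_x (expk eps x * sin (a * x))); last first.
  rewrite -RintegralN//; apply: eq_Rintegral => x _.
  by rewrite addr0 mulN1r /expk normrN mulrN sinN mulrN.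
by move/eqP; rewrite -addr_eq0 -mulr2n mulrn_eq0/= => /eqP.
Qed.

Lemma cintegral_expk (eps s : R) : 0 < eps ->
  cintegral mu (fun x => (expk eps x)%:C * e (x * s)) =
  (2 * eps / (eps ^+ 2 + (2 * pi * s) ^+ 2))%:C.
Proof.
move=> e0; apply: complexP => /=.
  rewrite -Rintegral_expk_cos//; apply: eq_Rintegral => x _.
  by rewrite mul0r subr0 [x * s]mulrC mulrA.
rewrite -[RHS](Rintegral_expk_sin (2 * pi * s) e0); apply: eq_Rintegral => x _.
by rewrite mul0r addr0 [x * s]mulrC mulrA.
Qed.

End poisson_kernel.

(** * The one-variable Fourier transform with a parameter *)

Section one_dim_fourier.
Context (R : realType) (W : normedModType R).
Local Notation mu := (@lebesgue_measure R).
Implicit Types f : R * W -> R[i].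

Definition FT1 f (p : R * W) : R[i] := cintegral mu (fun t => f (t, p.2) * ebar (p.1 * t)).

Let sin_cos (y : R) : sin y = cos (y - pi / 2).
Proof. by rewrite cosB cos_pihalf sin_pihalf mulr0 add0r mulr1. Qed.

(** Real and imaginary parts of the transform are sums of cosine transforms with phases 0 and plus
    or minus pi / 2, so [schwartz_cosT] applies to them. *)
Lemma FT1_ReE f p : schwartz f ->
  Re (FT1 f p) = cosT 0 (fun q => Re (f q)) p + cosT (- (pi / 2)) (fun q => Im (f q)) p.
Proof.
case: p => xi w [f1 f2]; rewrite /FT1 /cosT/= -RintegralD//=.
- apply: eq_Rintegral => t _; rewrite ReM/= addr0 -sin_cos.
  by rewrite !mulrN cosN sinN mulrN opprK mulrA.
- exact: (cosT_integrable 0 xi w f1).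
- exact: (cosT_integrable (- (pi / 2)) xi w f2).
Qed.

Lemma FT1_ImE f p : schwartz f ->
  Im (FT1 f p) = cosT 0 (fun q => Im (f q)) p + cosT (pi / 2) (fun q => Re (f q)) p.
Proof.
case: p => xi w [f1 f2]; rewrite /FT1 /cosT/= -RintegralD//=.
- apply: eq_Rintegral => t _; rewrite ImM/= addr0 cosDpihalf.
  by rewrite !mulrN cosN sinN !mulrN !mulrA addrC.
- exact: (cosT_integrable 0 xi w f2).
- exact: (cosT_integrable (pi / 2) xi w f1).
Qed.

Lemma schwartz_FT1 f : schwartz f -> schwartz (FT1 f).
Proof.
move=> sf; have [f1 f2] := sf; split.
  under eq_fun do rewrite FT1_ReE//.
  by apply: schwartz_realD; exact: schwartz_cosT.
under eq_fun do rewrite FT1_ImE//.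
by apply: schwartz_realD; exact: schwartz_cosT.
Qed.

Lemma schwartz_line_cmeasurable f w : schwartz f ->
  @cmeasurable _ (measurableTypeR R) R (fun t => f (t, w)).
Proof.
by move=> [f1 f2]; split; [exact: (schwartz_line_measurable w f1)|exact: (schwartz_line_measurable w f2)].
Qed.

Lemma schwartz_cauchy_normc f k : schwartz f ->
  exists2 M, 0 <= M & forall t w, `|w| ^+ k * normc (f (t, w)) <= M * (oneDsqr t)^-1.
Proof.
move=> [/(schwartz_cauchy_bound k)[M M0 fM] /(schwartz_cauchy_bound k)[N N0 fN]].
exists (M + N); first exact: addr_ge0.
move=> t w; rewrite mulrDl; apply: le_trans (lerD (fM t w) (fN t w)).
by rewrite -mulrDr ler_wpM2l ?exprn_ge0// normc_le.
Qed.

Lemma schwartz_line_cintegrable f w : schwartz f -> cintegrable mu (fun t => f (t, w)).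
Proof.
move=> sf; have [M M0 fM] := schwartz_cauchy_normc 0 sf.
apply: (cintegrable_le (schwartz_line_cmeasurable w sf) (rintegrableZ M (rintegrable_oneDsqrV R))).
by move=> t; have := fM t w; rewrite expr0 mul1r.
Qed.

Lemma schwartz_line_continuous f w : schwartz f ->
  continuous (fun t => Re (f (t, w))) /\ continuous (fun t => Im (f (t, w))).
Proof.
have dc (g : R -> R) : (forall t, derivable g t 1) -> continuous g.
  by move=> dg t; apply: differentiable_continuous; apply/derivable1_diffP.
by move=> [f1 f2]; split; apply: dc;
  [exact: (@schwartz_line_derivable _ _ _ w f1)|exact: (@schwartz_line_derivable _ _ _ w f2)].
Qed.

Lemma cintegral_dominated_cvg d (T : measurableType d) (m : {measure set T -> \bar R})
    (f_ : (T -> R[i])^nat) (f : T -> R[i]) (g : T -> R) :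
  (forall n, cmeasurable (f_ n)) -> rintegrable m g ->
  (forall n x, normc (f_ n x) <= g x) ->
  (forall x, Re (f_ n x) @[n --> \oo] --> Re (f x)) ->
  (forall x, Im (f_ n x) @[n --> \oo] --> Im (f x)) ->
  Re (cintegral m (f_ n)) @[n --> \oo] --> Re (cintegral m f) /\
  Im (cintegral m (f_ n)) @[n --> \oo] --> Im (cintegral m f).
Proof.
move=> mf ig fg f1 f2; split; apply: (Rintegral_dominated_cvg _ ig) => //.
- by move=> n; case: (mf n).
- by move=> n x; exact: le_trans (Re_le_normc _) (fg n x).
- by move=> n; case: (mf n).
- by move=> n x; exact: le_trans (Im_le_normc _) (fg n x).
Qed.

Let eps_ (n : nat) : R := n.+1%:R^-1.

Let eps_gt0 n : 0 < eps_ n. Proof. by rewrite invr_gt0. Qed.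

Let eps_cvg : eps_ n @[n --> \oo] --> (0 : R).
Proof. exact: cvg_harmonic. Qed.

Lemma ReZ (a : R) (z : R[i]) : Re (a%:C * z) = a * Re z.
Proof. by rewrite ReM/= mul0r subr0. Qed.
Lemma ImZ (a : R) (z : R[i]) : Im (a%:C * z) = a * Im z.
Proof. by rewrite ImM/= mul0r addr0. Qed.
Lemma normcZ (a : R) (z : R[i]) : normc (a%:C * z) = `|a| * normc z.
Proof. by rewrite normcM; congr (_ * _); rewrite normcE_sqrt /sqnormc /= expr0n addr0 sqrtr_sqr. Qed.

(** Measured in units of its width [E / (2 * P)], with P = pi, the Poisson kernel becomes the fixed
    Cauchy density. *)
Let poisson_scaling (P E y x : R) : 0 < P -> 0 < E ->
  E / (2 * P) * (2 * E / (E ^+ 2 + (2 * P * (x - (E / (2 * P) * y + x))) ^+ 2)) =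
  (P * oneDsqr y)^-1.
Proof.
move=> P0 E0; have y0 : 1 + y ^+ 2 != 0 by rewrite gt_eqF// ltr_pwDl// sqr_ge0.
rewrite (_ : E ^+ 2 + _ = E ^+ 2 * oneDsqr y).
  by rewrite /oneDsqr; field; rewrite y0 !lt0r_neq0.
by rewrite /oneDsqr; field; rewrite lt0r_neq0.
Qed.

(* Summation by the factors expk (eps_ n), whose Fourier transforms are Poisson kernels. *)
Let I_ f x w n := cintegral mu (fun xi => (expk (eps_ n) xi)%:C * (FT1 f (xi, w) * e (xi * x))).

(** One side of the comparison: the damping factors increase to 1, and the modulus of the transform
    dominates. *)
Let I_cvg f x w : schwartz f ->
  Re (I_ f x w n) @[n --> \oo] --> Re (cintegral mu (fun xi => FT1 f (xi, w) * e (xi * x))) /\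
  Im (I_ f x w n) @[n --> \oo] --> Im (cintegral mu (fun xi => FT1 f (xi, w) * e (xi * x))).
Proof.
move=> sf; have sF := schwartz_FT1 sf.
have mG : @cmeasurable _ (measurableTypeR R) R (fun xi => FT1 f (xi, w) * e (xi * x)).
  apply: cmeasurableM; first exact: schwartz_line_cmeasurable.
  by apply: cmeasurable_e; exact: (@measurable_funM _ _ _ _ id (cst x)).
have ck xi : expk (eps_ n) xi @[n --> \oo] --> (1 : R).
  have h1 : - (eps_ n * `|xi|) @[n --> \oo] --> - (0 * `|xi|).
    by apply: cvgN; apply: cvgMr_tmp; exact: eps_cvg.
  have h2 : expR (- (eps_ n * `|xi|)) @[n --> \oo] --> expR (- (0 * `|xi|)).
    exact: (cvg_comp _ _ h1 (@continuous_expR R _)).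
  by move: h2; rewrite mul0r oppr0 expR0.
have ckz xi z : expk (eps_ n) xi * z @[n --> \oo] --> z.
  have : expk (eps_ n) xi * z @[n --> \oo] --> 1 * z by apply: cvgMr_tmp; exact: ck.
  by rewrite mul1r.
apply: (@cintegral_dominated_cvg _ _ mu
  (fun n xi => (expk (eps_ n) xi)%:C * (FT1 f (xi, w) * e (xi * x))) _
  (fun xi => normc (FT1 f (xi, w) * e (xi * x)))).
- move=> n; apply: cmeasurableM => //; split; last exact: measurable_cst.
  exact: (@measurable_expk R (eps_ n)).
- have [M M0 FM] := schwartz_cauchy_normc 0 sF.
  apply: (rintegrable_le _ (rintegrableZ M (rintegrable_oneDsqrV R))).
    exact: measurable_normc mG.
  by move=> t; have := FM t w; rewrite expr0 mul1r normcM normc_e mulr1 ger0_norm ?normc_ge0.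
- move=> n xi; rewrite normcZ ger0_norm ?expk_ge0// ler_piMl ?normc_ge0//.
  by rewrite expk_le1// ltW.
- by move=> xi; under eq_fun do rewrite ReZ; exact: ckz.
- by move=> xi; under eq_fun do rewrite ImZ; exact: ckz.
Qed.

(** The damping makes the double integral absolutely convergent, so Fubini allows the frequency to
    be integrated first, which gives a Poisson kernel. Rescaling by its width moves all dependence
    on [n] into the argument of [f]. *)
Let I_E f x w n : schwartz f -> I_ f x w n =
  cintegral mu (fun y => ((pi * oneDsqr y)^-1)%:C * f (eps_ n / (2 * pi) * y + x, w)).
Proof.
move=> sf; set eps := eps_ n; have eps0 : 0 < eps by exact: eps_gt0.
have [M M0 fM] := schwartz_cauchy_normc 0 sf.
pose h (p : measurableTypeR R * measurableTypeR R) : R[i] :=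
  (expk eps p.1)%:C * (f (p.2, w) * e (p.1 * (x - p.2))).
have mh : cmeasurable h.
  apply: cmeasurableM.
    split; last exact: measurable_cst.
    have mk := @measurable_expk R eps.
    exact: (@measurableT_comp _ _ _ _ _ _ (expk eps : measurableTypeR R -> R) _ fst mk).
  apply: cmeasurableM.
    exact: (cmeasurable_comp (schwartz_line_cmeasurable w sf)).
  apply: cmeasurable_e; apply: measurable_funM; first exact: measurable_fst.
  by apply: measurable_funB => //; exact: measurable_snd.
have hb a b : normc (h (a, b)) <= expk eps a * (M * (oneDsqr b)^-1).
  rewrite /h normcZ normcM normc_e mulr1 ger0_norm ?expk_ge0// ler_wpM2l ?expk_ge0//.
  by have := fM b w; rewrite expr0 mul1r.
have ik := rintegrable_expk eps0.
have iM := rintegrableZ M (rintegrable_oneDsqrV R).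
have ifw := schwartz_line_cintegrable w sf.
transitivity (cintegral mu (fun xi => cintegral mu (fun t => h (xi, t)))).
  apply: eq_cintegral => xi; rewrite /FT1/=.
  rewrite -cintegralZr; last first.
    rewrite (_ : (fun t => _) = (fun t => f (t, w) * e (- (xi * t)))); last by [].
    by apply: cintegrableMe => //; apply: measurableT_comp => //; exact: measurable_funM.
  rewrite -cintegralZl; last first.
    rewrite (_ : (fun t => _) = (fun t => f (t, w) * e (- (xi * t) + xi * x))); last first.
      by apply/funext => t; rewrite eD mulrA.
    apply: cintegrableMe => //; apply: measurable_funD => //.
    by apply: measurableT_comp => //; exact: measurable_funM.
  apply: eq_cintegral => t; rewrite /h/= -mulrA -eD; congr (_ * (_ * e _)); ring.
rewrite (cfubC mh ik iM hb).
transitivity (cintegral mu (fun t => f (t, w) * (2 * eps / (eps ^+ 2 + (2 * pi * (x - t)) ^+ 2))%:C)).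
  apply: eq_cintegral => t; rewrite -cintegral_expk// -cintegralZl; last first.
    apply: cintegrableMe; last exact: measurable_funM.
    by split; [exact: ik|apply: (rintegrable_le _ ik) => [|y]; [exact: measurable_cst|rewrite normr0 expk_ge0]].
  by apply: eq_cintegral => xi; rewrite /h/= mulrCA mulrA.
have c0 : eps / (2 * pi) != 0.
  by rewrite mulf_neq0 ?gt_eqF// invr_gt0 mulr_gt0// pi_gt0.
have mP : @cmeasurable _ (measurableTypeR R) R (fun t => (2 * eps / (eps ^+ 2 + (2 * pi * (x - t)) ^+ 2))%:C).
  split; last exact: measurable_cst.
  apply: continuous_measurable_fun => t /=; apply: cvgMl_tmp; apply: cvgV.
    by rewrite gt_eqF// ltr_pwDl ?sqr_ge0// exprn_gt0.
  apply: cvgD; first exact: cvg_cst.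
  have cl : (2 * pi * (x - s)) @[s --> t] --> 2 * pi * (x - t).
    by apply: cvgMl_tmp; apply: cvgB; [exact: cvg_cst|exact: cvg_id].
  exact: (cvgM cl cl).
have iP : cintegrable mu (fun t => f (t, w) * (2 * eps / (eps ^+ 2 + (2 * pi * (x - t)) ^+ 2))%:C).
  apply: (cintegrable_le _ (rintegrableZ (2 * eps / eps ^+ 2) (cintegrable_normc ifw))).
    by apply: cmeasurableM mP; exact: schwartz_line_cmeasurable.
  move=> t; rewrite mulrC normcZ ler_wpM2r ?normc_ge0// ger0_norm.
    rewrite ler_wpM2l ?mulr_ge0// ?(ltW eps0)// lef_pV2 ?posrE ?exprn_gt0//.
      by rewrite lerDl sqr_ge0.
    by rewrite ltr_pwDl ?sqr_ge0// exprn_gt0.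
  by rewrite divr_ge0 ?mulr_ge0 ?addr_ge0 ?sqr_ge0// ltW.
rewrite (@cintegral_affine R _ x c0)// -cintegralZl; last exact: (@cintegrable_affine R _ x c0 _ iP).
apply: eq_cintegral => y; rewrite mulrCA mulrC -rmorphM/=; congr (_ %:C * _).
have p0 : 0 < pi :> R := pi_gt0 R.
rewrite ger0_norm ?divr_ge0 ?mulr_ge0 ?(ltW eps0) ?(ltW p0)//.
exact: poisson_scaling.
Qed.

Lemma FT1_inversion f x w : schwartz f ->
  cintegral mu (fun xi => FT1 f (xi, w) * e (xi * x)) = f (x, w).
Proof.
move=> sf; have [L1 L2] := I_cvg x w sf.
have [c1 c2] := schwartz_line_continuous w sf.
have [M M0 fM] := schwartz_cauchy_normc 0 sf.
have p0 : 0 < pi :> R := pi_gt0 R.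
have fb t : normc (f (t, w)) <= M.
  have := fM t w; rewrite expr0 mul1r => /le_trans; apply.
  by rewrite -[leRHS]mulr1 ler_wpM2l// oneDsqrV_le1.
have iw : rintegrable mu (fun y : R => (pi * oneDsqr y)^-1).
  have := rintegrableZ pi^-1 (rintegrable_oneDsqrV R).
  by apply: eq_integrable => // y _ /=; rewrite invfM.
have w0 (y : R) : 0 <= (pi * oneDsqr y)^-1.
  by rewrite invr_ge0 mulr_ge0 ?(ltW p0)// addr_ge0// sqr_ge0.
have mw : @cmeasurable _ (measurableTypeR R) R (fun y => (pi * oneDsqr y)^-1%:C).
  by split; [exact: rintegrable_measurable iw|exact: measurable_cst].
have cy y : eps_ n / (2 * pi) * y + x @[n --> \oo] --> x.
  have : eps_ n * ((2 * pi)^-1 * y) + x @[n --> \oo] --> 0 * ((2 * pi)^-1 * y) + x.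
    by apply: cvgD; [apply: cvgMr_tmp; exact: eps_cvg|exact: cvg_cst].
  by rewrite mul0r add0r; under eq_fun do rewrite mulrA.
have [K1 K2] : Re (I_ f x w n) @[n --> \oo] --> Re (f (x, w)) /\
    Im (I_ f x w n) @[n --> \oo] --> Im (f (x, w)).
  (* The density has total mass 1, so the expected limit is itself an integral against it, in the
     form that dominated convergence delivers. *)
  have E : f (x, w) = cintegral mu (fun y : R => (pi * oneDsqr y)^-1%:C * f (x, w)).
    rewrite cintegralZr; last first.
      split; first exact: iw.
      by have := rintegrableZ 0 iw; apply: eq_integrable => // y _ /=; rewrite mul0r.
    rewrite -[LHS]mul1r; congr (_ * _); rewrite /cintegral; apply: complexP => /=.
      rewrite (_ : \int[mu]_x0 _ = \int[mu]_y (pi^-1 * (oneDsqr y)^-1)); last first.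
        by apply: eq_Rintegral => y _; rewrite invfM.
      by rewrite RintegralZl ?Rintegral_oneDsqrV ?mulVf ?gt_eqF//; exact: rintegrable_oneDsqrV.
    by rewrite Rintegral_cst// mul0r.
  rewrite [X in _ --> Re X /\ _]E [X in _ /\ _ --> Im X]E.
  rewrite (_ : I_ f x w = fun n => cintegral mu (fun y =>
      (pi * oneDsqr y)^-1%:C * f (eps_ n / (2 * pi) * y + x, w))); last first.
    by apply/funext => n; rewrite I_E.
  apply: (@cintegral_dominated_cvg _ _ mu
     (fun n y => (pi * oneDsqr y)^-1%:C * f (eps_ n / (2 * pi) * y + x, w)) _
     (fun y => M * (pi * oneDsqr y)^-1)).
  - move=> n; apply: cmeasurableM => //.
    have := @cmeasurable_comp _ _ (measurableTypeR R) (measurableTypeR R) R _ (fun y => eps_ n / (2 * pi) * y + x)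
       (schwartz_line_cmeasurable w sf); apply.
    by apply: measurable_funD => //; exact: measurable_funM.
  - exact: rintegrableZ.
  - by move=> n y; rewrite normcZ ger0_norm// mulrC ler_wpM2r.
  - move=> y; under eq_fun do rewrite ReZ; rewrite ReZ; apply: cvgMl_tmp.
    exact: (cvg_comp _ _ (cy y) (c1 x)).
  - move=> y; under eq_fun do rewrite ImZ; rewrite ImZ; apply: cvgMl_tmp.
    exact: (cvg_comp _ _ (cy y) (c2 x)).
apply: complexP; [exact: cvg_unique L1 K1|exact: cvg_unique L2 K2].
Qed.

End one_dim_fourier.

(** * Schwartz functions and the Fourier transform on R^n *)

Section row_vectors.
Context (R : realType).
Local Notation mu := (@lebesgue_measure R).

Section cons.
Context (n : nat).
Implicit Types (v w : 'rV[R]_n.+1) (p : R * 'rV[R]_n).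

Lemma uncons_rV_inj : injective (@uncons_rV R n).
Proof.
move=> v w [h0 /rowP hl]; apply/rowP => i.
by have [j ->|->//] := unliftP ord0 i; have := hl j; rewrite !mxE.
Qed.

Lemma uncons_rVK : cancel (@uncons_rV R n) (@cons_rV R n).
Proof. by move=> v; apply: uncons_rV_inj; rewrite cons_rVK. Qed.

Lemma cons_rV_ord0 p : cons_rV p ord0 ord0 = p.1.
Proof. by have := congr1 fst (cons_rVK p). Qed.

Lemma cons_rV_lift p i : cons_rV p ord0 (lift ord0 i) = p.2 ord0 i.
Proof. by have /rowP/(_ i) := congr1 snd (cons_rVK p); rewrite mxE. Qed.

Lemma uncons_rV_linear (h : R) v w :
  uncons_rV (h *: v + w) = h *: (uncons_rV v : R * 'rV[R]_n) + uncons_rV w.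
Proof. by congr pair; rewrite /= ?mxE//; apply/rowP => i; rewrite !mxE. Qed.

Lemma cons_rV_linear (h : R) p q :
  cons_rV (h *: p + q) = h *: cons_rV p + cons_rV q.
Proof.
apply: (can_inj (@uncons_rVK)); rewrite uncons_rV_linear !cons_rVK//.
Qed.

Lemma dot_cons (u v : 'rV[R]_n.+1) :
  dot u v = (uncons_rV u).1 * (uncons_rV v).1 + dot (uncons_rV u).2 (uncons_rV v).2.
Proof.
by rewrite /dot big_ord_recl; congr (_ + _); apply: eq_bigr => i _; rewrite /= !mxE.
Qed.

End cons.

Lemma rV_coord_norm n (v : 'rV[R]_n) i : `|v ord0 i| <= `|v|.
Proof.
rewrite /Num.norm/= mx_normrE.
exact: (le_bigmax _ (fun ij : 'I_1 * 'I_n => `|v ij.1 ij.2|) (ord0, i)).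
Qed.

Lemma rV_norm_le n (v : 'rV[R]_n) M : 0 <= M -> (forall i, `|v ord0 i| <= M) -> `|v| <= M.
Proof.
move=> M0 vM; rewrite /Num.norm/= mx_normrE; apply: bigmax_le => // -[i j] _ /=.
by rewrite (ord1 i).
Qed.

Lemma norm_cons_rV n (p : R * 'rV[R]_n) : `|cons_rV p| = `|p|.
Proof.
apply/eqP; rewrite eq_le; apply/andP; split.
  apply: rV_norm_le => // i; have [j ->|->] := unliftP ord0 i.
    rewrite cons_rV_lift; apply: le_trans (rV_coord_norm _ _) _.
    by rewrite prod_normE le_max lexx orbT.
  by rewrite cons_rV_ord0 prod_normE le_max lexx.
rewrite prod_normE ge_max; apply/andP; split.
  by rewrite -(cons_rV_ord0 p); exact: rV_coord_norm.
by apply: rV_norm_le => // i; rewrite -cons_rV_lift; exact: rV_coord_norm.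
Qed.

Lemma norm_uncons_rV n (v : 'rV[R]_n.+1) : `|uncons_rV v : R * 'rV[R]_n| = `|v|.
Proof. by rewrite -norm_cons_rV uncons_rVK. Qed.

Lemma rV0_eq0 (v : 'rV[R]_0) : v = 0.
Proof. by apply/rowP => -[]. Qed.

Lemma derivable_line (V : normedModType R) (g : V -> R) (x v : V) :
  (forall y, derivable g y v) -> continuous (fun t : R => g (t *: v + x)).
Proof.
move=> dg t; apply: differentiable_continuous; apply/derivable1_diffP.
apply: (@derive_pullback R R V (fun t => t *: v + x) (fun t => t *: v) g _ t 1 _).1.
  by move=> h a b; rewrite scalerDl scalerA addrA.
by rewrite scale1r.
Qed.

(** Coordinates are peeled off one at a time and absorbed into [T], which is why the parameter space
    is arbitrary. Derivability along lines gives continuity in the peeled coordinate, and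
    [measurable_separately_continuous] adds it to the measurable variables. *)
Lemma measurable_fun_rV n d (T : measurableType d) (g : T * 'rV[R]_n -> R) :
  (forall w, measurable_fun setT (fun t => g (t, w))) ->
  (forall t x v, derivable (fun y => g (t, y)) x v) -> measurable_fun setT g.
Proof.
elim: n d T g => [|n ih] d T g mg dg.
  rewrite (_ : g = (fun t => g (t, 0)) \o fst).
    by apply: measurableT_comp => //; exact: mg.
  by apply/funext => -[t w]; rewrite (rV0_eq0 w).
pose g' (p : (T * R) * 'rV[R]_n) := g (p.1.1, cons_rV (p.1.2, p.2)).
have mg' : measurable_fun setT g'.
  apply: ih => [w|[t a] x v].
    apply: measurable_separately_continuous => [a|t]; first exact: (mg (cons_rV (a, w))).
    rewrite (_ : (fun a : R => g' ((t, a), w)) =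
        fun a : R => g (t, a *: cons_rV (1, 0) + cons_rV (0, w))).
      by apply: (@derivable_line _ (fun y => g (t, y))) => y; exact: dg.
    apply/funext => a; rewrite /g' /=; congr (g (_, _)).
    rewrite -cons_rV_linear; congr (cons_rV (_, _)).
      by rewrite /= addr0 -[_ *: _]/(_ * _) mulr1.
    by rewrite /= scaler0 add0r.
  apply: (@derive_pullback R _ _ (fun y => cons_rV (a, y)) (fun y => cons_rV (0, y)) (fun y => g (t, y)) _ x v (dg t _ _)).1.
  move=> h y z; rewrite -cons_rV_linear; congr (cons_rV (_, _)).
  by rewrite /= scaler0 add0r.
rewrite (_ : g = g' \o (fun p => ((p.1, (uncons_rV p.2).1), (uncons_rV p.2).2))).
  apply: measurableT_comp => //.
  apply/measurable_fun_pairP; split => /=.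
    apply/measurable_fun_pairP; split => /=; first exact: measurable_fst.
    by apply: (measurableT_comp (measurable_coord ord0)); exact: measurable_snd.
  apply: measurable_fun_rVP => i; under eq_fun do rewrite mxE.
  by apply: (measurableT_comp (measurable_coord _)); exact: measurable_snd.
by apply/funext => -[t w]; rewrite /g' /= -[in LHS](uncons_rVK w).
Qed.

Lemma schwartz_measurable_rV n (g : 'rV[R]_n -> R) : schwartz_real g -> measurable_fun setT g.
Proof.
move=> sg; have m : measurable_fun setT (fun p : unit * 'rV[R]_n => g p.2).
  by apply: measurable_fun_rV => // t x v; exact: schwartz_derivable.
have mp : measurable_fun setT (fun v : 'rV[R]_n => (tt, v)).
  by apply/measurable_fun_pairP; split; [exact: (measurable_cst tt)|exact: measurable_id].
exact: (measurableT_comp m mp).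
Qed.

Section slices.
Context (V W : normedModType R) (f : V * W -> R[i]).
Hypothesis sf : schwartz f.

Lemma schwartz_slice1 w : schwartz (fun x => f (x, w)).
Proof.
apply: (@schwartz_pullback _ V (V * W)%type (fun x => (x, w)) (fun x => (x, 0)) 1) => //.
  by move=> h x v; congr pair; rewrite /= scaler0 add0r.
by move=> x; rewrite mul1r prod_normE le_max lexx.
Qed.

Lemma schwartz_slice2 v : schwartz (fun x => f (v, x)).
Proof.
apply: (@schwartz_pullback _ W (V * W)%type (fun x => (v, x)) (fun x => (0, x)) 1) => //.
  by move=> h x u; congr pair; rewrite /= scaler0 add0r.
by move=> x; rewrite mul1r prod_normE le_max lexx orbT.
Qed.

End slices.

(** A dummy parameter in the zero-dimensional space makes the results with parameters apply to
    functions of [x] alone. *)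
Lemma schwartz_fst_rV0 n (f : 'rV[R]_n -> R[i]) : schwartz f ->
  schwartz (fun p : 'rV[R]_n * 'rV[R]_0 => f p.1).
Proof.
apply: (@schwartz_pullback _ _ _ fst fst 1) => // -[x w].
by rewrite mul1r prod_normE ge_max lexx /=; apply: rV_norm_le => // -[].
Qed.

Lemma schwartz_cmeasurable_rV n (f : 'rV[R]_n -> R[i]) : schwartz f -> cmeasurable f.
Proof. by move=> [f1 f2]; split; exact: schwartz_measurable_rV. Qed.

Lemma schwartz_cmeasurable_rV2 n m (f : 'rV[R]_n * 'rV[R]_m -> R[i]) : schwartz f -> cmeasurable f.
Proof.
move=> sf; split; apply: measurable_fun_rV => [w|t x v].
- by have [] := schwartz_cmeasurable_rV (schwartz_slice1 sf w).
- by have [/schwartz_derivable s1 _] := schwartz_slice2 sf t; exact: s1.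
- by have [] := schwartz_cmeasurable_rV (schwartz_slice1 sf w).
- by have [_ /schwartz_derivable s1] := schwartz_slice2 sf t; exact: s1.
Qed.

Lemma schwartz_cmeasurable_rV2R n m (f : 'rV[R]_n * 'rV[R]_m * R -> R[i]) : schwartz f -> cmeasurable f.
Proof.
have dc (g : R -> R) : (forall t v, derivable g t v) -> continuous g.
  by move=> dg t; apply: differentiable_continuous; apply/derivable1_diffP.
move=> sf; split; apply: measurable_separately_continuous => [t|x].
- by have [] := schwartz_cmeasurable_rV2 (schwartz_slice1 sf t).
- by have [/schwartz_derivable s1 _] := schwartz_slice2 sf x; apply: dc; exact: s1.
- by have [] := schwartz_cmeasurable_rV2 (schwartz_slice1 sf t).
- by have [_ /schwartz_derivable s1] := schwartz_slice2 sf x; apply: dc; exact: s1.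
Qed.

End row_vectors.

(** * Integration on R^n *)

Section leb_integrals.
Context (R : realType).
Local Notation mu := (@lebesgue_measure R).

Section step.
Context (n : nat).

Lemma rintegrable_leb_cons (g : 'rV[R]_n.+1 -> R) : measurable_fun setT g ->
  rintegrable (mu \x leb R n)%E (g \o @cons_rV R n) -> rintegrable (leb R n.+1) g.
Proof.
move=> mg ig; apply: (@integrable_pushforward _ _ _ _ R (@cons_rV R n) (@measurable_cons_rV R n)
  (mu \x leb R n)%E setT (EFin \o g)) => //; exact/measurable_EFinP.
Qed.

Lemma Rintegral_leb_cons (g : 'rV[R]_n.+1 -> R) : measurable_fun setT g ->
  rintegrable (mu \x leb R n)%E (g \o @cons_rV R n) ->
  \int[leb R n.+1]_x g x = \int[(mu \x leb R n)%E]_p g (cons_rV p).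
Proof.
move=> mg ig; rewrite /Rintegral; congr fine.
by apply: (@integral_pushforward _ _ _ _ R (@cons_rV R n) (@measurable_cons_rV R n)
  (mu \x leb R n)%E setT (EFin \o g)) => //; exact/measurable_EFinP.
Qed.

Lemma cintegral_leb_cons (g : 'rV[R]_n.+1 -> R[i]) : cmeasurable g ->
  cintegrable (mu \x leb R n)%E (g \o @cons_rV R n) ->
  cintegral (leb R n.+1) g = cintegral (mu \x leb R n)%E (g \o @cons_rV R n).
Proof.
move=> [m1 m2] [i1 i2]; rewrite /cintegral; congr (_ +i* _); exact: Rintegral_leb_cons.
Qed.

End step.

Lemma integral_leb0 (g : 'rV[R]_0 -> \bar R) : measurable_fun setT g ->
  (\int[leb R 0]_x g x = g 0%R)%E.
Proof. by move=> mg; rewrite integral_dirac// diracT mul1e. Qed.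

Lemma measurable_rV0 (g : 'rV[R]_0 -> R) : measurable_fun setT g.
Proof.
rewrite (_ : g = cst (g 0)); first exact: measurable_cst.
by apply/funext => x; rewrite (rV0_eq0 x).
Qed.

Lemma Rintegral_leb0 (g : 'rV[R]_0 -> R) : \int[leb R 0]_x g x = g 0.
Proof. by rewrite /Rintegral integral_leb0//; apply/measurable_EFinP; exact: measurable_rV0. Qed.

Lemma cintegral_leb0 (g : 'rV[R]_0 -> R[i]) : cintegral (leb R 0) g = g 0.
Proof. by apply: complexP; rewrite /= Rintegral_leb0. Qed.

(** The product form factors along [cons_rV], so integrability follows from the line by induction on
    the dimension. *)
Definition weight n (x : 'rV[R]_n) : R := \prod_(i < n) (oneDsqr (x ord0 i))^-1.

Lemma weight_ge0 n (x : 'rV[R]_n) : 0 <= weight x.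
Proof. by apply: prodr_ge0 => i _; exact: oneDsqrV_ge0. Qed.

Lemma weight_le1 n (x : 'rV[R]_n) : weight x <= 1.
Proof.
suff /andP[] : 0 <= weight x <= 1 by [].
rewrite /weight; elim/big_ind : _ => [|a b /andP[a0 a1] /andP[b0 b1]|i _].
- by rewrite ler01 lexx.
- by rewrite mulr_ge0// mulr_ile1.
- by rewrite oneDsqrV_ge0 oneDsqrV_le1.
Qed.

Lemma weight_cons n (p : R * 'rV[R]_n) : weight (cons_rV p) = (oneDsqr p.1)^-1 * weight p.2.
Proof.
rewrite /weight big_ord_recl cons_rV_ord0; congr (_ * _).
by apply: eq_bigr => i _; rewrite cons_rV_lift.
Qed.

Lemma measurable_weight n : measurable_fun setT (@weight n).
Proof.
apply: measurable_prod => i _.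
have mc : measurable_fun [set: R] (fun t : R => (oneDsqr t)^-1).
  exact: rintegrable_measurable (rintegrable_oneDsqrV R).
exact: (measurableT_comp mc (measurable_coord i)).
Qed.

Lemma rintegrable_weight n : rintegrable (leb R n) (@weight n).
Proof.
elim: n => [|n ih].
  apply: ge0_rintegrable; [exact: measurable_weight|exact: weight_ge0|].
  rewrite integral_leb0 ?ltry//; apply/measurable_EFinP; exact: measurable_weight.
apply: rintegrable_leb_cons; first exact: measurable_weight.
apply: (@fub_prod _ _ _ _ R mu (leb R n) _ (fun t => (oneDsqr t)^-1) (@weight n)).
- by apply: measurableT_comp; [exact: measurable_weight|exact: measurable_cons_rV].
- exact: rintegrable_oneDsqrV.
- exact: ih.
- by move=> x y; rewrite /= weight_cons/= ger0_norm// mulr_ge0 ?oneDsqrV_ge0 ?weight_ge0.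
Qed.

(** The right side is a product of [n] factors [(1 + |x|^2) / (1 + x_i^2)], each at least 1 because
    the norm is the maximum norm. *)
Lemma weight_norm_le n (x : 'rV[R]_n) : 1 <= (1 + `|x| ^+ 2) ^+ n * weight x.
Proof.
rewrite /weight -[X in _ ^+ X]card_ord -prodr_const -big_split/=.
elim/big_ind : _ => // [a b|i _]; first exact: mulr_ege1.
rewrite ler_pdivlMr ?mul1r; last by rewrite ltr_pwDl// sqr_ge0.
rewrite /oneDsqr lerD2l -(real_normK (num_real (x _ _))) lerXn2r// ?nnegrE//.
exact: rV_coord_norm.
Qed.

(** By [weight_norm_le] the weight costs a factor [(1 + |x|^2)^n], which is paid for by 2 n further
    orders of decay; [expr1D_le] contributes the [2 ^+ n]. *)
Lemma schwartz_weight_bound n (W : normedModType R) (f : 'rV[R]_n * W -> R[i]) k : schwartz f ->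
  exists2 M, 0 <= M & forall x w, `|w| ^+ k * normc (f (x, w)) <= M * weight x.
Proof.
move=> sf; have [M M0 fM] := schwartz_normc_bound k sf.
have [N N0 fN] := schwartz_normc_bound (k + 2 * n) sf.
exists (2 ^+ n * (M + N)) => [|x w]; first by rewrite mulr_ge0 ?exprn_ge0 ?addr_ge0.
have w0 := weight_ge0 x.
have hx : `|x| <= `|(x, w)| by rewrite prod_normE le_max lexx.
have hw : `|w| <= `|(x, w)| by rewrite prod_normE le_max lexx orbT.
set F := normc (f (x, w)); have F0 : 0 <= F by exact: normc_ge0.
apply: (@le_trans _ _ (`|w| ^+ k * F * ((1 + `|x| ^+ 2) ^+ n * weight x))).
  by rewrite ler_peMr ?weight_norm_le// mulr_ge0 ?exprn_ge0.
rewrite mulrA ler_wpM2r//.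
apply: (@le_trans _ _ (`|w| ^+ k * F * (2 ^+ n * (1 + (`|x| ^+ 2) ^+ n)))).
  by rewrite ler_wpM2l ?mulr_ge0 ?exprn_ge0// expr1D_le// exprn_ge0.
rewrite mulrCA ler_wpM2l ?exprn_ge0// mulrDr mulr1; apply: lerD.
  by apply: le_trans (fM (x, w)); rewrite ler_wpM2r// lerXn2r// nnegrE.
apply: le_trans (fN (x, w)); rewrite mulrAC ler_wpM2r// exprD -exprM.
by rewrite ler_pM ?exprn_ge0// lerXn2r// nnegrE.
Qed.

Lemma schwartz_weight_bound1 n (f : 'rV[R]_n -> R[i]) : schwartz f ->
  exists2 M, 0 <= M & forall x, normc (f x) <= M * weight x.
Proof.
move=> sf.
have [M M0 fM] := schwartz_weight_bound 0 (schwartz_fst_rV0 sf).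
by exists M => // x; have := fM x 0; rewrite expr0 mul1r.
Qed.

Lemma schwartz_cintegrable n (f : 'rV[R]_n -> R[i]) : schwartz f -> cintegrable (leb R n) f.
Proof.
move=> sf; have [M M0 fM] := schwartz_weight_bound1 sf.
exact: (cintegrable_le (schwartz_cmeasurable_rV sf) (rintegrableZ M (@rintegrable_weight n)) fM).
Qed.

Section translation.

Lemma measurable_addrV n (a : 'rV[R]_n) : measurable_fun setT (fun x : 'rV[R]_n => a + x).
Proof.
apply: measurable_fun_rVP => i; under eq_fun do rewrite mxE.
by apply: measurable_funD; [exact: measurable_cst|exact: measurable_coord].
Qed.

(** Induction with Tonelli: the first coordinate is translated by the rule on the line, the others
    by the induction hypothesis. Applied to indicators it gives invariance of the measure, hence the
    case of integrable functions. *)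
Lemma ge0_integral_leb_shift n (a : 'rV[R]_n) (f : 'rV[R]_n -> \bar R) :
  measurable_fun setT f -> (forall x, 0 <= f x)%E ->
  (\int[leb R n]_x f (a + x)%R = \int[leb R n]_x f x)%E.
Proof.
elim: n a f => [|n ih] a f mf f0.
  rewrite !integral_leb0//; first by rewrite (rV0_eq0 (a + 0)).
  by apply: (measurableT_comp mf); exact: measurable_addrV.
have mfa : measurable_fun setT (fun x => f (a + x)).
  by apply: (measurableT_comp mf); exact: measurable_addrV.
have pushE (g : 'rV[R]_n.+1 -> \bar R) : measurable_fun setT g -> (forall x, 0 <= g x)%E ->
    (\int[leb R n.+1]_x g x = \int[mu]_t \int[leb R n]_x g (cons_rV (t, x)))%E.
  move=> mg g0.
  have mgc : measurable_fun setT (g \o @cons_rV R n).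
    by apply: measurableT_comp => //; exact: measurable_cons_rV.
  rewrite -(@fubini_tonelli1 _ _ _ _ R mu (leb R n) (g \o @cons_rV R n)) => [||p]; [|by []|exact: g0].
  by apply: (@ge0_integral_pushforward _ _ _ _ R (@cons_rV R n) (@measurable_cons_rV R n)
    (mu \x leb R n)%E setT g).
rewrite (pushE _ mfa (fun x => f0 _)) (pushE _ mf f0).
set a0 := (uncons_rV a).1; set a' := (uncons_rV a).2.
have aE t x : a + cons_rV (t, x) = cons_rV (a0 + t, a' + x).
  by rewrite -[in LHS](uncons_rVK a) -[X in X + _]scale1r -cons_rV_linear scale1r.
pose G (t : R) := (\int[leb R n]_x f (cons_rV (t, x)))%E.
transitivity (\int[mu]_t G (a0 + t)%R)%E.
  apply: eq_integral => t _; rewrite /G -(ih a' (fun x => f (cons_rV (a0 + t, x))))//.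
    by apply: eq_integral => x _; rewrite aE.
  apply: (measurableT_comp mf); apply: (measurableT_comp (@measurable_cons_rV R n)).
  by apply/measurable_fun_pairP; split; [exact: (measurable_cst (a0 + t))|exact: measurable_id].
rewrite -[RHS]/(\int[mu]_t G t)%E (@ge0_integral_affine R 1 a0 (oner_neq0 _) G).
- rewrite normr1 mul1e; apply: eq_integral => t _.
  by rewrite mul1r addrC.
- apply: (@measurable_fun_fubini_tonelli_F _ _ _ _ R (leb R n) (f \o @cons_rV R n)).
    by apply: measurableT_comp => //; exact: measurable_cons_rV.
  by move=> p; exact: f0.
- by move=> t; rewrite /G; apply: integral_ge0 => x _; exact: f0.
Qed.

Lemma leb_shift n (a : 'rV[R]_n) (A : set 'rV[R]_n) : measurable A ->
  leb R n ((fun x => a + x) @^-1` A) = leb R n A.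
Proof.
move=> mA.
have mA' : measurable ((fun x => a + x) @^-1` A).
  by rewrite -[X in measurable X]setTI; exact: measurable_addrV.
set A' := (fun x => a + x) @^-1` A in mA' *.
have E1 : (\int[leb R n]_x (\1_A' x)%:E = leb R n A')%E.
  by rewrite integral_indic// setIT.
have E2 : (\int[leb R n]_x (\1_A x)%:E = leb R n A)%E by rewrite integral_indic// setIT.
rewrite -E1 -E2 -(@ge0_integral_leb_shift n a (fun x => (\1_A x)%:E))//.
by apply/measurable_EFinP; exact: measurable_indic.
Qed.

Let push n (a : 'rV[R]_n) := measure_function_pushforward__canonical__measure_function_Measure
   (leb R n) (measurable_addrV a).

Let push_leb n (a : 'rV[R]_n) (A : set 'rV[R]_n) : measurable A -> A `<=` setT ->
  leb R n A = push a A.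
Proof. by move=> mA _; rewrite /push/= /pushforward leb_shift. Qed.

Lemma rintegrable_leb_shift n (a : 'rV[R]_n) (f : 'rV[R]_n -> R) :
  rintegrable (leb R n) f -> rintegrable (leb R n) (fun x => f (a + x)).
Proof.
move=> fi; have mf := rintegrable_measurable fi.
apply/integrableP; split.
  by apply/measurable_EFinP; apply: (measurableT_comp mf); exact: measurable_addrV.
have := rintegrable_lty fi.
rewrite -(@ge0_integral_leb_shift n a (fun x => `|f x|%:E))//.
by apply/measurable_EFinP; exact: measurableT_comp.
Qed.

Lemma Rintegral_leb_shift n (a : 'rV[R]_n) (f : 'rV[R]_n -> R) :
  rintegrable (leb R n) f -> \int[leb R n]_x f (a + x) = \int[leb R n]_x f x.
Proof.
move=> fi; rewrite /Rintegral; congr fine; apply/esym.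
rewrite (eq_measure_integral (push a)); last exact: push_leb.
apply: (@integral_pushforward _ _ _ _ R _ (measurable_addrV a) (leb R n) setT (EFin \o f)) => //.
- by apply/measurable_EFinP; exact: rintegrable_measurable fi.
- exact: (rintegrable_leb_shift a fi).
Qed.

Lemma cintegral_leb_shift n (a : 'rV[R]_n) (f : 'rV[R]_n -> R[i]) :
  cintegrable (leb R n) f ->
  cintegral (leb R n) (fun x => f (a + x)) = cintegral (leb R n) f.
Proof.
move=> [f1 f2]; rewrite /cintegral; congr (_ +i* _); exact: Rintegral_leb_shift.
Qed.

End translation.

End leb_integrals.

(** * The Fourier transform on R^n with parameters *)

Section fourier.
Context (R : realType).
Local Notation mu := (@lebesgue_measure R).

Definition FT n (W : Type) (f : 'rV[R]_n * W -> R[i]) (p : 'rV[R]_n * W) : R[i] :=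
  cintegral (leb R n) (fun x => f (x, p.2) * ebar (dot p.1 x)).

Lemma measurable_dot n (u : 'rV[R]_n) : measurable_fun setT (fun x : 'rV[R]_n => dot u x).
Proof.
apply: measurable_sum => i; apply: measurable_funM; first exact: measurable_cst.
exact: measurable_coord.
Qed.

Section induction_step.
Context (n : nat) (W : normedModType R) (f : 'rV[R]_n.+1 * W -> R[i]).
Hypothesis sf : schwartz f.

(** [f1] moves the first coordinate among the parameters, where the induction hypothesis tolerates
    it; [g1] then brings it back to the front, ready for the one-variable transform. *)
Let f1 (p : 'rV[R]_n * (R * W)) := f (cons_rV (p.2.1, p.1), p.2.2).
Let g1 (p : R * ('rV[R]_n * W)) := FT f1 (p.2.1, (p.1, p.2.2)).

Lemma schwartz_cons_split : schwartz f1.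
Proof.
pose A (p : 'rV[R]_n * (R * W)) : 'rV[R]_n.+1 * W := (cons_rV (p.2.1, p.1), p.2.2).
apply: (@schwartz_pullback _ _ _ A A 1) => //.
  by move=> h x v; congr pair; rewrite -cons_rV_linear.
move=> [x [t w]]; rewrite mul1r /A !prod_normE norm_cons_rV prod_normE /=.
by rewrite maxCA maxA.
Qed.

Lemma schwartz_uncons_join (h : R * ('rV[R]_n * W) -> R[i]) : schwartz h ->
  schwartz (fun p : 'rV[R]_n.+1 * W => h ((uncons_rV p.1).1, ((uncons_rV p.1).2, p.2))).
Proof.
pose A (p : 'rV[R]_n.+1 * W) : R * ('rV[R]_n * W) := ((uncons_rV p.1).1, ((uncons_rV p.1).2, p.2)).
move=> sh; apply: (@schwartz_pullback _ _ _ A A 1 _ _ h) => //.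
  move=> s [x w] [v u]; have E := uncons_rV_linear s v x.
  by congr pair; [exact: (congr1 fst E)|congr pair; exact: (congr1 snd E)].
move=> [x w]; rewrite mul1r /A !prod_normE /= -norm_uncons_rV prod_normE /=.
by rewrite maxA.
Qed.

Lemma schwartz_swap_fst (h : 'rV[R]_n * (R * W) -> R[i]) : schwartz h ->
  schwartz (fun p : R * ('rV[R]_n * W) => h (p.2.1, (p.1, p.2.2))).
Proof.
pose A (p : R * ('rV[R]_n * W)) : 'rV[R]_n * (R * W) := (p.2.1, (p.1, p.2.2)).
move=> sh; apply: (@schwartz_pullback _ _ _ A A 1 _ _ h) => //.
by move=> [x [t w]]; rewrite mul1r /A !prod_normE /= maxCA.
Qed.

Let fub_bound (h : 'rV[R]_n.+1 * W -> R[i]) w : schwartz h -> exists2 M, 0 <= M &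
  forall (u : 'rV[R]_n.+1) t x, normc (h (cons_rV (t, x), w) * ebar (dot u (cons_rV (t, x))))
    <= (M * (oneDsqr t)^-1) * weight x.
Proof.
move=> /(schwartz_weight_bound 0)[M M0 hM]; exists M => // u t x.
rewrite normcM normc_ebar mulr1; have := hM (cons_rV (t, x)) w.
by rewrite expr0 mul1r weight_cons mulrA.
Qed.

Let fub_meas (h : 'rV[R]_n.+1 * W -> R[i]) w (u : 'rV[R]_n.+1) : schwartz h ->
  cmeasurable (fun x => h (x, w) * ebar (dot u x)).
Proof.
move=> sh; apply: cmeasurableM; first by apply: schwartz_cmeasurable_rV; exact: schwartz_slice1.
by apply: cmeasurable_ebar; exact: measurable_dot.
Qed.

Let fub_meas_cons (h : 'rV[R]_n.+1 * W -> R[i]) w (u : 'rV[R]_n.+1) : schwartz h ->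
  cmeasurable (fun p => h (cons_rV p, w) * ebar (dot u (cons_rV p))).
Proof.
move=> sh; apply: (cmeasurable_comp (fub_meas w u sh)); exact: measurable_cons_rV.
Qed.

Let cint_cons (h : 'rV[R]_n.+1 * W -> R[i]) w (u : 'rV[R]_n.+1) : schwartz h ->
  cintegral (leb R n.+1) (fun x => h (x, w) * ebar (dot u x)) =
  cintegral mu (fun t => cintegral (leb R n) (fun x =>
     h (cons_rV (t, x), w) * ebar (dot u (cons_rV (t, x))))) /\
  cintegral (leb R n.+1) (fun x => h (x, w) * ebar (dot u x)) =
  cintegral (leb R n) (fun x => cintegral mu (fun t =>
     h (cons_rV (t, x), w) * ebar (dot u (cons_rV (t, x))))).
Proof.
move=> sh; have [M M0 hM] := fub_bound w sh.
have m1 := fub_meas w u sh; have m2 := fub_meas_cons w u sh.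
have iM := rintegrableZ M (rintegrable_oneDsqrV R).
have iw := rintegrable_weight R n.
rewrite cintegral_leb_cons//; last exact: (cfub_prod m2 iM iw (hM u)).
by split; [exact: (cfub1 m2 iM iw (hM u))|exact: (cfub2 m2 iM iw (hM u))].
Qed.

Lemma FT_cons : FT f =
  fun p => FT1 g1 ((uncons_rV p.1).1, ((uncons_rV p.1).2, p.2)).
Proof.
have s1 := schwartz_cons_split.
apply/funext => -[u w]; rewrite /FT/= (cint_cons w u sf).1 /FT1/=.
apply: eq_cintegral => t; rewrite /g1 /FT/= -cintegralZr; last first.
  apply: (cintegrable_le _ (cintegrable_normc (schwartz_cintegrable (schwartz_slice1 s1 (t, w))))).
    apply: cmeasurableM; first by apply: schwartz_cmeasurable_rV; exact: schwartz_slice1.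
    by apply: cmeasurable_ebar; exact: measurable_dot.
  by move=> x; rewrite normcM normc_ebar mulr1.
apply: eq_cintegral => x; rewrite /f1/= -mulrA; congr (_ * _).
by rewrite dot_cons cons_rVK/= /ebar opprD addrC eD.
Qed.

Hypothesis IHs : schwartz (FT f1).
Hypothesis IHi : forall x t w,
  cintegral (leb R n) (fun p => FT f1 (p, (t, w)) * e (dot p x)) = f1 (x, (t, w)).

Let sg1 : schwartz g1. Proof. exact: schwartz_swap_fst. Qed.

Lemma schwartz_FT_step : schwartz (FT f).
Proof.
by rewrite FT_cons; apply: schwartz_uncons_join; exact: schwartz_FT1.
Qed.

Lemma FT_inversion_step x w :
  cintegral (leb R n.+1) (fun p => FT f (p, w) * e (dot p x)) = f (x, w).
Proof.
(* The inverse transform at [x] is a forward integral at [- x], so that the splitting [cint_cons]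
   serves both directions. *)
have dotN (u v : 'rV[R]_n.+1) : e (dot u v) = ebar (dot (- v) u).
  rewrite /ebar; congr e; rewrite /dot -sumrN; apply: eq_bigr => i _.
  by rewrite mxE mulNr opprK mulrC.
under eq_fun do rewrite dotN.
(* Here the first coordinate is integrated innermost: one-variable inversion returns [g1], and the
   induction hypothesis handles the remaining coordinates. *)
rewrite (cint_cons w (- x) schwartz_FT_step).2.
transitivity (cintegral (leb R n) (fun p => g1 ((uncons_rV x).1, (p, w)) * e (dot p (uncons_rV x).2))).
  apply: eq_cintegral => p; rewrite -(@FT1_inversion _ _ g1)//.
  have sFT1 := schwartz_FT1 sg1.
  rewrite -cintegralZr; last first.
    apply: cintegrableMe; last exact: measurable_funM.
    exact: (schwartz_line_cintegrable _ sFT1).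
  apply: eq_cintegral => xi; rewrite FT_cons -mulrA; congr (_ * _).
    by rewrite -[LHS]/(FT1 g1 ((uncons_rV (cons_rV (xi, p))).1, ((uncons_rV (cons_rV (xi, p))).2, w)))
       cons_rVK.
  by rewrite -dotN dot_cons cons_rVK/= eD.
rewrite /g1/= IHi /f1/=; congr (f (_, _)).
by rewrite -[RHS]uncons_rVK; congr cons_rV; case: (uncons_rV x).
Qed.

End induction_step.

Lemma schwartz_FT_inversion n : forall (W : normedModType R) (f : 'rV[R]_n * W -> R[i]),
  schwartz f -> schwartz (FT f) /\
  forall x w, cintegral (leb R n) (fun p => FT f (p, w) * e (dot p x)) = f (x, w).
Proof.
elim: n => [|n ih] W f sf.
  have E : FT f = f.
    apply/funext => -[p w]; rewrite /FT cintegral_leb0/= (rV0_eq0 p) /dot big_ord0 /ebar oppr0.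
    by rewrite e0 mulr1.
  rewrite E; split => // x w; rewrite cintegral_leb0 (rV0_eq0 x) /dot big_ord0.
  by rewrite e0 mulr1.
have [h1 h2] := ih _ _ (schwartz_cons_split sf).
by split; [exact: schwartz_FT_step|move=> x w; apply: FT_inversion_step => // ? ? ?; exact: h2].
Qed.

Lemma schwartz_FT n (W : normedModType R) (f : 'rV[R]_n * W -> R[i]) :
  schwartz f -> schwartz (FT f).
Proof. by move=> /schwartz_FT_inversion[]. Qed.

Lemma FT_inversion n (W : normedModType R) (f : 'rV[R]_n * W -> R[i]) x w : schwartz f ->
  cintegral (leb R n) (fun p => FT f (p, w) * e (dot p x)) = f (x, w).
Proof. by move=> /schwartz_FT_inversion[_]. Qed.

End fourier.

Section inverse_fourier.
Context (R : realType).

Lemma dotC n (u v : 'rV[R]_n) : dot u v = dot v u.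
Proof. by rewrite /dot; apply: eq_bigr => i _; rewrite mulrC. Qed.

(** The inverse transform, obtained from [FT] by conjugation so that it inherits the preservation of
    Schwartz functions; [IFTE] gives its usual integral. *)
Definition IFT n (W : Type) (f : 'rV[R]_n * W -> R[i]) (p : 'rV[R]_n * W) : R[i] :=
  conjc (FT (fun q => conjc (f q)) p).

Context (n : nat) (W : normedModType R).
Implicit Types f : 'rV[R]_n * W -> R[i].

Lemma conjcK' (z : R[i]) : conjc (conjc z) = z.
Proof. by case: z => a b; apply: complexP => //=; rewrite opprK. Qed.

Lemma conjcM (z w : R[i]) : conjc (z * w) = conjc z * conjc w.
Proof. by apply: complexP; rewrite ?(ReM, ImM, Reconj, Imconj); ring. Qed.

Lemma cintegrable_FT f x w : schwartz f ->
  cintegrable (leb R n) (fun p => f (p, w) * ebar (dot x p)).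
Proof.
move=> sf; apply: cintegrableMe.
  exact: (schwartz_cintegrable (schwartz_slice1 sf w)).
by apply: measurableT_comp => //; exact: measurable_dot.
Qed.

Lemma IFTE f x w : schwartz f ->
  IFT f (x, w) = cintegral (leb R n) (fun p => f (p, w) * e (dot x p)).
Proof.
move=> sf; rewrite /IFT /FT -cintegral_conj/=; last first.
  exact: (cintegrable_FT _ _ (schwartz_conj sf)).
by apply: eq_cintegral => p; rewrite conjcM conjcK' conj_e opprK.
Qed.

Lemma schwartz_IFT f : schwartz f -> schwartz (IFT f).
Proof. by move=> sf; apply: schwartz_conj; apply: schwartz_FT; exact: schwartz_conj. Qed.

Lemma FTK f : schwartz f -> IFT (FT f) = f.
Proof.
move=> sf; apply/funext => -[x w]; rewrite IFTE; last exact: schwartz_FT.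
by rewrite -[RHS]FT_inversion//; apply: eq_cintegral => p; rewrite dotC.
Qed.

(** Conjugating [FTK] for the conjugate function exchanges the two transforms. *)
Lemma IFTK f : schwartz f -> FT (IFT f) = f.
Proof.
move=> sf; have sf' := schwartz_conj sf; apply/funext => -[p w].
have := congr1 (fun h => conjc (h (p, w))) (FTK sf'); rewrite conjcK' => <-.
rewrite {2}/IFT conjcK' /FT; apply: eq_cintegral => x; congr (_ * _).
Qed.

End inverse_fourier.

(* FT does not see null sets, and inversion recovers every value. *)
Lemma schwartz_ae_eq0 (R : realType) n (f : 'rV[R]_n -> R[i]) : schwartz f ->
  {ae leb R n, forall x, f x = 0} -> f = fun=> 0.
Proof.
move=> sf f0.
have s2 := schwartz_fst_rV0 sf.
have F0 : FT (fun p : 'rV[R]_n * 'rV[R]_0 => f p.1) = fun=> 0.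
  apply/funext => -[p w]; rewrite /FT/=.
  rewrite -[RHS](cintegral0 (leb R n)); apply: cintegral_ae.
  - apply: cmeasurableM; first exact: schwartz_cmeasurable_rV.
    by apply: cmeasurable_ebar; exact: measurable_dot.
  - exact: cmeasurable_cst.
  - by apply: filterS f0 => x ->; rewrite mul0r.
apply/funext => x; rewrite -(FT_inversion x 0 s2) F0.
by under eq_fun do rewrite mul0r; exact: cintegral0.
Qed.

(** * Operators with dominated kernels on L^2 *)

Section L2_classes.
Context d (T : measurableType d) (R : realType) (mu : {measure set T -> \bar R}).
Implicit Types (f g : T -> R[i]) (xi zeta : L2 mu).
Local Open Scope quotient_scope.

Lemma is_L2P f : reflect (is_L2 mu f) (f \in L2_pred mu).
Proof. exact: asboolP. Qed.

Lemma is_L2_cmeasurable f : is_L2 mu f -> cmeasurable f.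
Proof. by case. Qed.

Lemma is_L2_rintegrable f : is_L2 mu f -> rintegrable mu (fun x => sqnormc (f x)).
Proof.
move=> [f1 f2 foo]; apply: ge0_rintegrable => //; first exact: measurable_sqnormc.
by move=> x; exact: sqnormc_ge0.
Qed.

Lemma is_L2_le f (g : T -> R) : cmeasurable f -> rintegrable mu g ->
  (forall x, sqnormc (f x) <= g x) -> is_L2 mu f.
Proof.
move=> [f1 f2] ig fg; split => //.
have /rintegrable_lty : rintegrable mu (fun x => sqnormc (f x)).
  apply: (rintegrable_le _ ig); first exact: measurable_sqnormc.
  by move=> x; rewrite ger0_norm ?sqnormc_ge0.
by under eq_integral do rewrite ger0_norm ?sqnormc_ge0//.
Qed.

Lemma is_L2_L2rep xi : is_L2 mu (L2rep xi).
Proof. by rewrite /L2rep; case: (repr xi) => f /= /is_L2P. Qed.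

Lemma L2fun_val_insubd f : is_L2 mu f -> L2fun_val (insubd (0 : L2fun mu) f) = f.
Proof. by move=> /is_L2P fL; rewrite -[LHS]/(val _) insubdK. Qed.

Lemma pi_L2_eq (F G : L2fun mu) :
  ((\pi_(L2 mu) F) = (\pi_(L2 mu) G)) <-> {ae mu, forall x, L2fun_val F x = L2fun_val G x}.
Proof.
split.
  move=> /eqP; rewrite -Quotient.idealrBE => /asboolP; apply: filterS => x h.
  by apply/eqP; rewrite -subr_eq0; apply/eqP.
move=> h; apply/eqP; rewrite -Quotient.idealrBE; apply/asboolP; apply: filterS h => x h.
by apply/eqP; rewrite -[X in X == 0]/(L2fun_val F x - L2fun_val G x) h subrr.
Qed.

Lemma toL2_eqP f g : is_L2 mu f -> is_L2 mu g ->
  toL2 mu f = toL2 mu g <-> {ae mu, forall x, f x = g x}.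
Proof. by move=> fL gL; rewrite /toL2 pi_L2_eq !L2fun_val_insubd. Qed.

Lemma toL2_L2rep xi : toL2 mu (L2rep xi) = xi.
Proof.
rewrite /toL2 -[RHS]reprK; apply/pi_L2_eq; apply: aeW => x.
by rewrite L2fun_val_insubd//; exact: is_L2_L2rep.
Qed.

Lemma L2rep_toL2 f : is_L2 mu f -> {ae mu, forall x, L2rep (toL2 mu f) x = f x}.
Proof.
move=> fL; apply/toL2_eqP => //; first exact: is_L2_L2rep.
exact: toL2_L2rep.
Qed.

Lemma is_L2_lin a f g : is_L2 mu f -> is_L2 mu g -> is_L2 mu (fun x => a * f x + g x).
Proof.
move=> /is_L2P fL /is_L2P gL; apply/is_L2P.
have [_] := L2_submod_closed mu; exact.
Qed.

Lemma toL2_lin a f g : is_L2 mu f -> is_L2 mu g ->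
  toL2 mu (fun x => a * f x + g x) = a *: toL2 mu f + toL2 mu g.
Proof.
move=> fL gL.
rewrite /toL2 -[_ *: _]/(L2scale a _) (pi_L2scale a) -pi_L2D; apply/pi_L2_eq; apply: aeW => x.
rewrite L2fun_val_insubd; last exact: is_L2_lin.
by rewrite -[RHS]/(a * L2fun_val _ x + L2fun_val _ x) !L2fun_val_insubd.
Qed.

Lemma mulr_le_sqr (a b : R) : a * b <= a ^+ 2 + b ^+ 2.
Proof. have := sqr_ge0 (a - b); have := sqr_ge0 (a + b); have := sqr_ge0 a; have := sqr_ge0 b; nra. Qed.

Lemma cintegrable_L2M f g : is_L2 mu f -> is_L2 mu g ->
  cintegrable mu (fun x => f x * conjc (g x)).
Proof.
move=> fL gL.
apply: (cintegrable_le _ (rintegrableD (is_L2_rintegrable fL) (is_L2_rintegrable gL))).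
  apply: cmeasurableM; first exact: is_L2_cmeasurable.
  by apply: cmeasurable_conj; exact: is_L2_cmeasurable.
by move=> x; rewrite normcM normc_conj -!sqr_normcE mulr_le_sqr.
Qed.

Lemma L2inner_toL2 f g : is_L2 mu f -> is_L2 mu g ->
  L2inner (toL2 mu f) (toL2 mu g) = cintegral mu (fun x => f x * conjc (g x)).
Proof.
move=> fL gL; rewrite /L2inner; apply: cintegral_ae.
- apply: cmeasurableM; first exact/is_L2_cmeasurable/is_L2_L2rep.
  by apply: cmeasurable_conj; exact/is_L2_cmeasurable/is_L2_L2rep.
- apply: cmeasurableM; first exact: is_L2_cmeasurable.
  by apply: cmeasurable_conj; exact: is_L2_cmeasurable.
- by apply: filterS2 (L2rep_toL2 fL) (L2rep_toL2 gL) => x -> ->.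
Qed.

Lemma Re_mul_conjc (z : R[i]) : Re (z * conjc z) = sqnormc z.
Proof. by rewrite ReM Reconj Imconj mulrN opprK /sqnormc !expr2. Qed.

Lemma L2inner_self f : is_L2 mu f ->
  Re (L2inner (toL2 mu f) (toL2 mu f)) = \int[mu]_x sqnormc (f x).
Proof.
by move=> fL; rewrite L2inner_toL2//; apply: eq_Rintegral => x _; exact: Re_mul_conjc.
Qed.

Lemma sqnormc_eq0 (z : R[i]) : sqnormc z = 0 -> z = 0.
Proof.
rewrite /sqnormc => /eqP; rewrite paddr_eq0 ?sqr_ge0// !sqrf_eq0 => /andP[/eqP h1 /eqP h2].
exact: complexP.
Qed.

Lemma sqnormc_ae_eq0 f : is_L2 mu f -> \int[mu]_x sqnormc (f x) = 0 ->
  {ae mu, forall x, f x = 0}.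
Proof.
move=> fL; have iL := is_L2_rintegrable fL.
move=> h0; have h : (\int[mu]_x (sqnormc (f x))%:E = 0)%E by rewrite -EFin_Rintegral// h0.
have I0 : (\int[mu]_x `|(sqnormc (f x))%:E| = 0)%E.
  by rewrite -h; apply: eq_integral => x _; rewrite gee0_abs// lee_fin sqnormc_ge0.
have mE : measurable_fun setT (fun x => (sqnormc (f x))%:E) := measurable_int _ iL.
have := (ae_eq_integral_abs mu measurableT mE).1 I0; apply: filterS => x /(_ I) E.
by apply: sqnormc_eq0; exact: EFin_inj E.
Qed.

(** Makes adjoints unique, and with them the involution. The test vector is the difference of the
    two representatives. *)
Lemma L2inner_nondegenerate (xi zeta : L2 mu) :
  (forall chi, L2inner chi xi = L2inner chi zeta) -> xi = zeta.
Proof.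
move=> h; rewrite -(toL2_L2rep xi) -(toL2_L2rep zeta).
set f := L2rep xi; set g := L2rep zeta.
have fL : is_L2 mu f := is_L2_L2rep xi; have gL : is_L2 mu g := is_L2_L2rep zeta.
apply/(toL2_eqP fL gL).
pose k x := (-1) * g x + f x.
have kL : is_L2 mu k by exact: is_L2_lin.
have : {ae mu, forall x, k x = 0}.
  apply: sqnormc_ae_eq0 => //.
  have := h (toL2 mu k); rewrite -(toL2_L2rep xi) -(toL2_L2rep zeta) !L2inner_toL2// => E.
  have E2 : cintegral mu (fun x => k x * conjc (k x)) = 0.
    transitivity (cintegral mu (fun x => (-1) * (k x * conjc (g x)) + k x * conjc (f x))).
      apply: eq_cintegral => x; apply: complexP;
      by rewrite ?(ReM, ImM, ReD, ImD, Reconj, Imconj) /=; ring.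
    rewrite cintegralD; [|apply: cintegrableZ; exact: cintegrable_L2M|exact: cintegrable_L2M].
    by rewrite cintegralZl ?E ?mulN1r ?addNr//; exact: cintegrable_L2M.
  have := congr1 (@complex.Re R) E2; rewrite /= => <-.
  by apply: eq_Rintegral => x _; rewrite Re_mul_conjc.
apply: filterS => x; rewrite /k mulN1r addrC => /eqP; rewrite subr_eq0 => /eqP.
exact.
Qed.

Definition L2norm xi : R := Num.sqrt (Re (L2inner xi xi)).

Lemma L2norm_toL2 f : is_L2 mu f -> L2norm (toL2 mu f) ^+ 2 = \int[mu]_x sqnormc (f x).
Proof.
move=> fL; rewrite /L2norm L2inner_self// sqr_sqrtr//.
by apply: Rintegral_ge0 => x _; exact: sqnormc_ge0.
Qed.

Lemma L2norm_ge0 xi : 0 <= L2norm xi. Proof. exact: sqrtr_ge0. Qed.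

End L2_classes.

(** * Operators with kernels dominated by a product weight *)

Section kernel_operators.
Context d (T : measurableType d) (R : realType).
Variables (mu : {sigma_finite_measure set T -> \bar R}) (om : T -> R).
Hypotheses (om_ge0 : forall x, 0 <= om x) (om_le1 : forall x, om x <= 1).
Hypothesis iom : rintegrable mu om.
Implicit Types (f g : T -> R[i]) (k l : T * T -> R[i]) (xi zeta : L2 mu).

(** Since [om] is bounded and integrable it is also square integrable, so these kernels are
    Hilbert-Schmidt. The pointwise bound gives more: [kfun k f u] converges absolutely at every [u],
    and all estimates reduce to the integral of [om |f|]. *)
Definition dominated_kernel k :=
  cmeasurable k /\ exists2 C, 0 <= C & forall u v, normc (k (u, v)) <= C * (om u * om v).

Definition kfun k f u : R[i] := cintegral mu (fun v => k (u, v) * f v).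

Definition kop k xi : L2 mu := toL2 mu (kfun k (L2rep xi)).

Lemma rintegrable_om_normc f : is_L2 mu f -> rintegrable mu (fun x => om x * normc (f x)).
Proof.
move=> fL; apply: (rintegrable_le _ (rintegrableD iom (is_L2_rintegrable fL))).
  apply: measurable_funM; first exact: rintegrable_measurable iom.
  by apply: measurable_normc; exact: is_L2_cmeasurable fL.
move=> x; rewrite ger0_norm ?mulr_ge0 ?normc_ge0//.
apply: (le_trans (mulr_le_sqr _ _)); rewrite sqr_normcE lerD2r expr2.
by rewrite ler_piMr.
Qed.

Let om_int_ge0 : 0 <= \int[mu]_x om x. Proof. exact: Rintegral_ge0. Qed.

(* Cauchy-Schwarz with a worse constant: AM-GM om |f| <= (s om^2 + |f|^2 / s) / 2
   with s the norm of f. *)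
Lemma Rintegral_om_normc_le f : is_L2 mu f ->
  \int[mu]_x (om x * normc (f x)) <= (1 + \int[mu]_x om x) * L2norm (toL2 mu f).
Proof.
move=> fL; set W := \int[mu]_x om x; set N := L2norm _; set J := \int[mu]_x _.
have W0 : 0 <= W := om_int_ge0.
have iL := is_L2_rintegrable fL; have iJ := rintegrable_om_normc fL.
have key s : 0 < s -> 2 * J <= s * W + s^-1 * N ^+ 2.
  move=> s0; rewrite L2norm_toL2// -!RintegralZl// -RintegralD//; [|exact: rintegrableZ..].
  apply: le_Rintegral => //.
  - exact: rintegrableZ.
  - by apply: rintegrableD; exact: rintegrableZ.
  move=> x _; rewrite -sqr_normcE; set a := normc _; have a0 : 0 <= a := normc_ge0 _.
  have h1 : 2 * (om x * a) <= s * om x ^+ 2 + s^-1 * a ^+ 2.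
    have : 0 <= s^-1 * (s * om x - a) ^+ 2 by rewrite mulr_ge0 ?invr_ge0 ?sqr_ge0// ltW.
    rewrite (_ : s^-1 * _ = s * om x ^+ 2 + s^-1 * a ^+ 2 - 2 * (om x * a)); last first.
      by field; rewrite gt_eqF.
    by rewrite subr_ge0.
  apply: (le_trans h1); rewrite lerD2r ler_wpM2l ?(ltW s0)//.
  by rewrite expr2 ler_piMr.
have N0 : 0 <= N := L2norm_ge0 _.
have J0 : 0 <= J by apply: Rintegral_ge0 => x _; rewrite mulr_ge0 ?normc_ge0.
move: N0; rewrite le_eqVlt => /predU1P[N0|N0].
  rewrite -N0 mulr0 leNgt; apply/negP => Jp.
  have W1 : 0 < W + 1 by rewrite ltr_wpDl.
  (* When the norm is 0 every s > 0 is admissible; this choice yields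
     [2 * J <= J * W / (W + 1) <= J], against J > 0. *)
  have := key (J / (W + 1)) (divr_gt0 Jp W1); rewrite -N0 expr0n mulr0 addr0 => h1.
  have h2 : J / (W + 1) * W <= J by rewrite mulrAC ler_pdivrMr// ler_wpM2l// lerDl.
  by have := le_trans h1 h2; rewrite mulr_natl mulr2n -lerBrDl subrr leNgt Jp.
have := key N N0; rewrite expr2 mulKf ?gt_eqF// => h.
have h2 : J <= 2 * J by rewrite mulr_natl mulr2n lerDl.
by apply: (le_trans h2); apply: (le_trans h); rewrite mulrDl mul1r addrC lerD2l mulrC.
Qed.

Section one_kernel.
Variables (k : T * T -> R[i]) (f : T -> R[i]).
Hypotheses (hk : dominated_kernel k) (fL : is_L2 mu f).

Let mkf : cmeasurable (fun p : T * T => k p * f p.2).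
Proof.
apply: cmeasurableM; first by case: hk.
by apply: (cmeasurable_comp (is_L2_cmeasurable fL)); exact: measurable_snd.
Qed.

Let kf_bound : exists2 C, 0 <= C & forall u v, normc (k (u, v) * f v) <= (C * om u) * (om v * normc (f v)).
Proof.
case: hk => _ [C C0 kC]; exists C => // u v.
by rewrite normcM (mulrA (C * om u)) ler_wpM2r ?normc_ge0// -mulrA.
Qed.

Lemma kfun_integrable u : cintegrable mu (fun v => k (u, v) * f v).
Proof.
have [C C0 h] := kf_bound.
exact: (cfub_section1 mkf (rintegrable_om_normc fL) h).
Qed.

Lemma kfun_cmeasurable : cmeasurable (kfun k f).
Proof.
have [C C0 h] := kf_bound.
apply: (@cintegrable_measurable _ _ _ mu).
exact: (cfub_int1 mkf (rintegrableZ C iom) (rintegrable_om_normc fL) h).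
Qed.

End one_kernel.

Lemma kfun_bound k : dominated_kernel k -> exists2 C, 0 <= C &
  forall f, is_L2 mu f ->
  forall u, normc (kfun k f u) <= C * \int[mu]_x (om x * normc (f x)) * om u.
Proof.
move=> hk; case: (hk) => mk [C C0 kC]; exists (2 * C); first by rewrite mulr_ge0.
move=> f fL u; have iJ := rintegrable_om_normc fL.
have h v : normc (k (u, v) * f v) <= (C * om u) * (om v * normc (f v)).
  by rewrite normcM (mulrA (C * om u)) ler_wpM2r ?normc_ge0// -mulrA.
apply: (le_trans (normc_cintegral_le _ (rintegrableZ (C * om u) iJ) h)).
  exact: cintegrable_measurable (kfun_integrable hk fL u).
by rewrite RintegralZl//; rewrite le_eqVlt; apply/orP; left; apply/eqP; ring.
Qed.

Lemma kfun_is_L2 k f : dominated_kernel k -> is_L2 mu f -> is_L2 mu (kfun k f).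
Proof.
move=> hk fL; have [C C0 /(_ f fL) h] := kfun_bound hk; pose J := C * \int[mu]_x (om x * normc (f x)).
have J0 : 0 <= J.
  by rewrite mulr_ge0//; apply: Rintegral_ge0 => x _; rewrite mulr_ge0 ?normc_ge0.
apply: (is_L2_le (kfun_cmeasurable hk fL) (rintegrableZ (J ^+ 2) iom)) => u.
rewrite -sqr_normcE; apply: (@le_trans _ _ ((J * om u) ^+ 2)).
  by apply: lerXn2r; rewrite ?nnegrE; [exact: normc_ge0|exact: mulr_ge0|exact: h].
by rewrite exprMn ler_wpM2l ?sqr_ge0// expr2 ler_piMr.
Qed.

(** [kop] is written with the chosen representative of a class; integrating against the kernel does
    not see a change on a null set, so any representative computes it. *)
Lemma kop_toL2 k f : dominated_kernel k -> is_L2 mu f -> kop k (toL2 mu f) = toL2 mu (kfun k f).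
Proof.
move=> hk fL; have rL := is_L2_L2rep (toL2 mu f).
apply/toL2_eqP; [exact: kfun_is_L2|exact: kfun_is_L2|apply: aeW => u].
apply: cintegral_ae.
- exact: cintegrable_measurable (kfun_integrable hk rL u).
- exact: cintegrable_measurable (kfun_integrable hk fL u).
- by apply: filterS (L2rep_toL2 fL) => v ->.
Qed.

Lemma kop_linear k : dominated_kernel k -> linear (kop k).
Proof.
move=> hk a xi zeta; rewrite -(toL2_L2rep xi) -(toL2_L2rep zeta).
have fL := is_L2_L2rep xi; have gL := is_L2_L2rep zeta.
rewrite -toL2_lin// !kop_toL2//; last exact: is_L2_lin.
rewrite -toL2_lin; [|exact: kfun_is_L2..].
congr toL2; apply/funext => u; rewrite /kfun.
have i1 := kfun_integrable hk fL u; have i2 := kfun_integrable hk gL u.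
rewrite -cintegralZl// -cintegralD//; last exact: cintegrableZ.
by apply: eq_cintegral => v; rewrite mulrDr mulrCA.
Qed.

Lemma kop_bounded k : dominated_kernel k ->
  exists M, forall xi, L2norm (kop k xi) <= M * L2norm xi.
Proof.
move=> hk; set W := \int[mu]_x om x.
have [C C0 kC] := kfun_bound hk.
(* One factor [1 + W] comes from [Rintegral_om_normc_le]. The other dominates the norm of [om],
   whose square is at most [W <= (1 + W)^2]. *)
exists (C * (1 + W) * (1 + W)) => xi; rewrite -(toL2_L2rep xi).
set f := L2rep xi; have fL : is_L2 mu f := is_L2_L2rep xi.
have W0 : 0 <= W := om_int_ge0.
have N0 := L2norm_ge0 (toL2 mu f).
have sq (a b : R) : 0 <= a -> 0 <= b -> a ^+ 2 <= b ^+ 2 -> a <= b.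
  by move=> a0 b0; rewrite ler_pXn2r.
have kL := kfun_is_L2 hk fL.
rewrite (kop_toL2 hk fL); apply: sq.
- exact: L2norm_ge0.
- by apply: mulr_ge0 => //; rewrite !mulr_ge0// addr_ge0.
rewrite (L2norm_toL2 kL).
set N := L2norm (toL2 mu f) in N0 *.
pose J := C * ((1 + W) * N).
have J0 : 0 <= J by rewrite !mulr_ge0// addr_ge0.
apply: (@le_trans _ _ (\int[mu]_x (J ^+ 2 * om x))).
  apply: le_Rintegral => //; [exact: is_L2_rintegrable|exact: rintegrableZ|].
  move=> u _; rewrite -sqr_normcE; apply: (@le_trans _ _ ((J * om u) ^+ 2)).
    apply: lerXn2r; rewrite ?nnegrE; [exact: normc_ge0|exact: mulr_ge0|].
    apply: (le_trans (kC f fL u)); rewrite ler_wpM2r// ler_wpM2l//.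
    exact: Rintegral_om_normc_le.
  by rewrite exprMn ler_wpM2l ?sqr_ge0// expr2 ler_piMr.
rewrite RintegralZl// -/W (_ : C * (1 + W) * (1 + W) * N = J * (1 + W)); last by rewrite /J; ring.
rewrite [leRHS]exprMn ler_wpM2l ?sqr_ge0// sqrrD expr1n mul1r; have := sqr_ge0 W; lra.
Qed.

Lemma kop_comp k l m : dominated_kernel k -> dominated_kernel l -> dominated_kernel m ->
  (forall u v, m (u, v) = cintegral mu (fun t => k (u, t) * l (t, v))) ->
  forall xi, kop k (kop l xi) = kop m xi.
Proof.
move=> hk hl hm mE xi; have lL := kfun_is_L2 hl (is_L2_L2rep xi).
apply: (etrans (kop_toL2 hk lL)).
rewrite /kop; congr toL2; apply/funext => u; rewrite /kfun.
set f := L2rep xi; have fL : is_L2 mu f := is_L2_L2rep xi.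
have [mk [C C0 kC]] := hk; have [ml [D D0 lD]] := hl.
have iJ := rintegrable_om_normc fL.
pose h (p : T * T) := k (u, p.1) * (l p * f p.2).
have mku : cmeasurable (fun t => k (u, t)).
  apply: (cmeasurable_comp mk); apply/measurable_fun_pairP.
  by split; [exact: (measurable_cst u)|exact: measurable_id].
have mh : cmeasurable h.
  apply: cmeasurableM; first exact: (cmeasurable_comp mku measurable_fst).
  apply: cmeasurableM => //.
  exact: (cmeasurable_comp (is_L2_cmeasurable fL) measurable_snd).
have hb t v : normc (h (t, v)) <= (C * D * om u * om t) * (om v * normc (f v)).
  rewrite /h !normcM /= (mulrA (C * D * om u * om t)) mulrA ler_wpM2r ?normc_ge0//.
  apply: (@le_trans _ _ ((C * (om u * om t)) * (D * (om t * om v)))).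
    by rewrite ler_pM ?normc_ge0.
  (* The middle variable carries [om] twice: one factor makes the integral over [t] converge, the
     other is bounded by 1. *)
  rewrite (_ : _ * (D * _) = om t * (C * D * om u * om t * om v)); last by ring.
  by rewrite ler_piMl ?mulr_ge0.
have i1 : rintegrable mu (fun t => C * D * om u * om t) by exact: rintegrableZ.
transitivity (cintegral mu (fun t => cintegral mu (fun v => h (t, v)))).
  apply: eq_cintegral => t; rewrite -cintegralZl//; exact: kfun_integrable.
rewrite (cfubC mh i1 iJ hb); apply: eq_cintegral => v.
rewrite mE -cintegralZr; first by apply: eq_cintegral => t; rewrite /h/= mulrA.
apply: (cintegrable_le _ (rintegrableZ (C * D * om u * om v) iom)).
  apply: cmeasurableM => //; apply: (cmeasurable_comp ml); apply/measurable_fun_pairP.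
  by split; [exact: measurable_id|exact: (measurable_cst v)].
move=> t; rewrite normcM; apply: (@le_trans _ _ ((C * (om u * om t)) * (D * (om t * om v)))).
  by rewrite ler_pM ?normc_ge0.
rewrite (_ : _ * (D * _) = om t * (C * D * om u * om v * om t)); last by ring.
by rewrite ler_piMl ?mulr_ge0.
Qed.

Lemma kop_adjoint k l : dominated_kernel k -> dominated_kernel l ->
  (forall u v, l (u, v) = conjc (k (v, u))) ->
  forall xi zeta, L2inner (kop k xi) zeta = L2inner xi (kop l zeta).
Proof.
move=> hk hl lE xi zeta; rewrite -{1}(toL2_L2rep zeta) -{2}(toL2_L2rep xi).
set f := L2rep xi; have fL : is_L2 mu f := is_L2_L2rep xi.
set g := L2rep zeta; have gL : is_L2 mu g := is_L2_L2rep zeta.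
rewrite /kop -/f -/g !L2inner_toL2//; [|exact: kfun_is_L2..].
have [mk [C C0 kC]] := hk.
pose h (p : T * T) := k p * f p.2 * conjc (g p.1).
have mh : cmeasurable h.
  apply: cmeasurableM; first apply: cmeasurableM => //.
    exact: (cmeasurable_comp (is_L2_cmeasurable fL) measurable_snd).
  apply: cmeasurable_conj; exact: (cmeasurable_comp (is_L2_cmeasurable gL) measurable_fst).
have hb u v : normc (h (u, v)) <= (C * (om u * normc (g u))) * (om v * normc (f v)).
  rewrite /h !normcM normc_conj/=.
  rewrite (_ : C * _ * _ = C * (om u * om v) * normc (f v) * normc (g u)); last by ring.
  by rewrite !ler_wpM2r ?normc_ge0.
have iJ := rintegrable_om_normc fL; have iK := rintegrable_om_normc gL.
transitivity (cintegral mu (fun u => cintegral mu (fun v => h (u, v)))).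
  by apply: eq_cintegral => u; rewrite -cintegralZr//; exact: kfun_integrable.
rewrite (cfubC mh (rintegrableZ C iK) iJ hb); apply: eq_cintegral => v.
rewrite /kfun -cintegral_conj; last exact: kfun_integrable.
rewrite -cintegralZl; last by apply: cintegrable_conj; exact: kfun_integrable.
apply: eq_cintegral => u; rewrite /h/= lE; apply: complexP;
by rewrite ?(ReM, ImM, Reconj, Imconj); ring.
Qed.

End kernel_operators.

(** * Bump functions *)

Section bump.
Context (R : realType).

(* The derivatives of expR (- x^-1), extended by 0 to x <= 0, are combinations of these. *)
Definition flat (k : nat) (x : R) : R :=
  if 0 < x then x^-1 ^+ k * expR (- x^-1) else 0.

Lemma exprn_expRN_le (k : nat) (y : R) : 0 <= y -> y ^+ k * expR (- y) <= k`!%:R.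
Proof.
move=> y0; rewrite expRN ler_pdivrMr ?expR_gt0//.
case: k => [|k]; first by rewrite expr0 mul1r -expR0 ler_expR.
have := expR_ge1Dxn k y0; rewrite -ler_pdivrMl ?ltr0n ?fact_gt0//; apply: le_trans.
by rewrite mulrC lerDr.
Qed.

Lemma flat_ge0 k x : 0 <= flat k x.
Proof.
rewrite /flat; case: ifPn => // x0.
by rewrite mulr_ge0 ?expR_ge0// exprn_ge0// invr_ge0 ltW.
Qed.

Lemma flat_le k x : flat k x <= k`!%:R.
Proof. by rewrite /flat; case: ifPn => // x0; rewrite exprn_expRN_le// invr_ge0 ltW. Qed.

Lemma flat_norm k x : `|flat k x| <= k`!%:R.
Proof. by rewrite ger0_norm ?flat_ge0// flat_le. Qed.

(** For x > 0 one has [flat k x = x * flat k.+1 x], and [flat k.+1] is bounded; the function thus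
    vanishes at 0 at least linearly. *)
Lemma flatS_le k x : flat k x <= `|x| * k.+1`!%:R.
Proof.
rewrite {1}/flat; case: ifPn => [x0|_]; last by rewrite mulr_ge0.
have := flat_le k.+1 x; rewrite /flat x0 exprS => h.
by rewrite gtr0_norm// -ler_pdivrMl// mulrA.
Qed.

Lemma is_derive_expn (k : nat) (y : R) : is_derive y (1:R) (fun y : R => y ^+ k) (k%:R * y ^+ k.-1).
Proof.
elim: k => [|k ih].
  by rewrite mul0r; under [X in is_derive _ _ X _]eq_fun do rewrite expr0; exact: is_derive_cst.
under [X in is_derive _ _ X _]eq_fun do rewrite exprS.
apply: (@is_derive_eq _ _ _ _ _ _ _ _ (is_deriveM (is_derive_id y (1:R)) ih)).
rewrite -![_ *: _]/(_ * _) /= -natr1; case: k {ih} => [|k]; first by rewrite /= !expr0; ring.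
by rewrite /= exprS; ring.
Qed.

Lemma is_derive_flat k x :
  is_derive x (1:R) (flat k) (- k%:R * flat k.+1 x + flat k.+2 x).
Proof.
have [x0|x0|->] := ltgtP x 0.
- apply: (@near_eq_is_derive _ _ _ (cst 0)).
    near=> y; rewrite /flat ifF//; apply/negbTE; rewrite -leNgt ltW//.
    by near: y; exact: lt_nbhsl.
  rewrite (_ : _ + _ = 0); first exact: is_derive_cst.
  have xF : (0 < x) = false by apply/negbTE; rewrite -leNgt ltW.
  by rewrite /flat xF mulr0 addr0.
- pose F (y : R) := y ^+ k * expR (- y).
  apply: (@near_eq_is_derive _ _ _ (F \o GRing.inv)).
    near=> y; rewrite /flat ifT//.
    by near: y; exact: lt_nbhsr.
  have dinv : is_derive x (1:R) (fun x : R => x^-1) (- x ^- 2).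
    apply: is_derive_eq; first by apply: (is_deriveV (f := id)); rewrite gt_eqF.
    by rewrite -[_ *: _]/(_ * _) mulr1.
  have dN (y : R) : is_derive y (1:R) (fun y : R => - y) (-1).
    by have := is_derive_affine (-1) 0 y; under [X in is_derive _ _ X _]eq_fun do rewrite mulN1r addr0.
  have dexp (y : R) : is_derive y (1:R) (fun y : R => expR (- y)) (expR (- y) * -1).
    exact: (@is_derive1_comp R expR (fun y => - y) y _ _ (is_derive_expR _) (dN y)).
  have dF := is_deriveM (is_derive_expn k x^-1) (dexp x^-1).
  have := @is_derive1_comp R F GRing.inv x _ _ dF dinv.
  move=> h; apply: (@is_derive_eq _ _ _ _ _ _ _ _ h).
  rewrite /flat x0 -![_ *: _]/(_ * _) -exprVn; set y := x^-1.
  case: (k) => [|j]; first by rewrite !mul0r !oppr0 !mul0r /= expr0 expr2; ring.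
  by rewrite /= !exprS expr0; ring.
- have h : h^-1 *: ((flat k \o shift 0) (h *: 1) - flat k 0) @[h --> (0:R)^'] --> (0:R).
    have fk0 j : flat j 0 = 0 by rewrite /flat ltxx.
    apply/cvgrPdist_le => eps eps0; near=> h.
    rewrite sub0r normrN fk0 subr0 /= addr0 -[h *: 1]/(h * 1) mulr1 -[_ *: _]/(_ * _) normrM.
    (* Trading two powers of [h] for orders of [flat] gives a quadratic bound, so the difference
       quotient at 0 tends to 0. *)
    have hk : `|flat k h| <= `|h| * (`|h| * k.+2`!%:R).
      rewrite /flat; case: ifPn => [h0|_]; last by rewrite normr0 !mulr_ge0.
      have := flatS_le k.+1 h; rewrite /flat h0 exprS => hh.
      rewrite [`|_ * expR _|]ger0_norm ?mulr_ge0 ?expR_ge0 ?exprn_ge0 ?invr_ge0 ?(ltW h0)//.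
      by move: hh; rewrite (gtr0_norm h0) -mulrA ler_pdivrMl.
    have h0 : h != 0 by near: h; exact: nbhs_dnbhs_neq.
    rewrite normfV ler_pdivrMl ?normr_gt0//; apply: (le_trans hk).
    rewrite ler_wpM2l// -ler_pdivlMr ?ltr0n ?fact_gt0//.
    near: h; apply: dnbhs0_le; by rewrite divr_gt0// ltr0n fact_gt0.
  apply: DeriveDef; first by apply/cvg_ex; exists 0.
  rewrite /flat !ltxx mulr0 addr0; exact/cvg_lim.
Unshelve. all: by end_near. Qed.

Lemma is_derive_dir (f : R -> R) (x v df : R) : is_derive x (1:R) f df ->
  derivable f x v /\ 'D_v f x = v * df.
Proof.
move=> [d1 e1]; have df1 : differentiable f x by apply/derivable1_diffP.
split; first exact: diff_derivable.
rewrite deriveE// -e1 deriveE// -[in LHS](mulr1 v) -[v * 1]/(v *: 1) linearZ.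
by [].
Qed.

(** The two factors vanish to infinite order at -1 and at 1. Free orders and a free scalar make the
    span of the family stable under derivatives; the bump itself is the case j = k = 0. *)
Definition bump2 (c : R) (j k : nat) (s : R) : R := c * (flat j (1 + s) * flat k (1 - s)).

Lemma is_derive_bump2 c j k s : is_derive s (1:R) (bump2 c j k)
  (bump2 (- (c * j%:R)) j.+1 k s + bump2 c j.+2 k s + bump2 (c * k%:R) j k.+1 s + bump2 (- c) j k.+2 s).
Proof.
have d1 : is_derive s (1:R) (fun s => flat j (1 + s)) (- j%:R * flat j.+1 (1 + s) + flat j.+2 (1 + s)).
  rewrite (_ : (fun s => flat j (1 + s)) = flat j \o (fun s => 1 * s + 1)); last first.
    by apply/funext => t; rewrite /= mul1r addrC.
  apply: (@is_derive_eq _ _ _ _ _ _ _ _ (@is_derive1_comp R (flat j) (fun s => 1 * s + 1) s _ _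
    (is_derive_flat j _) (is_derive_affine 1 1 s))).
  by rewrite mulr1 mul1r [s + 1]addrC.
have d2 : is_derive s (1:R) (fun s => flat k (1 - s)) ((- k%:R * flat k.+1 (1 - s) + flat k.+2 (1 - s)) * -1).
  rewrite (_ : (fun s => flat k (1 - s)) = flat k \o (fun s => -1 * s + 1)); last first.
    by apply/funext => t; rewrite /= mulN1r addrC.
  apply: (@is_derive_eq _ _ _ _ _ _ _ _ (@is_derive1_comp R (flat k) (fun s => -1 * s + 1) s _ _
    (is_derive_flat k _) (is_derive_affine (-1) 1 s))).
  by rewrite mulN1r [- s + 1]addrC.
have := is_deriveZ c (is_deriveM d1 d2).
move=> h; apply: (@is_derive_eq _ _ _ _ _ _ _ _ h).
by rewrite -![_ *: _]/(_ * _) /bump2; ring.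
Qed.

Lemma bump2_eq0 c j k s : 1 < `|s| -> bump2 c j k s = 0.
Proof.
rewrite lter_normr /bump2 => /orP[s1|s1].
  rewrite /flat [X in _ * (_ * X)]ifF ?mulr0//.
  by apply/negbTE; rewrite -leNgt subr_le0 ltW.
rewrite /flat [X in _ * (X * _)]ifF ?mul0r ?mulr0//.
by apply/negbTE; rewrite -leNgt addrC -lerBrDr sub0r lerNr ltW.
Qed.

Lemma schwartz_bump2 c j k : schwartz_real (bump2 c j k).
Proof.
apply: (@schwartz_span _ _ (fun f => exists c j k, f = bump2 c j k)).
- by move=> _ [a [i [l ->]]] x v; exact: (is_derive_dir v (is_derive_bump2 a i l x)).1.
- move=> _ [a [i [l ->]]] v.
  rewrite (_ : 'D_v _ = fun s => ((bump2 (- (v * a * i%:R)) i.+1 l s + bump2 (v * a) i.+2 l s)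
     + bump2 (v * a * l%:R) i l.+1 s) + bump2 (- (v * a)) i l.+2 s).
    apply: addspan_add; last by apply: addspan_base; do 3 eexists.
    apply: addspan_add; last by apply: addspan_base; do 3 eexists.
    by apply: addspan_add; apply: addspan_base; do 3 eexists.
  apply/funext => s; rewrite (is_derive_dir v (is_derive_bump2 a i l s)).2 /bump2; ring.
- move=> _ [a [i [l ->]]] n; exists (`|a| * (i`!%:R * l`!%:R)) => s.
  have [s1|s1] := leP `|s| 1; last by rewrite bump2_eq0// normr0 mulr0 !mulr_ge0.
  apply: (@le_trans _ _ (1 * `|bump2 a i l s|)); first by rewrite ler_wpM2r// exprn_ile1.
  by rewrite mul1r /bump2 !normrM ler_wpM2l// ler_pM// flat_norm.
- by apply: addspan_base; do 3 eexists.
Qed.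

Lemma bump_exists (r : R) : exists b : R -> R,
  [/\ schwartz_real b, b r = 1 & exists M, forall s, M < `|s| -> b s = 0].
Proof.
(* Scaling by [1 + |r|] brings [r] strictly inside (-1, 1), where the standard bump is positive and
   can be normalized by its value. *)
pose D := 1 + `|r|; have D0 : 0 < D by rewrite ltr_pwDl.
pose A (s : R) := D^-1 * s.
have Ar : `|A r| < 1 by rewrite /A normrM normfV (gtr0_norm D0) ltr_pdivrMl// mulr1 /D ltrDr.
pose c := bump2 1 0 0 (A r).
have c0 : c != 0.
  rewrite /c /bump2 mul1r /flat; move: Ar; rewrite ltr_norml => /andP[h1 h2].
  rewrite !ifT; last 2 first.
    by rewrite subr_gt0.
    by rewrite -ltrBlDl sub0r.
  by rewrite gt_eqF// !mulr_gt0 ?expR_gt0.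
exists (fun s => c^-1 * bump2 1 0 0 (A s)); split.
- apply: schwartz_realZ.
  apply: (@schwartz_real_pullback R R R A A D _ _ (bump2 1 0 0)).
  + by move=> h x v; rewrite /A -![_ *: _]/(_ * _) mulrDr mulrCA.
  + by move=> x; rewrite /A normrM normfV (gtr0_norm D0) mulrA divff ?mul1r ?gt_eqF.
  + exact: schwartz_bump2.
- by rewrite -/c mulVf.
- exists D => s Ds; rewrite bump2_eq0 ?mulr0//.
  by rewrite /A normrM normfV (gtr0_norm D0) ltr_pdivlMl// mulr1.
Qed.

End bump.

(** * Symbols and kernels *)

Lemma IFT_eq0 (R : realType) n (W : Type) (h : 'rV[R]_n * W -> R[i]) x w :
  (forall p, h (p, w) = 0) -> IFT h (x, w) = 0.
Proof.
have j0 : conjc (0 : R[i]) = 0 by apply: complexP; rewrite /= ?oppr0.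
move=> h0; rewrite /IFT /FT -[RHS]j0; apply: (congr1 (@conjc R)).
rewrite -[RHS](cintegral0 (leb R n)); apply: eq_cintegral => p.
by rewrite h0 j0 mul0r.
Qed.

(** * The Fourier transform in both vector variables *)

Section two_variable_fourier.
Context (R : realType) (n : nat).
Local Notation V := 'rV[R]_n.
Local Notation G := (V * V * R)%type.
Implicit Types (f : G -> R[i]) (phi : V * V -> R[i]).

(** [FT] acts on the first component of a pair. These reorderings bring first [y] and then [x] to
    the front, or first [p] and then [q] for the inverse, and keep the rest as parameters. *)
Let toA (f : G -> R[i]) (p : V * (V * R)) : R[i] := f ((p.2.1, p.1), p.2.2).
Let ofA (h : V * (V * R) -> R[i]) (p : G) : R[i] := h (p.1.2, (p.1.1, p.2)).
Let swapB (h : V * (V * R) -> R[i]) (p : V * (V * R)) : R[i] := h (p.2.1, (p.1, p.2.2)).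
Let toC (f : G -> R[i]) (p : V * (V * R)) : R[i] := f ((p.1, p.2.1), p.2.2).
Let ofC (h : V * (V * R) -> R[i]) (p : G) : R[i] := h (p.1.1, (p.1.2, p.2)).

Definition FT2 f : G -> R[i] := ofC (FT (swapB (FT (toA f)))).
Definition IFT2 f : G -> R[i] := ofA (IFT (swapB (IFT (toC f)))).

Let schwartz_toA f : schwartz f -> schwartz (toA f).
Proof.
pose A (p : V * (V * R)) : G := ((p.2.1, p.1), p.2.2).
apply: (@schwartz_pullback _ _ _ A A 1) => // -[x [y s]].
by rewrite mul1r !prod_normE /= maxA [Num.max `|x| `|y|]maxC.
Qed.

Let schwartz_toC f : schwartz f -> schwartz (toC f).
Proof.
pose A (p : V * (V * R)) : G := ((p.1, p.2.1), p.2.2).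
apply: (@schwartz_pullback _ _ _ A A 1) => // -[x [y s]].
by rewrite mul1r !prod_normE /= maxA.
Qed.

Let schwartz_ofA h : schwartz h -> schwartz (ofA h).
Proof.
pose A (p : G) : V * (V * R) := (p.1.2, (p.1.1, p.2)).
apply: (@schwartz_pullback _ _ _ A A 1) => // -[[x y] s].
by rewrite mul1r !prod_normE /= maxA [Num.max `|y| `|x|]maxC.
Qed.

Let schwartz_ofC h : schwartz h -> schwartz (ofC h).
Proof.
pose A (p : G) : V * (V * R) := (p.1.1, (p.1.2, p.2)).
apply: (@schwartz_pullback _ _ _ A A 1) => // -[[x y] s].
by rewrite mul1r !prod_normE /= maxA.
Qed.

Let schwartz_swapB h : schwartz h -> schwartz (swapB h).
Proof.
pose A (p : V * (V * R)) : V * (V * R) := (p.2.1, (p.1, p.2.2)).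
apply: (@schwartz_pullback _ _ _ A A 1) => // -[x [y s]].
by rewrite mul1r !prod_normE /= maxCA.
Qed.

Lemma schwartz_FT2 f : schwartz f -> schwartz (FT2 f).
Proof. by move=> sf; apply/schwartz_ofC/schwartz_FT/schwartz_swapB/schwartz_FT/schwartz_toA. Qed.

Lemma schwartz_IFT2 f : schwartz f -> schwartz (IFT2 f).
Proof. by move=> sf; apply/schwartz_ofA/schwartz_IFT/schwartz_swapB/schwartz_IFT/schwartz_toC. Qed.

Let swapBK h : swapB (swapB h) = h.
Proof. by apply/funext => -[x [y s]]. Qed.
Let toCK f : ofC (toC f) = f. Proof. by apply/funext => -[[x y] s]. Qed.
Let ofAK h : toA (ofA h) = h. Proof. by apply/funext => -[x [y s]]. Qed.

Lemma IFT2K f : schwartz f -> FT2 (IFT2 f) = f.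
Proof.
move=> sf; have sC := schwartz_toC sf.
have sB : schwartz (swapB (IFT (toC f))) by exact/schwartz_swapB/schwartz_IFT.
by rewrite /IFT2 /FT2 ofAK (IFTK sB) swapBK (IFTK sC) toCK.
Qed.

(** The variable [r] is only a parameter of the transform, so compact support in [r], as [calA]
    demands, survives it. *)
Lemma IFT2_slice0 f r : (forall p q, f (p, q, r) = 0) -> forall x y, IFT2 f (x, y, r) = 0.
Proof. by move=> f0 x y; apply: IFT_eq0 => q; apply: IFT_eq0 => p; exact: f0. Qed.

(** [schwartz_weight_bound] extracts the weight in [u] while keeping 2 n powers of [v]; these pay
    for the weight in [v]. *)
Lemma schwartz_two_weights (K : V * V -> R[i]) : schwartz K ->
  exists2 C, 0 <= C & forall u v, normc (K (u, v)) <= C * (weight u * weight v).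
Proof.
move=> sK; have [M M0 KM] := schwartz_weight_bound 0 sK.
have [N N0 KN] := schwartz_weight_bound (2 * n) sK.
exists (2 ^+ n * (M + N)) => [|u v]; first by rewrite mulr_ge0 ?exprn_ge0 ?addr_ge0.
set F := normc _; have F0 : 0 <= F := normc_ge0 _.
have wu := weight_ge0 u; have wv := weight_ge0 v.
apply: (@le_trans _ _ (F * ((1 + `|v| ^+ 2) ^+ n * weight v))).
  by rewrite ler_peMr ?weight_norm_le.
rewrite !mulrA ler_wpM2r//.
apply: (@le_trans _ _ (F * (2 ^+ n * (1 + (`|v| ^+ 2) ^+ n)))).
  by rewrite ler_wpM2l// expr1D_le// exprn_ge0.
rewrite mulrCA -mulrA ler_wpM2l ?exprn_ge0// mulrDr mulr1 mulrDl; apply: lerD.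
  by have := KM u v; rewrite expr0 mul1r.
by rewrite mulrC -exprM; exact: KN.
Qed.

Lemma measurable_leb2_dot (p q : V) :
  measurable_fun setT (fun z : V * V => dot p z.1 + dot q z.2).
Proof.
by apply: measurable_funD; [apply: (measurableT_comp (measurable_dot p)); exact: measurable_fst|
  apply: (measurableT_comp (measurable_dot q)); exact: measurable_snd].
Qed.

Lemma leb2_fubini (F : V * V -> R[i]) (a b : V -> R) :
  cmeasurable F -> rintegrable (leb R n) a -> rintegrable (leb R n) b ->
  (forall x y, normc (F (x, y)) <= a x * b y) ->
  cintegral (leb2 R n) F = cintegral (leb R n) (fun x => cintegral (leb R n) (fun y => F (x, y))) /\
  cintegral (leb2 R n) F = cintegral (leb R n) (fun y => cintegral (leb R n) (fun x => F (x, y))).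
Proof.
move=> mF ia ib Fab; split.
  exact: (cfub1 mF ia ib Fab).
exact: (cfub2 mF ia ib Fab).
Qed.

Lemma fhatE f : schwartz f -> fhat f = FT2 f.
Proof.
move=> sf; apply/funext => -[[p q] r]; rewrite /fhat /FT2 /ofC /FT /=.
have sr : schwartz (fun z : V * V => f (z, r)) by exact: schwartz_slice1.
have [C C0 fC] := schwartz_two_weights sr.
have iw := rintegrable_weight R n.
have mF : cmeasurable (fun z : V * V => f (z.1, z.2, r) * ebar (dot p z.1 + dot q z.2)).
  apply: cmeasurableM.
    by have := schwartz_cmeasurable_rV2 sr; congr cmeasurable; apply/funext => -[].
  by apply: cmeasurable_ebar; exact: measurable_leb2_dot.
have Fb x y : normc (f ((x, y).1, (x, y).2, r) * ebar (dot p (x, y).1 + dot q (x, y).2)) <=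
    C * weight x * weight y.
  by rewrite normcM normc_ebar mulr1 -mulrA; exact: fC.
rewrite (leb2_fubini mF (rintegrableZ C iw) iw Fb).1.
apply: eq_cintegral => x; rewrite /swapB /= /toA /=.
rewrite -cintegralZr; last first.
  exact: (cintegrable_FT q (x, r) (schwartz_toA sf)).
apply: eq_cintegral => y; rewrite -mulrA; congr (_ * _).
by rewrite /ebar opprD addrC eD.
Qed.

End two_variable_fourier.

(** * Product and involution of symbols through their kernels *)

Section symbol_kernels.
Context (R : realType) (n : nat) (eta : R) (eta0 : eta != 0).
Local Notation V := 'rV[R]_n.
Implicit Types (phi psi : V * V -> R[i]).
Local Notation w := (@weight R n).

Let dominated := @dominated_kernel _ _ R w.

(* For phi = fhat f (., ., r) and eta = eta lam r this is
   (u, v) |-> int f (v - u, y, r) ebar (eta u . y) dy, the integral kernel of pi_r(f). *)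
Definition symbol_kernel phi (p : V * V) : R[i] := IFT phi (p.2 - p.1, eta *: p.1).

Lemma schwartz_dominated (K : V * V -> R[i]) : schwartz K -> dominated K.
Proof.
move=> sK; split; first exact: schwartz_cmeasurable_rV2.
exact: schwartz_two_weights.
Qed.

Let norm_le2 (x y : V) (C N : R) : `|x| <= C * N -> `|y| <= C * N -> `|(x, y)| <= C * N.
Proof. by move=> h1 h2; rewrite prod_normE ge_max h1 h2. Qed.

Lemma schwartz_symbol_kernel phi : schwartz phi -> schwartz (symbol_kernel phi).
Proof.
move=> sp; pose A (p : V * V) : V * V := (p.2 - p.1, eta *: p.1).
(* The constant bounds the inverse of [A]: [u] is [eta^-1] times the second component, and [v] is
   the first component plus [u]. *)
apply: (@schwartz_pullback _ _ _ A A (1 + `|eta|^-1) _ _ (IFT phi)); last exact: schwartz_IFT.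
  move=> h [x1 x2] [v1 v2]; congr pair => /=.
    by rewrite scalerBr opprD addrACA.
  by rewrite scalerDr !scalerA mulrC.
move=> [u v]; set N := `|A _|.
have N0 : 0 <= N := normr_ge0 _.
have h1 : `|v - u| <= N by rewrite /N prod_normE le_max lexx.
have h2 : `|u| <= `|eta|^-1 * N.
  rewrite ler_pdivlMl ?normr_gt0// -normrZ /N prod_normE le_max lexx orbT//.
apply: norm_le2.
  by apply: (le_trans h2); rewrite ler_wpM2r// lerDr.
rewrite -[v](subrK u) (le_trans (ler_normD _ _))// mulrDl mul1r lerD//.
Qed.

Lemma symbol_kernel_dominated phi : schwartz phi -> dominated (symbol_kernel phi).
Proof. by move=> sp; apply: schwartz_dominated; exact: schwartz_symbol_kernel. Qed.

Lemma dotZl (a : R) (u v : V) : dot (a *: u) v = a * dot u v.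
Proof. by rewrite /dot mulr_sumr; apply: eq_bigr => i _; rewrite mxE mulrA. Qed.
Lemma dotDl (u u' v : V) : dot (u + u') v = dot u v + dot u' v.
Proof. by rewrite /dot -big_split; apply: eq_bigr => i _; rewrite /= mxE mulrDl. Qed.
Lemma dotNl (u v : V) : dot (- u) v = - dot u v.
Proof. by rewrite -scaleN1r dotZl mulN1r. Qed.
Lemma dotBl (u u' v : V) : dot (u - u') v = dot u v - dot u' v.
Proof. by rewrite dotDl dotNl. Qed.

(** In the product formula the integral over the momentum is already an inverse transform of [phi],
    which leaves one Fourier integral in [x]. There [alpha] occurs both as frequency and in [psi];
    kept as two arguments, it turns the product into a transform with parameters, restricted in
    [mulf] to a diagonal. *)
Definition twist_integrand phi psi (p : V * (V * V)) : R[i] :=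
  IFT phi (p.1, p.2.2) * psi (p.2.1, p.2.2 + eta *: p.1).

Definition mulf phi psi (p : V * V) : R[i] := FT (twist_integrand phi psi) (p.1, p).

Lemma schwartz_twist phi psi : schwartz phi -> schwartz psi -> schwartz (twist_integrand phi psi).
Proof.
move=> sp sq; pose A (p : V * (V * V)) : (V * V) * (V * V) :=
  ((p.1, p.2.2), (p.2.1, p.2.2 + eta *: p.1)).
have st := schwartz_tensor (schwartz_IFT sp) sq.
apply: (@schwartz_pullback _ _ _ A A 1 _ _ _ st).
  move=> h [x1 [x2 x3]] [v1 [v2 v3]]; congr pair; congr pair => /=.
  by rewrite !scalerDr !scalerA [eta * h]mulrC addrACA.
move=> [x [a b]]; rewrite mul1r /A !prod_normE /= !ge_max !le_max !lexx ?orbT//.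
Qed.

Lemma schwartz_mulf phi psi : schwartz phi -> schwartz psi -> schwartz (mulf phi psi).
Proof.
move=> sp sq; have sT := schwartz_FT (schwartz_twist sp sq).
apply: (@schwartz_pullback _ _ _ (fun p : V * V => (p.1, p)) (fun p : V * V => (p.1, p)) 1 _ _ _ sT) => //.
by move=> p; rewrite mul1r [leRHS]prod_normE le_max lexx orbT.
Qed.

Lemma mulfE phi psi (a b : V) : mulf phi psi (a, b) =
  cintegral (leb R n) (fun x => IFT phi (x, b) * psi (a, b + eta *: x) * ebar (dot a x)).
Proof. by []. Qed.

Lemma schwartz_slice_affine psi (a b : V) : schwartz psi -> schwartz (fun x => psi (a, b + eta *: x)).
Proof.
move=> sq; have s2 := schwartz_slice2 sq a.
apply: (@schwartz_pullback_affine _ _ _ (fun x : V => b + eta *: x) (fun x => eta *: x)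
  (`|eta|^-1 * (1 + `|b|)) _ _ _ s2).
  by move=> h x v; rewrite scalerDr !scalerA [eta * h]mulrC addrCA.
move=> x; rewrite -mulrA ler_pdivlMl ?normr_gt0// -normrZ.
rewrite -{1}[eta *: x](addKr b) (le_trans (ler_normD _ _))// normrN.
set y := `|b + eta *: x|; have y0 : 0 <= y := normr_ge0 _.
have b0 : 0 <= `|b| := normr_ge0 _.
by rewrite mulrDl mul1r mulrDr mulr1; nra.
Qed.

(** For fixed (a, b) the modulus is a function of the momentum times a function of [x], the latter
    integrable because [eta] is nonzero. The double integral therefore converges absolutely, and its
    inner integral over the momentum is [IFT phi]. *)
Lemma mulf_formula phi psi (a b : V) : schwartz phi -> schwartz psi ->
  mulf phi psi (a, b) = cintegral (leb2 R n) (fun z =>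
    phi (z.1, b) * psi (a, b + eta *: z.2) * e (dot (z.1 - a) z.2)).
Proof.
move=> sp sq; have sa := schwartz_slice_affine a b sq; have s1 := schwartz_slice1 sp b.
have ia := cintegrable_normc (schwartz_cintegrable s1).
have ib := cintegrable_normc (schwartz_cintegrable sa).
have mF : cmeasurable (fun z : V * V => phi (z.1, b) * psi (a, b + eta *: z.2) * e (dot (z.1 - a) z.2)).
  apply: cmeasurableM.
    apply: cmeasurableM.
      exact: (cmeasurable_comp (schwartz_cmeasurable_rV s1) measurable_fst).
    exact: (cmeasurable_comp (schwartz_cmeasurable_rV sa) measurable_snd).
  apply: cmeasurable_e; apply: measurable_sum => i; apply: measurable_funM.
    under eq_fun do rewrite !mxE; apply: measurable_funD; last exact: measurable_cst.
    exact: (measurableT_comp (measurable_coord i) measurable_fst).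
  exact: (measurableT_comp (measurable_coord i) measurable_snd).
have Fb x y : normc (phi ((x, y).1, b) * psi (a, b + eta *: (x, y).2) * e (dot ((x, y).1 - a) (x, y).2)) <=
   normc (phi (x, b)) * normc (psi (a, b + eta *: y)).
  by rewrite !normcM normc_e mulr1.
rewrite (leb2_fubini mF ia ib Fb).2 mulfE; apply: eq_cintegral => x.
rewrite IFTE// -mulrA -cintegralZr; last first.
  apply: cintegrableMe; first exact: schwartz_cintegrable.
  exact: measurable_dot.
apply: eq_cintegral => p /=; rewrite dotBl eD -conj_e.
rewrite [dot x p]dotC /ebar -conj_e; apply: complexP;
by rewrite ?(ReM, ImM, Reconj, Imconj); ring.
Qed.

(** On the inverse transforms the product is a twisted convolution: the character [ebar (dot a t)]
    moves the argument of the inverse transform of [psi] from [x] to [x - t]. *)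
Lemma IFT_mulf phi psi (x b : V) : schwartz phi -> schwartz psi ->
  IFT (mulf phi psi) (x, b) = cintegral (leb R n) (fun t => IFT phi (t, b) * IFT psi (x - t, b + eta *: t)).
Proof.
move=> sp sq; have st := schwartz_twist sp sq.
have sB : schwartz (fun p : V * V => twist_integrand phi psi (p.1, (p.2, b))).
  apply: (@schwartz_pullback _ _ _ (fun p : V * V => (p.1, (p.2, b))) (fun p : V * V => (p.1, (p.2, 0))) 1 _ _ _ st).
    by move=> h p v; congr pair; congr pair; rewrite /= scaler0 add0r.
  by move=> [u v]; rewrite mul1r !prod_normE /= !ge_max !le_max !lexx ?orbT.
have [C C0 BC] := schwartz_two_weights sB.
pose h (p : V * V) := twist_integrand phi psi (p.2, (p.1, b)) * ebar (dot p.1 p.2) * e (dot x p.1).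
have mswap : measurable_fun setT (fun p : V * V => (p.2, p.1)).
  by apply/measurable_fun_pairP; split; [exact: measurable_snd|exact: measurable_fst].
have mh : cmeasurable h.
  apply: cmeasurableM.
    apply: cmeasurableM.
      exact: (cmeasurable_comp (schwartz_cmeasurable_rV2 sB) mswap).
    apply: cmeasurable_ebar; apply: measurable_sum => i; apply: measurable_funM.
      exact: (measurableT_comp (measurable_coord i) measurable_fst).
    exact: (measurableT_comp (measurable_coord i) measurable_snd).
  apply: cmeasurable_e; exact: (measurableT_comp (measurable_dot x) measurable_fst).
have iw := rintegrable_weight R n.
have hb u v : normc (h (u, v)) <= (C * w u) * w v.
  by have := BC v u; rewrite /h 2!normcM normc_e normc_ebar !mulr1 (mulrC (w v)) mulrA.
rewrite IFTE; last exact: schwartz_mulf.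
transitivity (cintegral (leb R n) (fun a => cintegral (leb R n) (fun t => h (a, t)))).
  apply: eq_cintegral => a; rewrite /mulf /FT/= -cintegralZr//.
  exact: (cintegrable_FT a (a, b) st).
rewrite (cfubC mh (rintegrableZ C iw) iw hb); apply: eq_cintegral => t.
rewrite [X in _ * X]IFTE// -cintegralZl; last first.
  apply: cintegrableMe; last exact: measurable_dot.
  exact: (schwartz_cintegrable (schwartz_slice1 sq _)).
apply: eq_cintegral => a; rewrite /h /twist_integrand /= dotBl eD /ebar -!mulrA.
congr (_ * (_ * _)); rewrite [dot a t]dotC mulrC//.
Qed.

(** Translating [t] by [u] turns the twisted convolution into composition of kernels: with b = eta u
    the twist [b + eta *: t] is [eta *: (u + t)], which is what the second kernel expects. *)
Lemma symbol_kernel_mulf phi psi (u v : V) : schwartz phi -> schwartz psi ->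
  symbol_kernel (mulf phi psi) (u, v) =
  cintegral (leb R n) (fun t => symbol_kernel phi (u, t) * symbol_kernel psi (t, v)).
Proof.
move=> sp sq; apply: (etrans (IFT_mulf (v - u) (eta *: u) sp sq)).
apply: esym; rewrite -(cintegral_leb_shift u); last first.
  have s1 := schwartz_slice2 (schwartz_symbol_kernel sp) u.
  have s2 := schwartz_slice1 (schwartz_symbol_kernel sq) v.
  have [M M0 sM] := schwartz_weight_bound1 s1.
  apply: (cintegrable_le _ (rintegrableZ M (cintegrable_normc (schwartz_cintegrable s2)))).
    by apply: cmeasurableM; [exact: (schwartz_cmeasurable_rV s1)|exact: (schwartz_cmeasurable_rV s2)].
  move=> t; rewrite normcM ler_wpM2r ?normc_ge0//.
  by apply: (le_trans (sM t)); rewrite ler_piMr// weight_le1.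
apply: eq_cintegral => t.
rewrite -[LHS]/(IFT phi (u + t - u, eta *: u) * IFT psi (v - (u + t), eta *: (u + t))).
rewrite (_ : u + t - u = t); last by rewrite addrC addKr.
by rewrite (_ : v - (u + t) = v - u - t) ?scalerDr//; rewrite opprD addrA.
Qed.

(** The adjoint kernel in the coordinates x = v - u and b = eta u: there [eta *: v] is
    [b + eta *: x], and conjugating the inverse transform of [psi] at [- x] gives that of the
    conjugate of [psi] at [x]. *)
Definition star_integrand psi (p : V * V) : R[i] :=
  IFT (fun q => conjc (psi q)) (p.1, p.2 + eta *: p.1).

Definition starf psi : V * V -> R[i] := FT (star_integrand psi).

Lemma schwartz_star_integrand psi : schwartz psi -> schwartz (star_integrand psi).
Proof.
move=> sq; have sc := schwartz_IFT (schwartz_conj sq).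
pose A (p : V * V) : V * V := (p.1, p.2 + eta *: p.1).
apply: (@schwartz_pullback _ _ _ A A (1 + `|eta|) _ _ _ sc).
  move=> h [x1 x2] [v1 v2]; congr pair => /=.
  by rewrite !scalerDr !scalerA [eta * h]mulrC addrACA.
move=> [x b]; set N := `|A _|; have N0 : 0 <= N := normr_ge0 _.
have h1 : `|x| <= N by rewrite /N prod_normE le_max lexx.
have h2 : `|b + eta *: x| <= N by rewrite /N prod_normE le_max lexx orbT.
apply: norm_le2.
  by apply: (le_trans h1); rewrite ler_peMl// lerDl.
rewrite -[b](addrK (eta *: x)) (le_trans (ler_normB _ _))// mulrDl mul1r lerD// normrZ.
by rewrite ler_wpM2l.
Qed.

Lemma schwartz_starf psi : schwartz psi -> schwartz (starf psi).
Proof. by move=> sq; apply: schwartz_FT; exact: schwartz_star_integrand. Qed.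

Lemma conj_IFT psi (x b : V) : schwartz psi ->
  IFT (fun q => conjc (psi q)) (x, b) = conjc (IFT psi (- x, b)).
Proof.
move=> sq; rewrite !IFTE//; last exact: schwartz_conj.
rewrite -cintegral_conj; last first.
  apply: cintegrableMe; last exact: measurable_dot.
  exact: (schwartz_cintegrable (schwartz_slice1 sq _)).
by apply: eq_cintegral => p; rewrite conjcM conj_e dotNl opprK.
Qed.

Lemma symbol_kernel_starf psi (u v : V) : schwartz psi ->
  symbol_kernel (starf psi) (u, v) = conjc (symbol_kernel psi (v, u)).
Proof.
move=> sq; rewrite /symbol_kernel /starf FTK; last exact: schwartz_star_integrand.
rewrite /star_integrand /= conj_IFT// opprB; congr (conjc (IFT _ (_, _))).
by rewrite -scalerDr addrC subrK.
Qed.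

Lemma measurable_dot2 : measurable_fun setT (fun z : V * V => dot z.1 z.2).
Proof.
apply: measurable_sum => i; apply: measurable_funM.
  exact: (measurableT_comp (measurable_coord i) measurable_fst).
exact: (measurableT_comp (measurable_coord i) measurable_snd).
Qed.

(** The integral over [z] is a full inverse transform of the conjugate of [psi], so it decays in the
    outer variables and Fubini applies to them. The characters in [y] combine to the frequency
    [b + eta *: x]; integrating over [y] then undoes half of that inverse transform. *)
Lemma starf_formula psi (a b : V) : schwartz psi ->
  starf psi (a, b) = cintegral (leb2 R n) (fun w => cintegral (leb2 R n) (fun z =>
    conjc (psi z) * ebar (dot (a - z.1) w.1 + dot (b - z.2) w.2) * ebar (eta * dot w.1 w.2))).
Proof.
move=> sq; have sc := schwartz_conj sq; have sI := schwartz_IFT sc.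
(* Partial inverse transform in the first variable, with the arguments swapped so that the next
   [IFT] acts on the second one. *)
pose theta (p : V * V) := IFT (fun q => conjc (psi q)) (p.2, p.1).
have sth : schwartz theta.
  pose A (p : V * V) : V * V := (p.2, p.1).
  apply: (@schwartz_pullback _ _ _ A A 1 _ _ _ sI) => // -[x y].
  by rewrite mul1r !prod_normE /= maxC.
have sIth := schwartz_IFT sth.
have iw := rintegrable_weight R n.
have [C C0 cC] := schwartz_two_weights sc.
have [D D0 tD] := schwartz_two_weights sIth.
pose c (z : V * V) := ebar (dot a z.1 + dot b z.2 + eta * dot z.1 z.2).
have inner (x y : V) : cintegral (leb2 R n) (fun z =>
    conjc (psi z) * ebar (dot (a - z.1) x + dot (b - z.2) y) * ebar (eta * dot x y)) =
    IFT theta (y, x) * c (x, y).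
  transitivity (cintegral (leb2 R n) (fun z => c (x, y) * (conjc (psi z) * e (dot x z.1 + dot y z.2)))).
    apply: eq_cintegral => z; rewrite mulrCA -!mulrA; congr (_ * _).
    rewrite /c /ebar -!eD; congr e; rewrite !dotBl (dotC x z.1) (dotC y z.2) /=; ring.
  have mF : cmeasurable (fun z : V * V => conjc (psi z) * e (dot x z.1 + dot y z.2)).
    apply: cmeasurableM; first exact: schwartz_cmeasurable_rV2.
    by apply: cmeasurable_e; exact: measurable_leb2_dot.
  have Fb p q : normc (conjc (psi (p, q)) * e (dot x (p, q).1 + dot y (p, q).2)) <= (C * weight p) * weight q.
    by rewrite normcM normc_e mulr1 -mulrA.
  rewrite cintegralZl; last exact: (cfub_prod mF (rintegrableZ C iw) iw Fb).
  rewrite mulrC (leb2_fubini mF (rintegrableZ C iw) iw Fb).2; congr (_ * _).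
  rewrite IFTE//; apply: eq_cintegral => q; rewrite /theta /= IFTE// -cintegralZr; last first.
    apply: cintegrableMe; last exact: measurable_dot.
    exact: (schwartz_cintegrable (schwartz_slice1 sc _)).
  by apply: eq_cintegral => p /=; rewrite eD mulrA.
transitivity (cintegral (leb2 R n) (fun w => IFT theta (w.2, w.1) * c w)); last first.
  by apply: eq_cintegral => -[x y]; rewrite inner.
have mswap : measurable_fun setT (fun p : V * V => (p.2, p.1)).
  by apply/measurable_fun_pairP; split; [exact: measurable_snd|exact: measurable_fst].
have mG : cmeasurable (fun w : V * V => IFT theta (w.2, w.1) * c w).
  apply: cmeasurableM; first exact: (cmeasurable_comp (schwartz_cmeasurable_rV2 sIth) mswap).
  apply: cmeasurable_ebar; apply: measurable_funD; first exact: measurable_leb2_dot.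
  by apply: measurable_funM => //; exact: measurable_dot2.
have Gb x y : normc (IFT theta ((x, y).2, (x, y).1) * c (x, y)) <= (D * weight x) * weight y.
  by rewrite normcM /c normc_ebar mulr1 -mulrA (mulrC (weight x)); exact: tD.
rewrite (leb2_fubini mG (rintegrableZ D iw) iw Gb).1 /starf /FT.
apply: eq_cintegral => x /=.
rewrite /star_integrand /= -[IFT _ _]/(theta (b + eta *: x, x)) -[in LHS](IFTK sth) /FT /=.
rewrite -cintegralZr; last exact: cintegrable_FT.
apply: eq_cintegral => y; rewrite -mulrA; congr (_ * _).
by rewrite /c /ebar -eD; congr e; rewrite dotDl dotZl /=; ring.
Qed.

End symbol_kernels.

(** * Quantization of the orbits *)

Section operators.
Context (R : realType) (n : nat) (lam : R).
Local Notation V := 'rV[R]_n.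
Local Notation G := (V * V * R)%type.
Local Notation w := (@weight R n).
Local Notation mu := (leb R n).

Lemma eta_neq0 (r : R) : r != 0 -> eta lam r != 0.
Proof.
move=> r0; rewrite /eta; case: ifPn => // l0.
rewrite mulf_neq0 ?invr_eq0 ?mulf_neq0//.
by rewrite subr_eq0 -expR0 (inj_eq (@expR_inj R)) !mulf_neq0.
Qed.

Lemma schwartz_is_L2 (f : V -> R[i]) : schwartz f -> is_L2 mu f.
Proof.
move=> sf; have [M M0 fM] := schwartz_weight_bound1 sf.
apply: (is_L2_le (schwartz_cmeasurable_rV sf) (rintegrableZ (M ^+ 2) (rintegrable_weight R n))) => x.
rewrite -sqr_normcE; apply: (@le_trans _ _ ((M * w x) ^+ 2)).
  by apply: lerXn2r; rewrite ?nnegrE; [exact: normc_ge0|rewrite mulr_ge0// weight_ge0|exact: fM].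
by rewrite exprMn ler_wpM2l ?sqr_ge0// expr2 ler_piMr ?weight_ge0// weight_le1.
Qed.

Lemma is_L2_shift (u : V) (g : V -> R[i]) : is_L2 mu g -> is_L2 mu (fun x => g (u + x)).
Proof.
move=> gL; have ig := rintegrable_leb_shift u (is_L2_rintegrable gL).
apply: (is_L2_le _ ig) => //.
exact: (cmeasurable_comp (is_L2_cmeasurable gL) (measurable_addrV u)).
Qed.

Definition orb_kernel (r : R) (phi : V * V -> R[i]) := symbol_kernel (eta lam r) phi.

Lemma calA_schwartz (f : G -> R[i]) : calA f -> schwartz f. Proof. by case. Qed.

Lemma schwartz_fhat (f : G -> R[i]) : schwartz f -> schwartz (fhat f).
Proof. by move=> sf; rewrite fhatE//; exact: schwartz_FT2. Qed.

Lemma schwartz_fhat_slice (f : G -> R[i]) r : schwartz f -> schwartz (fun z : V * V => fhat f (z.1, z.2, r)).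
Proof.
move=> sf; have := schwartz_slice1 (schwartz_fhat sf) r.
by congr schwartz; apply/funext => -[].
Qed.

(** [fhat] transforms first in [y] and then in [x]; only the second step is undone, which leaves the
    transform in [y] that occurs in the kernel of [rep]. *)
Lemma IFT_fhat (f : G -> R[i]) r (x q : V) : schwartz f ->
  IFT (fun z : V * V => fhat f (z.1, z.2, r)) (x, q) =
  cintegral mu (fun y => f (x, y, r) * ebar (dot q y)).
Proof.
move=> sf; rewrite fhatE//.
pose A (p : V * (V * R)) : G := ((p.2.1, p.1), p.2.2).
pose B (p : V * (V * R)) : V * (V * R) := (p.2.1, (p.1, p.2.2)).
have sA : schwartz (f \o A).
  apply: (@schwartz_pullback _ _ _ A A 1) => // -[a [b s]].
  by rewrite mul1r !prod_normE /= maxA [Num.max `|a| `|b|]maxC.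
have sB : schwartz (FT (f \o A) \o B).
  apply: (@schwartz_pullback _ _ _ B B 1) => //; last exact: schwartz_FT.
  by move=> [a [b s]]; rewrite mul1r !prod_normE /= maxCA.
exact: (congr1 (fun h => h (x, (q, r))) (FTK sB)).
Qed.

Lemma rep_kop (r : R) (r0 : r != 0) (f : G -> R[i]) : calA f ->
  rep lam (irr_orb r r0) f = kop (mu := mu) (orb_kernel r (restriction (irr_orb r r0) (fhat f))).
Proof.
move=> /calA_schwartz sf; apply/funext => xi /=; rewrite /kop; congr toL2.
apply/funext => u; set g := L2rep xi; have gL : is_L2 mu g := is_L2_L2rep xi.
have e0 := eta_neq0 r0; set eta := eta lam r in e0 *.
have sr : schwartz (fun z : V * V => f (z, r)) by exact: schwartz_slice1.
have [C C0 fC] := schwartz_two_weights sr.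
have iw := rintegrable_weight R n.
have guL := is_L2_shift u gL.
have iwg := rintegrable_om_normc (@weight_ge0 R n) (@weight_le1 R n) iw guL.
have mF : cmeasurable (fun z : V * V => f (z.1, z.2, r) * ebar (eta * dot u z.2) * g (u + z.1)).
  apply: cmeasurableM; last first.
    exact: (cmeasurable_comp (is_L2_cmeasurable guL) measurable_fst).
  apply: cmeasurableM.
    by have := schwartz_cmeasurable_rV2 sr; congr cmeasurable; apply/funext => -[].
  apply: cmeasurable_ebar; apply: measurable_funM => //.
  exact: (measurableT_comp (measurable_dot u) measurable_snd).
have Fb x y : normc (f ((x, y).1, (x, y).2, r) * ebar (eta * dot u (x, y).2) * g (u + (x, y).1)) <=
    C * (w x * normc (g (u + x))) * w y.
  rewrite !normcM normc_ebar mulr1 /=.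
  rewrite (_ : _ * w y = C * (w x * w y) * normc (g (u + x))); last by ring.
  by rewrite ler_wpM2r ?normc_ge0//; exact: fC.
have sphi := schwartz_fhat_slice r sf.
have dk := symbol_kernel_dominated e0 sphi.
rewrite (leb2_fubini mF (rintegrableZ C iwg) iw Fb).1 /kfun.
(* The kernel is integrated over v = u + x, while [rep] integrates over [x]; after the translation
   the two integrands agree for each [x]. *)
rewrite -[RHS](cintegral_leb_shift u); last first.
  exact: (kfun_integrable (@weight_ge0 R n) (@weight_le1 R n) iw dk gL).
apply: eq_cintegral => x.
rewrite -[LHS]/(cintegral mu (fun y => f (x, y, r) * ebar (eta * dot u y) * g (u + x))).
rewrite cintegralZr; last first.
  pose A (p : V * (V * R)) : G := ((p.2.1, p.1), p.2.2).
  have sA : schwartz (f \o A).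
    apply: (@schwartz_pullback _ _ _ A A 1) => // -[a [b s]].
    by rewrite mul1r !prod_normE /= maxA [Num.max `|a| `|b|]maxC.
  have := cintegrable_FT (eta *: u) (x, r) sA.
  by congr cintegrable; apply/funext => y; rewrite dotZl.
congr (_ * _); rewrite /orb_kernel /symbol_kernel /= IFT_fhat//.
rewrite [u + x]addrC addrK; apply: eq_cintegral => y; by rewrite dotZl.
Qed.

Lemma calA_exists (phi : V * V -> R[i]) (r : R) : schwartz phi ->
  exists f : G -> R[i], calA f /\ forall p q, fhat f (p, q, r) = phi (p, q).
Proof.
move=> sp; have [b [sb br [M bM]]] := bump_exists r.
have sF := schwartz_tensor sp (schwartz_realC sb).
have sI := schwartz_IFT2 sF.
exists (IFT2 (fun g : G => phi g.1 * (b g.2)%:C)); split.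
  split => //; exists M => x y s Ms; apply: IFT2_slice0 => p q /=.
  by rewrite bM//; rewrite -[_ %:C]/(0 : R[i]) mulr0.
by move=> p q; rewrite fhatE// IFT2K//= br -[1%:C]/(1 : R[i]) mulr1.
Qed.

(* Test against f = conj (m (u0, _)): the Schwartz function kfun mu m f vanishes
   almost everywhere, hence at u0, where its value is the integral of |m (u0, _)|^2. *)
Lemma schwartz_kernel_eq0 (m : V * V -> R[i]) : schwartz m ->
  (forall f, schwartz f -> {ae mu, forall u, kfun mu m f u = 0}) ->
  forall u v, m (u, v) = 0.
Proof.
move=> sm mf0 u0.
pose f (v : V) := conjc (m (u0, v)).
have sf : schwartz f by apply: schwartz_conj; exact: (schwartz_slice2 sm u0).
have fL := schwartz_is_L2 sf.
(* Integration over [v] is the Fourier transform of [Y] at frequency 0, so that [kfun mu m f] is a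
   Schwartz function by [schwartz_FT]. *)
pose Y (p : V * V) := m (p.2, p.1) * f p.1.
have sY : schwartz Y.
  pose A (p : V * V) : (V * V) * V := ((p.2, p.1), p.1).
  apply: (@schwartz_pullback _ _ _ A A 1 _ _ _ (schwartz_tensor sm sf)); first by [].
  by move=> [a b]; rewrite mul1r !prod_normE /= !ge_max !le_max !lexx ?orbT.
have YE u : FT Y (0, u) = kfun mu m f u.
  rewrite /FT /kfun; apply: eq_cintegral => v; rewrite /Y /=.
  rewrite (_ : dot 0 v = 0); first by rewrite /ebar oppr0 e0 mulr1.
  by rewrite /dot big1// => i _; rewrite mxE mul0r.
have kae : {ae mu, forall u, FT Y (0, u) = 0}.
  by apply: filterS (mf0 f sf) => u h; rewrite YE.
have k0 := schwartz_ae_eq0 (schwartz_slice2 (schwartz_FT sY) 0) kae.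
have f0 : \int[mu]_v sqnormc (f v) = 0.
  have := congr1 (fun h => Re (h u0)) k0; rewrite YE /kfun /= => <-.
  apply: eq_Rintegral => v _; rewrite /f.
  by rewrite -[sqnormc _]Re_mul_conjc conjcK' mulrC.
have h := schwartz_ae_eq0 sf (sqnormc_ae_eq0 fL f0).
move=> v; have := congr1 (fun h => conjc (h v)) h; rewrite /f conjcK' => ->.
by apply: complexP; rewrite /= ?oppr0.
Qed.

Lemma kop_kernel_inj (K L : V * V -> R[i]) : schwartz K -> schwartz L ->
  kop (mu := mu) K = kop (mu := mu) L -> K = L.
Proof.
move=> sK sL KL.
have iw := rintegrable_weight R n.
have dK := schwartz_dominated sK; have dL := schwartz_dominated sL.
have m0 := @schwartz_kernel_eq0 (fun p => K p + - L p) (schwartzD sK (schwartzN sL)).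
apply/funext => -[u v]; apply/eqP; rewrite -subr_eq0; apply/eqP; apply: m0 => f sf.
have fL := schwartz_is_L2 sf.
have iK x := kfun_integrable (@weight_ge0 R n) (@weight_le1 R n) iw dK fL x.
have iL x := kfun_integrable (@weight_ge0 R n) (@weight_le1 R n) iw dL fL x.
have KL1 := kfun_is_L2 (@weight_ge0 R n) (@weight_le1 R n) iw dK fL.
have KL2 := kfun_is_L2 (@weight_ge0 R n) (@weight_le1 R n) iw dL fL.
have := congr1 (fun T => T (toL2 mu f)) KL.
rewrite (kop_toL2 (@weight_ge0 R n) (@weight_le1 R n) iw dK fL).
rewrite (kop_toL2 (@weight_ge0 R n) (@weight_le1 R n) iw dL fL).
move=> /(toL2_eqP KL1 KL2); apply: filterS => x h.
transitivity (kfun mu K f x + (-1) * kfun mu L f x); last by rewrite h mulN1r subrr.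
rewrite -(cintegralZl (-1) (iL x)) -(cintegralD (iK x) (cintegrableZ (-1) (iL x))).
by apply: eq_cintegral => y; rewrite mulrDl mulN1r mulNr.
Qed.

Lemma kop_symbol_inj (eta : R) (phi psi : V * V -> R[i]) : eta != 0 ->
  schwartz phi -> schwartz psi ->
  kop (mu := mu) (symbol_kernel eta phi) = kop (mu := mu) (symbol_kernel eta psi) -> phi = psi.
Proof.
move=> eta0 sp sq /(kop_kernel_inj (schwartz_symbol_kernel eta0 sp) (schwartz_symbol_kernel eta0 sq)) EK.
rewrite -(IFTK sp) -(IFTK sq); congr FT; apply/funext => -[x b].
(* This point is the preimage of (x, b) under (u, v) |-> (v - u, eta u), so the kernels determine
   the inverse transforms everywhere. *)
have := congr1 (fun h => h (eta^-1 *: b, eta^-1 *: b + x)) EK; rewrite /symbol_kernel /=.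
by rewrite [_ + x]addrC addrK scalerA divff// scale1r.
Qed.

End operators.

(** For the one-point orbits: a function there prescribes a single value of [fhat f], which a
    multiple of a tensor product of two such functions attains. *)
Lemma schwartz_value1 (R : realType) n (p : 'rV[R]_n) :
  exists2 f : 'rV[R]_n -> R[i], schwartz f & f p = 1.
Proof.
elim: n p => [|n ih] p.
  have [b [sb b0 _]] := bump_exists (0 : R).
  exists (fun=> (b 0)%:C); last by rewrite b0.
  apply: (@schwartz_pullback _ _ _ (fun=> 0 : R) (fun=> 0) 1 _ _ _ (schwartz_realC sb)).
    by move=> h x v; rewrite scaler0 addr0.
  by move=> x; rewrite (rV0_eq0 x) !normr0 mulr0.
have [g sg gp] := ih (uncons_rV p).2.
have [b [sb bp _]] := bump_exists (uncons_rV p).1.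
exists (fun v => (b (uncons_rV v).1)%:C * g (uncons_rV v).2); last by rewrite bp gp mulr1.
have st := schwartz_tensor (schwartz_realC sb) sg.
apply: (@schwartz_pullback _ _ _ (@uncons_rV R n) (@uncons_rV R n) 1 _ _ _ st).
  move=> h x v; rewrite /uncons_rV; congr pair; rewrite /= ?mxE//.
  by apply/rowP => i; rewrite !mxE.
by move=> x; rewrite mul1r -norm_cons_rV uncons_rVK.
Qed.

Section L2_equality.
Context d (T : measurableType d) (R : realType) (mu : {measure set T -> \bar R}).

Lemma toL2_eq_null (f g : T -> R[i]) : is_L2 mu f -> is_L2 mu g ->
  mu [set x | f x <> g x] = 0%E -> toL2 mu f = toL2 mu g.
Proof.
move=> fL gL fg0; apply/(toL2_eqP fL gL); exists [set x | f x <> g x]; split => //.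
rewrite (_ : [set x | f x <> g x] = (fun x => sqnormc ((-1) * g x + f x)) @^-1` (~` [set 0])).
  have [f1 f2] := is_L2_cmeasurable (is_L2_lin (-1) gL fL).
  by rewrite -[X in measurable X]setTI; apply: (measurable_sqnormc f1 f2) => //; exact: measurableC.
apply/seteqP; split => x /= fgx h; apply: fgx.
  by move/sqnormc_eq0 : h; rewrite mulN1r addrC => /eqP; rewrite subr_eq0 => /eqP.
by rewrite h mulN1r addNr /sqnormc /= !expr0n /= addr0.
Qed.

End L2_equality.

(** * The quantization map and the deformed operations *)

Section quantization.
Context (R : realType) (n : nat) (lam : R).
Local Notation V := 'rV[R]_n.
Local Notation G := (V * V * R)%type.
Local Notation mu := (leb R n).
Implicit Types rho : irrep R n.

Lemma Sc_inj rho (phi psi : Sc rho) : Sc_fun phi = Sc_fun psi -> phi = psi.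
Proof.
case: phi psi => f sf [g sg] /= fg; move: sf sg; rewrite fg => sf sg.
by congr MkSc; exact: Prop_irrelevance.
Qed.

Lemma restriction_fhat_surjective rho (phi : Sc rho) :
  exists f, calA f /\ restriction rho (fhat f) = phi.
Proof.
case: rho phi => [p q|r r0] [phi sp] /=.
  have [g sg gp] := schwartz_value1 p; have [h sh hq] := schwartz_value1 q.
  have [f [Af fE]] := calA_exists 0 (schwartz_tensor sg (schwartzZ (phi tt) sh)).
  exists f; split => //; apply/funext => -[]; rewrite /restriction /= fE /= gp hq.
  by rewrite mul1r mulr1.
have [f [Af fE]] := calA_exists r sp.
by exists f; split => //; apply/funext => -[p q]; exact: fE.
Qed.

Lemma rep_restriction rho f g : calA f -> calA g ->
  restriction rho (fhat f) = restriction rho (fhat g) -> rep lam rho f = rep lam rho g.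
Proof.
case: rho => [p q|r r0] Af Ag fg.
  (* On a point orbit [rep] is, by conversion, multiplication by the value of [fhat f] there. *)
  exact: (congr1 (fun h => (fun z => h tt * z)) fg).
by rewrite (rep_kop lam r0 Af) (rep_kop lam r0 Ag) fg.
Qed.

Lemma Q_rep rho (phi : Sc rho) f :
  calA f -> restriction rho (fhat f) = phi -> Q lam phi = rep lam rho f.
Proof.
move=> Af fE.
have [Ag gE] := xgetPex (fun=> 0) (restriction_fhat_surjective phi).
by apply: rep_restriction => //; rewrite gE fE.
Qed.

Lemma Q_pt (p q : V) (phi : Sc (irr_pt p q)) : Q lam phi = (fun z => phi tt * z).
Proof.
by have [f [Af fE]] := restriction_fhat_surjective phi; rewrite (Q_rep Af fE) -fE.
Qed.

Lemma Q_orb (r : R) (r0 : r != 0) (phi : Sc (irr_orb r r0)) : Q lam phi = kop (mu := mu) (orb_kernel lam r phi).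
Proof.
have [f [Af fE]] := restriction_fhat_surjective phi.
by rewrite (Q_rep Af fE) -fE; exact: rep_kop.
Qed.

(** Both operations are prescribed only through [Q]; injectivity turns such a prescription into
    uniqueness. *)
Lemma Q_inj rho (phi psi : Sc rho) : Q lam phi = Q lam psi -> phi = psi.
Proof.
case: rho phi psi => [p q|r r0] phi psi.
  rewrite !Q_pt => h; apply: Sc_inj; apply/funext => -[].
  by have := congr1 (fun T => T (1 : R[i])) h; rewrite !mulr1.
rewrite !Q_orb => h; apply: Sc_inj.
exact: (kop_symbol_inj (eta_neq0 lam r0) (Sc_prop phi) (Sc_prop psi) h).
Qed.

Lemma hnorm_pt (p q : V) (z : hilb (irr_pt p q)) : hnorm z = normc (z : R[i]).
Proof. by rewrite /hnorm /= Re_mul_conjc -sqr_normcE sqrtr_sqr ger0_norm// normc_ge0. Qed.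

Lemma inner_nondegenerate rho (xi zeta : hilb rho) :
  (forall chi, inner chi xi = inner chi zeta) -> xi = zeta.
Proof.
case: rho xi zeta => [p q|r r0] /= xi zeta; last exact: L2inner_nondegenerate.
by move=> /(_ 1); rewrite !mul1r => /(congr1 (@conjc R)); rewrite !conjcK'.
Qed.

Lemma Q_bounded rho (phi : Sc rho) : bounded_operator (Q lam phi).
Proof.
case: rho phi => [p q|r r0] phi.
  rewrite Q_pt; split=> [a z w|]; first by rewrite mulrDr -[_ *: _]/(a * z) mulrCA.
  by exists (normc (phi tt)) => z; rewrite !hnorm_pt normcM.
have dk := symbol_kernel_dominated (eta_neq0 lam r0) (Sc_prop phi).
rewrite Q_orb; split.
  exact: (kop_linear (@weight_ge0 R n) (@weight_le1 R n) (rintegrable_weight R n) dk).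
exact: (kop_bounded (@weight_ge0 R n) (@weight_le1 R n) (rintegrable_weight R n) dk).
Qed.

Lemma schwartz_leb2_L2 (phi : V * V -> R[i]) : schwartz phi -> is_L2 (leb2 R n) phi.
Proof.
move=> sp; have [C C0 pC] := schwartz_two_weights sp.
have mp := schwartz_cmeasurable_rV2 sp; have iw := rintegrable_weight R n.
have iC : rintegrable (leb2 R n) (fun z => sqnormc (phi z)).
  have [p1 p2] := mp.
  apply: (fub_prod (measurable_sqnormc p1 p2) (rintegrableZ (C ^+ 2) iw) iw) => x y.
  rewrite ger0_norm ?sqnormc_ge0// -sqr_normcE.
  have w1 := weight_ge0 x; have w2 := weight_ge0 y.
  apply: (@le_trans _ _ ((C * (weight x * weight y)) ^+ 2)).
    by apply: lerXn2r; rewrite ?nnegrE; [exact: normc_ge0|rewrite !mulr_ge0|exact: pC].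
  rewrite exprMn -mulrA ler_wpM2l ?sqr_ge0// expr2 ler_piMr ?mulr_ge0//.
  by rewrite mulr_ile1 ?weight_le1.
by apply: (is_L2_le mp iC).
Qed.

Lemma is_L2_dtheta_pt (p q : V) (F : G -> R[i]) : cmeasurable F ->
  is_L2 (dtheta lam (irr_pt p q)) F.
Proof.
move=> [F1 F2]; split => //=; rewrite integral_dirac//; last first.
  by apply/measurable_EFinP; exact: measurable_sqnormc.
by rewrite diracT mul1e ltry.
Qed.

Lemma is_L2_dtheta_orb (r : R) (r0 : r != 0) (F : G -> R[i]) : cmeasurable F ->
  schwartz (fun z : V * V => F (z.1, z.2, r)) -> is_L2 (dtheta lam (irr_orb r r0)) F.
Proof.
move=> [F1 F2] sF; split => //.
have mF : measurable_fun setT (fun g => (sqnormc (F g))%:E).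
  by apply/measurable_EFinP; exact: measurable_sqnormc.
have [_ _ foo] := schwartz_leb2_L2 sF.
rewrite (ge0_integral_pushforward (@measurable_emb R n r) _ measurableT mF); last first.
  by move=> g _; rewrite lee_fin sqnormc_ge0.
rewrite preimage_setT ge0_integral_mscale//; last 2 first.
  exact: (measurableT_comp mF (@measurable_emb R n r)).
  by move=> z _; rewrite lee_fin sqnormc_ge0.
by rewrite lte_mul_pinfty.
Qed.

(** [orbit_class] extends [phi] off the orbit independently of [r], whereas [fhat f] varies with
    [r]; [dtheta] is carried by the orbit, where they agree, so they have the same class. *)
Lemma orbit_class_fhat rho (phi : Sc rho) f : calA f ->
  restriction rho (fhat f) = phi -> orbit_class lam phi = toL2 (dtheta lam rho) (fhat f).
Proof.
case: rho phi => [p q|r r0] phi Af fE; have sf := schwartz_fhat (calA_schwartz Af).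
  have mf := schwartz_cmeasurable_rV2R sf.
  apply: toL2_eq_null.
  - by apply: is_L2_dtheta_pt; exact: cmeasurable_cst.
  - exact: is_L2_dtheta_pt.
  - rewrite /= diracE memNset//= => h; apply: h.
    by rewrite -fE.
have mf := schwartz_cmeasurable_rV2R sf.
have mphi : cmeasurable (fun g : G => phi g.1).
  by apply: (cmeasurable_comp (schwartz_cmeasurable_rV2 (Sc_prop phi))); exact: measurable_fst.
apply: toL2_eq_null.
- apply: is_L2_dtheta_orb => //.
  by have := Sc_prop phi; congr schwartz; apply/funext => -[].
- apply: is_L2_dtheta_orb => //.
  exact: (schwartz_fhat_slice r (calA_schwartz Af)).
- rewrite /= /pushforward (_ : _ @^-1` _ = set0) ?measure0//.
  apply/seteqP; split => // -[a b] /=; apply.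
  by rewrite -fE.
Qed.

Lemma S_orbit_class rho S : is_S lam rho S ->
  forall phi : Sc rho, S (orbit_class lam phi) = Q lam phi.
Proof.
move=> hS phi; have [f [Af fE]] := restriction_fhat_surjective phi.
by rewrite (orbit_class_fhat Af fE) (Q_rep Af fE); exact: (S_rep hS Af).
Qed.

Lemma deformed_product_unique rho (mul mul' : Sc rho -> Sc rho -> Sc rho) :
  deformed_product lam mul -> deformed_product lam mul' -> mul = mul'.
Proof. by move=> h h'; apply/funext => phi; apply/funext => psi; apply: Q_inj; rewrite h h'. Qed.

Lemma deformed_involution_unique rho (star star' : Sc rho -> Sc rho) :
  deformed_involution lam star -> deformed_involution lam star' -> star = star'.
Proof.
move=> h h'; apply/funext => psi; apply: Q_inj; apply/funext => zeta.
by apply: inner_nondegenerate => xi; rewrite -h -h'.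
Qed.

Section point.
Variables (p q : V).

Definition mul_pt (phi psi : Sc (irr_pt p q)) : Sc (irr_pt p q) :=
  @MkSc R n (irr_pt p q) (fun=> phi tt * psi tt) I.

Definition star_pt (psi : Sc (irr_pt p q)) : Sc (irr_pt p q) :=
  @MkSc R n (irr_pt p q) (fun=> conjc (psi tt)) I.

Lemma deformed_product_pt : deformed_product lam mul_pt.
Proof. by move=> phi psi; rewrite !Q_pt; apply/funext => z /=; rewrite mulrA. Qed.

Lemma deformed_involution_pt : deformed_involution lam star_pt.
Proof.
move=> psi xi zeta; rewrite !Q_pt /=.
by rewrite conjcM conjcK' mulrCA mulrA.
Qed.

End point.

Section plane.
Variables (r : R) (r0 : r != 0).
Let eta0 := eta_neq0 lam r0.

Definition mul_orb (phi psi : Sc (irr_orb r r0)) : Sc (irr_orb r r0) :=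
  @MkSc R n (irr_orb r r0) (mulf (eta lam r) phi psi)
    (schwartz_mulf (eta lam r) (Sc_prop phi) (Sc_prop psi)).

Definition star_orb (psi : Sc (irr_orb r r0)) : Sc (irr_orb r r0) :=
  @MkSc R n (irr_orb r r0) (starf (eta lam r) psi) (schwartz_starf (eta lam r) (Sc_prop psi)).

Lemma deformed_product_orb : deformed_product lam mul_orb.
Proof.
move=> phi psi; have sp := Sc_prop phi; have sq := Sc_prop psi.
rewrite !Q_orb; apply/funext => xi; apply: esym.
apply: (kop_comp (@weight_ge0 R n) (@weight_le1 R n) (rintegrable_weight R n)
  (symbol_kernel_dominated eta0 sp) (symbol_kernel_dominated eta0 sq)
  (symbol_kernel_dominated eta0 (schwartz_mulf (eta lam r) sp sq))) => u v.
exact: symbol_kernel_mulf.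
Qed.

Lemma deformed_involution_orb : deformed_involution lam star_orb.
Proof.
move=> psi xi zeta; have sq := Sc_prop psi; rewrite !Q_orb.
apply: (kop_adjoint (@weight_ge0 R n) (@weight_le1 R n) (rintegrable_weight R n)
  (symbol_kernel_dominated eta0 sq)
  (symbol_kernel_dominated eta0 (schwartz_starf (eta lam r) sq))) => u v.
exact: symbol_kernel_starf.
Qed.

End plane.

(** Outside the larger box the integrand vanishes identically. If |b| > M this is due to [phi].
    Otherwise the maximum norm of (a, b) is attained by [a], so |a| exceeds N, and [psi (a, _)]
    vanishes wherever its second argument has moved. *)
Lemma mulf_compactly_supported (et : R) (phi psi : V * V -> R[i]) : et != 0 ->
  schwartz phi -> schwartz psi ->
  compactly_supported phi -> compactly_supported psi -> compactly_supported (mulf et phi psi).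
Proof.
move=> et0 sp sq [M phiM] [N psiN]; exists (Num.max M N) => -[a b].
rewrite prod_normE gt_max => /andP[Mab Nab]; rewrite mulf_formula//.
rewrite -[RHS](cintegral0 (leb2 R n)); apply: eq_cintegral => z /=.
have [Mb|bM] := ltP M `|b|.
  by rewrite phiM ?mul0r// prod_normE lt_max Mb orbT.
have Ma : M < `|a| by move: Mab; rewrite lt_max => /orP[//|]; rewrite ltNge bM.
rewrite psiN ?mulr0 ?mul0r// prod_normE lt_max; apply/orP; left.
by move: Nab; rewrite lt_max => /orP[//|Nb]; rewrite (lt_trans (lt_le_trans Nb bM)).
Qed.

End quantization.

Theorem proposition4p2 (R : realType) (n : nat) (n1 : (1 <= n)%N) (lam : R) :
  (* Q is a well-defined map from S_c(O) to B(H), and the restriction of S *)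
  (forall rho : irrep R n,
    [/\ forall phi : Sc rho, exists f,
          calA f /\ restriction rho (fhat f) = phi,
        forall (phi : Sc rho) f,
          calA f -> restriction rho (fhat f) = phi -> Q lam phi = rep lam rho f,
        forall S, is_S lam rho S ->
          forall phi : Sc rho, S (orbit_class lam phi) = Q lam phi
      & forall phi : Sc rho, bounded_operator (Q lam phi)]) /\
  (* Q determines a product and an involution on S_c(O) *)
  (forall rho : irrep R n,
    (exists! mul : Sc rho -> Sc rho -> Sc rho, deformed_product lam mul) /\
    (exists! star : Sc rho -> Sc rho, deformed_involution lam star)) /\
  (forall (p q : 'rV[R]_n)
      (mul : Sc (irr_pt p q) -> Sc (irr_pt p q) -> Sc (irr_pt p q))
      (star : Sc (irr_pt p q) -> Sc (irr_pt p q)),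
    deformed_product lam mul -> deformed_involution lam star ->
    forall phi psi : Sc (irr_pt p q),
      mul phi psi tt = phi tt * psi tt /\ star psi tt = conjc (psi tt)) /\
  (forall (r : R) (r0 : r != 0)
      (mul : Sc (irr_orb r r0) -> Sc (irr_orb r r0) -> Sc (irr_orb r r0))
      (star : Sc (irr_orb r r0) -> Sc (irr_orb r r0)),
    deformed_product lam mul -> deformed_involution lam star ->
    forall phi psi : Sc (irr_orb r r0),
      [/\ forall alpha beta : 'rV[R]_n,
            mul phi psi (alpha, beta) =
            \cint[leb2 R n]_z
              (phi (z.1, beta) * psi (alpha, beta + eta lam r *: z.2)
               * e (dot (z.1 - alpha) z.2)),
          (* iterated: not absolutely convergent in (w, z) *)
          forall alpha beta : 'rV[R]_n,
            star psi (alpha, beta) =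
            \cint[leb2 R n]_w \cint[leb2 R n]_z
              (conjc (psi z) * ebar (dot (alpha - z.1) w.1 + dot (beta - z.2) w.2)
               * ebar (eta lam r * dot w.1 w.2))
        & compactly_supported phi -> compactly_supported psi ->
          compactly_supported (mul phi psi)]).

Proof.
split; [|split; [|split]].
- move=> rho; split.
  + exact: restriction_fhat_surjective.
  + exact: Q_rep.
  + exact: S_orbit_class.
  + exact: Q_bounded.
- case=> [p q|r r0]; split.
  + exists (@mul_pt R n p q); split; first exact: deformed_product_pt.
    by move=> mul; exact: deformed_product_unique (@deformed_product_pt R n lam p q).
  + exists (@star_pt R n p q); split; first exact: deformed_involution_pt.
    by move=> star; exact: deformed_involution_unique (@deformed_involution_pt R n lam p q).
  + exists (@mul_orb R n lam r r0); split; first exact: deformed_product_orb.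
    by move=> mul; exact: deformed_product_unique (@deformed_product_orb R n lam r r0).
  + exists (@star_orb R n lam r r0); split; first exact: deformed_involution_orb.
    by move=> star; exact: deformed_involution_unique (@deformed_involution_orb R n lam r r0).
- move=> p q mul star hmul hstar phi psi.
  rewrite (deformed_product_unique hmul (@deformed_product_pt R n lam p q)).
  by rewrite (deformed_involution_unique hstar (@deformed_involution_pt R n lam p q)).
- move=> r r0 mul star hmul hstar phi psi.
  rewrite (deformed_product_unique hmul (@deformed_product_orb R n lam r r0)).
  rewrite (deformed_involution_unique hstar (@deformed_involution_orb R n lam r r0)).
  have sp := Sc_prop phi; have sq := Sc_prop psi; have eta0 := eta_neq0 lam r0.
  split.
  + by move=> alpha beta; exact: mulf_formula.
  + by move=> alpha beta; exact: starf_formula.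
  + exact: mulf_compactly_supported.
Qed.
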